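(* Let $q$ be a power of an odd prime and let $n\ge3$, with $n/2\ge3$ if $n$ is even. Then the Bruhat stack $\mathcal B_{J,K}(\mathrm{GO}(V,b))$ is connected and consists of precisely three points $\mathrm{id}$, $s_1$, and $w_1$, where $\mathrm{id}$ is a specialization of $s_1$, and $s_1$ is a specialization of $w_1$. Here the points are parametrized by ${}^JW^K=\{\mathrm{id},s_1,w_1\}$, with $w_1$ the element of maximal length in ${}^JW^K$.
   Context: Let $b$ be a non-degenerate split symmetric bilinear form on $V=\mathbb F_q^n$ and let $\hat G=\mathrm{GO}(V,b)$ be the group of orthogonal similitudes over $\mathbb F_q$, with identity component $G$ (which is split reductive, and equals $\hat G$ if $n$ is odd, while $\pi_0(\hat G)\cong\mathbb Z/2$ if $n$ is even). Let $\mu$ be a cocharacter of $\mathrm{GO}(V,b)$ whose weights on $V$ are $0,1,2$ with multiplicities $1,n-2,1$; choose a split maximal torus $T$ and a Borel subgroup $B\supseteq T$ of $G$ such that $\mu$ is a $B$-dominant cocharacter of $T$. Let $W\subseteq\hat W$ be the Weyl groups $\mathrm{Norm}_G(T)/T$, $\mathrm{Norm}_{\hat G}(T)/T$ (on $\overline{\mathbb F}_q$-points), $I\subset W$ the simple reflections, $J=\{i\in I:\langle\mu,\alpha_i\rangle=0\}$, where $\alpha_i$ is the simple root corresponding to $i$, and $K=w_0Jw_0$ ($w_0$ the longest element of $W$); in this case $K=J$. Explicitly, for $n=2m+1$, $W=\{\sigma\in S_n:\sigma(i)+\sigma(n+1-i)=n+1\ \forall i\}$ with $s_i=(i,i+1)(n-i,n-i+1)$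 for $1\le i\le m-1$ and $s_m=(m,m+2)$; for $n=2m$, $\hat W=\{\sigma\in S_n:\sigma(i)+\sigma(n+1-i)=n+1\ \forall i\}$, $W=\{\sigma\in\hat W:\#\{1\le i\le m:\sigma(i)>m\}\text{ even}\}$, $s_i=(i,i+1)(n-i,n-i+1)$ for $1\le i\le m-1$ and $s_m=(m-1,m+1)(m,m+2)$. In both cases $I=\{s_1,\dots,s_m\}$ and $J=K=\{s_2,\dots,s_m\}$. ${}^JW^K$ is the set of $w\in W$ of minimal length in $W_JwW_K$, where $W_J=\langle J\rangle$, $W_K=\langle K\rangle$. Let $P_J\supseteq B$ be the parabolic subgroup of $G$ of type $J$, $\Theta=\Delta=\pi_0(\mathrm{Cent}_{\hat G}(\mu))$ (trivial if $n$ is odd, equal to $\pi_0(\hat G)$ if $n$ is even), and let $\hat P_{J,\Theta}\subseteq\mathrm{Norm}_{\hat G}(P_J)$ be the subgroup with identity component $P_J$ and component group $\Theta$; likewise $\hat P_{K,\Delta}$. The Bruhat stack is $$\mathcal B_{J,K}(\mathrm{GO}(V,b))=[\hat G\backslash(\hat G/\hat P_{J,\Theta}\times\hat G/\hat P_{K,\Delta})]\cong[\hat P_{J,\Theta}\backslash\hat G/\hat P_{K,\Delta}],$$ and $w\in{}^JW^K$ labels the point given by the double coset $\hat P_{J,\Theta}\dot w\hat P_{K,\Delta}$, $\dot w$ a representative of $w$ in $\mathrm{Norm}_G(T)$.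
   Formalization: For n=3 the set J is empty and W={id,s_1}, so w_1=s_1 and the stack has only two points; the three points id, s_1, w_1 are therefore claimed to be pairwise distinct only for n≠3, while all other claims are kept for n=3. *)

(* Defs.v *)
From HB Require Import structures.
From Stdlib Require Import Relation_Operators.
From mathcomp Require Import all_boot all_order all_fingroup all_algebra.
From mathcomp Require Import all_classical topology.
From mathcomp.multinomials Require Import mpoly.

Set Implicit Arguments.
Unset Strict Implicit.
Unset Printing Implicit Defensive.

Import GroupScope Order.TTheory GRing.Theory Num.Theory.

Local Open Scope classical_set_scope.
Local Open Scope ring_scope.

(* Indices run over 0, ..., n-1, so rev_ord is i |-> n+1-i of the 1-based
   notation, and s_1, ..., s_m (m = n./2) are indexed by 'I_(n./2) from 0.
   The product of {perm T} is (s * t) x = t (s x), opposite to composition. *)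
Section Weyl.
Variable n : nat.

Lemma half_le : (n./2 <= n)%N.
Proof. by rewrite -{2}(odd_double_half n) -addnn addnA leq_addl. Qed.

Definition weyl_hat : {set 'S_n} :=
  [set s : 'S_n | [forall i, s (rev_ord i) == rev_ord (s i)]]%SET.

Definition weyl : {set 'S_n} :=
  [set s in weyl_hat
  | odd n || ~~ odd #|[set i : 'I_n | (i < n./2)%N && (n./2 <= s i)%N]%SET|]%SET.

(* The simple root alpha_j is the restriction of eps_a - eps_b to the diagonal
   torus, (a, b) = simple_root j; ordS and ord_pred never wrap around here
   when 2 < n.  For n = 2m, eps_(m-1) - eps_(m+1) = eps_(m-1) + eps_m modulo
   the similitude character (1-based). *)
Definition simple_root (j : 'I_(n./2)) : 'I_n * 'I_n :=
  let i := widen_ord half_le j in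
  if (j.+1 < n./2)%N || odd n then (i, ordS i) else (ord_pred i, rev_ord i).

Definition simple_refl (j : 'I_(n./2)) : 'S_n :=
  let i := widen_ord half_le j in
  if (j.+1 < n./2)%N then
    (tperm i (ordS i) * tperm (rev_ord i) (rev_ord (ordS i)))%g
  else if odd n then tperm i (rev_ord i)
  else (tperm (ord_pred i) (rev_ord i) * tperm i (rev_ord (ord_pred i)))%g.

(* Word length; a shortest word has fewer than n! letters. *)
Definition weyl_length (w : 'S_n) : nat :=
  find (fun k => [exists t : k.-tuple 'I_(n./2),
                    w == (\prod_(j <- t) simple_refl j)%g])
       (iota 0 #|{perm 'I_n}|).

Definition longest : 'S_n :=
  [arg max_(w > 1%g in weyl) weyl_length w]%N.

(* <c, alpha_j> for the cocharacter t |-> diag (t ^ c i)_i. *)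
Definition root_pairing (c : 'I_n -> int) (j : 'I_(n./2)) : int :=
  c (simple_root j).1 - c (simple_root j).2.

Definition dominant (c : 'I_n -> int) : Prop := forall j, 0 <= root_pairing c j.

Definition typeJ (c : 'I_n -> int) : {set 'S_n} :=
  [set simple_refl j | j : 'I_(n./2) & root_pairing c j == 0]%SET.

Definition typeK (c : 'I_n -> int) : {set 'S_n} :=
  [set (longest * s * longest)%g | s in typeJ c]%SET.

(* W_J w W_K, read in composition order. *)
Definition weyl_dcoset (J K : {set 'S_n}) (w : 'S_n) : {set 'S_n} :=
  (<<K>> :* w * <<J>>)%g.

Definition min_dcoset_reps (J K : {set 'S_n}) : {set 'S_n} :=
  [set w in weyl | [forall v in weyl_dcoset J K w,
                      weyl_length w <= weyl_length v]%N]%SET.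

End Weyl.

(* Algebraic groups over F are given by their points in all extension fields
   of F.  An extension field is a field K with a morphism i : F -> K. *)
Section Similitudes.
Variables (F : fieldType) (n : nat) (b : 'M[F]_n).

Definition split_form : Prop :=
  exists U : 'M[F]_(n./2, n), row_free U /\ U *m b *m U^T = 0.

Definition GO (K : fieldType) (i : {rmorphism F -> K}) (g : 'M[K]_n) : Prop :=
  exists2 c : K, c != 0 & g^T *m map_mx i b *m g = c *: map_mx i b.

(* The kernel of F[x_kl] -> K, x_kl |-> g_kl: the prime ideal of the point of
   affine n^2-space under the K-valued point g. *)
Definition entry_eval (K : fieldType) (i : {rmorphism F -> K}) (g : 'M[K]_n)
    (p : {mpoly F[n * n]}) : K :=
  mmap i (fun k => mxvec g ord0 k) p.

Definition eval_ker (K : fieldType) (i : {rmorphism F -> K}) (g : 'M[K]_n) :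
    set {mpoly F[n * n]} :=
  [set p | entry_eval i g p = 0].

(* The underlying topological space of the scheme GO(V, b): points are the
   primes under its field-valued points. *)
Record GOspace : Type := GOSpace {
  pt_ideal : set {mpoly F[n * n]};
  pt_GO : exists (K : fieldType) (i : {rmorphism F -> K}) (g : 'M[K]_n),
    GO i g /\ pt_ideal = eval_ker i g }.

HB.instance Definition _ := gen_eqMixin GOspace.
HB.instance Definition _ := gen_choiceMixin GOspace.

Definition GOpt (K : fieldType) (i : {rmorphism F -> K}) (g : 'M[K]_n)
    (gGO : GO i g) : GOspace :=
  GOSpace (ex_intro _ K (ex_intro _ i (ex_intro _ g (conj gGO erefl)))).

Definition zariski_open (U : set GOspace) : Prop :=
  exists S : set {mpoly F[n * n]}, U = [set x | ~ S `<=` pt_ideal x].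

Lemma zariski_openT : zariski_open setT.
Proof.
exists [set 1]; apply/seteqP; split => // x _ /= H.
have [K [i [g [gGO xE]]]] := pt_GO x.
have := H 1 erefl; rewrite xE /eval_ker /= /entry_eval rmorph1.
by apply/eqP; rewrite oner_neq0.
Qed.

Lemma entry_evalM (K : fieldType) (i : {rmorphism F -> K}) (g : 'M[K]_n) p q :
  entry_eval i g (p * q) = entry_eval i g p * entry_eval i g q.
Proof. by rewrite /entry_eval; apply: rmorphM. Qed.

Lemma zariski_openI : setI_closed zariski_open.
Proof.
move=> _ _ [S ->] [S' ->].
exists [set p | exists q q', [/\ S q, S' q' & p = q * q']].
apply/seteqP; split => x /=; have [K [i [g [gGO ->]]]] := pt_GO x.
  move=> [/existsNP[q /not_implyP[Sq q0]] /existsNP[q' /not_implyP[Sq' q'0]]].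
  move=> /(_ (q * q')); rewrite /eval_ker /= entry_evalM => H.
  have /eqP : entry_eval i g q * entry_eval i g q' = 0 by apply: H; exists q, q'.
  by rewrite mulf_eq0 => /orP[] /eqP.
move=> /existsNP[_ /not_implyP[[q [q' [Sq Sq' ->]]]]].
rewrite /eval_ker /= entry_evalM => qq'.
split=> [/(_ _ Sq)|/(_ _ Sq')] /= q0; apply: qq'.
  by rewrite q0 mul0r.
by rewrite q0 mulr0.
Qed.

Lemma zariski_open_bigU (I : Type) (f : I -> set GOspace) :
  (forall i, zariski_open (f i)) -> zariski_open (\bigcup_i f i).
Proof.
move=> fo; exists [set p | exists S i,
  S p /\ f i = [set x | ~ S `<=` pt_ideal x]].
apply/seteqP; split => x /=.
  move=> [i _ fix_]; have [S fE] := fo i; move: (fix_); rewrite fE /= => + H.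
  by apply=> p Sp; apply: H; exists S, i.
move=> /existsNP[p /not_implyP[[S [i [Sp fE]]] xp]].
by exists i => //; rewrite fE /= => H; apply: xp; exact: H.
Qed.

HB.instance Definition _ := isOpenTopological.Build GOspace
  zariski_openT zariski_openI zariski_open_bigU.

Lemma GO_one : GO (idfun : {rmorphism F -> F}) 1%:M.
Proof.
by exists 1; rewrite ?oner_neq0 // trmx1 mul1mx mulmx1 scale1r.
Qed.

(* Points of the identity component G of GO(V, b). *)
Definition GOo (K : fieldType) (i : {rmorphism F -> K}) : set 'M[K]_n :=
  [set g | exists h : GO i g,
     connected_component setT (GOpt GO_one) (GOpt h)].

(* The columns of e are a basis e_1, ..., e_n of V with b(e_i, e_j) = 0 for
   i + j != n + 1 (1-based).  The pairs T <= B of a split maximal torus and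
   a Borel subgroup of G are those of the elements of G which are diagonal,
   resp. upper triangular, in such a basis. *)
Definition adapted_basis (e : 'M[F]_n) : Prop :=
  e \in unitmx /\ forall i j, j != rev_ord i -> (e^T *m b *m e) i j = 0.

Variable e : 'M[F]_n.

Definition in_basis (K : fieldType) (i : {rmorphism F -> K}) (g : 'M[K]_n) :=
  invmx (map_mx i e) *m g *m map_mx i e.

Definition borel (K : fieldType) (i : {rmorphism F -> K}) : set 'M[K]_n :=
  [set g | GOo i g /\
     forall k l : 'I_n, (l < k)%N -> in_basis i g k l = 0].

(* Representatives of w in Norm_G(T): g <e_l> = <e_(w l)> for all l. *)
Definition weyl_rep (w : 'S_n) (K : fieldType) (i : {rmorphism F -> K}) :
    set 'M[K]_n :=
  [set g | GOo i g /\ forall k l : 'I_n, k != w l -> in_basis i g k l = 0].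

Definition subgroup_mx (K : fieldType) (S : set 'M[K]_n) : Prop :=
  [/\ S 1%:M, forall g h, S g -> S h -> S (g *m h)
    & forall g, S g -> S (invmx g)].

(* The parabolic subgroup of G of type J containing B. *)
Definition parabolic (J : {set 'S_n}) (K : fieldType)
    (i : {rmorphism F -> K}) : set 'M[K]_n :=
  smallest (@subgroup_mx K)
    (borel i `|` [set g | exists2 s, s \in J & weyl_rep s i g]).

Definition norm_parabolic (J : {set 'S_n}) (K : fieldType)
    (i : {rmorphism F -> K}) : set 'M[K]_n :=
  [set g | GO i g /\
     forall (L : fieldType) (j : {rmorphism K -> L}) (h : 'M[L]_n),
       parabolic J (j \o i) (map_mx j g *m h *m invmx (map_mx j g)) <->
       parabolic J (j \o i) h].

Variable c : 'I_n -> int.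

Definition cochar (K : fieldType) (i : {rmorphism F -> K}) (t : K) : 'M[K]_n :=
  map_mx i e *m diag_mx (\row_k (t ^ c k)) *m invmx (map_mx i e).

Definition is_cochar : Prop :=
  forall (K : fieldType) (i : {rmorphism F -> K}) (t : K),
    t != 0 -> GO i (cochar i t).

Definition cent_cochar (K : fieldType) (i : {rmorphism F -> K}) :
    set 'M[K]_n :=
  [set g | GO i g /\
     forall (L : fieldType) (j : {rmorphism K -> L}) (t : L), t != 0 ->
       map_mx j g *m cochar (j \o i) t = cochar (j \o i) t *m map_mx j g].

(* Elements whose class in pi_0(GO) lies in Theta, the image of
   pi_0(Cent(mu)). *)
Definition in_Theta (K : fieldType) (i : {rmorphism F -> K}) : set 'M[K]_n :=
  [set g | GO i g /\
     exists (L : fieldType) (j : {rmorphism K -> L}) (z : 'M[L]_n),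
       cent_cochar (j \o i) z /\ GOo (j \o i) (map_mx j g *m invmx z)].

(* Since Norm(P_J) meets G in P_J, these are the points of the subgroup of
   Norm(P_J) with identity component P_J and component group Theta. *)
Definition parabolic_hat (J : {set 'S_n}) (K : fieldType)
    (i : {rmorphism F -> K}) : set 'M[K]_n :=
  norm_parabolic J i `&` in_Theta i.

(* The points of a stack [P\H/Q] are those of H, where x and y are identified
   if over some field they have lifts in the same double coset (after a field
   extension every point of the stack lifts to H).  This is an equivalence
   relation since any two extensions of a field embed in a common one; taking
   the generated one yields the quotient without that fact. *)
Definition same_dcoset (J K : {set 'S_n}) (x y : GOspace) : Prop :=
  exists (L : fieldType) (i : {rmorphism F -> L}) (g p q : 'M[L]_n)
         (hg : GO i g) (hpgq : GO i (p *m g *m q)),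
    [/\ parabolic_hat J i p, parabolic_hat K i q, x = GOpt hg & y = GOpt hpgq].

Definition stack_eq (x y : GOspace) : bool :=
  `[< clos_refl_sym_trans _ (same_dcoset (typeJ c) (typeK c)) x y >].

Lemma stack_eq_refl : reflexive stack_eq.
Proof. by move=> x; apply/asboolP; exact: rst_refl. Qed.

Lemma stack_eq_sym : ssrbool.symmetric stack_eq.
Proof.
by move=> x y; apply/asboolP/asboolP => h; exact: rst_sym.
Qed.

Lemma stack_eq_trans : transitive stack_eq.
Proof.
by move=> y x z /asboolP xy /asboolP yz; apply/asboolP; exact: rst_trans xy yz.
Qed.

Canonical stack_equiv : equiv_rel GOspace :=
  EquivRel stack_eq stack_eq_refl stack_eq_sym stack_eq_trans.

(* The underlying topological space of the Bruhat stack.  The atlas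
   GO(V, b) -> [P\GO(V, b)/Q] is open and surjective, whence the quotient
   topology. *)
Definition bruhat_stack : topologicalType :=
  quotient_topology {eq_quot stack_equiv}%qT.

Definition to_stack (x : GOspace) : bruhat_stack :=
  (\pi_(quotient_topology {eq_quot stack_equiv}) x)%qT.

Definition labelled_by (w : 'S_n) : set bruhat_stack :=
  [set x | exists (K : fieldType) (i : {rmorphism F -> K}) (g : 'M[K]_n)
             (h : GO i g), weyl_rep w i g /\ x = to_stack (GOpt h)].

End Similitudes.

(* Main.v *)
Require Import Defs.
From mathcomp Require Import all_boot all_order all_fingroup all_algebra.
From mathcomp Require Import all_classical topology.
From mathcomp.multinomials Require Import mpoly.
From mathcomp Require Import zify ring.
From mathcomp Require finfield.
From Stdlib Require Import Relation_Operators.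

Set Implicit Arguments.
Unset Strict Implicit.
Unset Printing Implicit Defensive.

Import GRing.Theory.

Local Open Scope classical_set_scope.
Local Open Scope ring_scope.

(** Let L be the isotropic line spanned by the first basis vector e_0, and
    L^perp its orthogonal complement. The parabolic subgroup of type J is the
    stabiliser of L, and K = J, so that the double coset of a similitude g
    records the position of the isotropic line gL relative to L. There are
    three positions: gL = L, or gL is different from L and contained in
    L^perp, or gL is not contained in L^perp. They are realised by 1, s_1 and
    w_1, where w_1 exchanges the first and the last index. The first two
    positions are closed conditions on g, and moving gL shows that each
    position degenerates to the previous one. For n = 3 the space L^perp/L is
    an anisotropic line, the second position does not occur, and s_1 = w_1.

    On the side of the Weyl group, the length is half of the number of
    inversions (weyl_lengthE), the group generated by J is the stabiliser of
    the index 0 (mem_gen_stab), and the elements of minimal length in the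
    double cosets are found by comparing inversions (min_dcoset_repsE).

    The identity component is a connected component of a space of prime
    ideals. A polynomial matrix G of similitudes has a generic point which
    specialises to every value of G with nonzero multiplier
    (path_specialization). Hence values of G at 0 and 1 lie in the same
    component, and explicit paths lead from 1 to the upper triangular
    similitudes, to products of two reflections, and so to representatives of
    all elements of W (upper_neutral, root_swap_neutral, weyl_neutral). This
    puts enough elements into the parabolic subgroups to compute the double
    cosets. On the one hand, an element of the normaliser of the parabolic
    subgroup fixes L, as L is the only line fixed by all upper triangular
    similitudes (par_eigenvector, norm_fixes_line). On the other hand, a
    similitude that fixes L is reduced by elimination to upper triangular
    similitudes and monomial matrices fixing e_0 (stab_ind), which lie in the
    extended parabolic subgroups (hat_upper, hat_refl, hat_flip). The
    elimination applied to a single column yields at most three double cosets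
    (same_class_cases), and they are distinct because the conditions gL = L
    and gL in L^perp are equations between the entries of g, invariant under
    both parabolic subgroups (same_class_type).

    For the specialisations, consider the product of the reflections in the
    vectors e_0 + e_(n-1) + y and e_0 + e_(n-1), where y is a polynomial path
    in the span of the other basis vectors. It moves L to the line of 2a (e_0
    + y) - b(y, y) e_(n-1) with a = b(e_0, e_(n-1)) (degeneration_col), so the
    generic position and the one at t = 0 can be prescribed by the choice of y
    (closure_simple_refl, closure_longest_rep). The space of the stack is then
    the closure of the point of w_1, hence connected. *)

(** * Signed permutations *)

Ltac ord_bounds :=
  repeat match goal with x : 'I_?k |- _ =>
    lazymatch goal with _ : is_true (leq (S (nat_of_ord x)) k) |- _ => fail
    | _ => have := ltn_ord x; intro end end.
Ltac case_ifs := rewrite /=; repeat (case: ifP => ?).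
Ltac ifs_lia := case_ifs; rewrite /=; first [done | lia].
Ltac ordlia := rewrite /= -?(inj_eq val_inj) /=; ord_bounds; lia.

Section SignedPermutations.
Local Open Scope nat_scope.
Variable n : nat.
Local Notation m := n./2.
Implicit Types a b x y : 'I_n.

Lemma weyl_hatP (w : 'S_n) :
  reflect (forall x, w (rev_ord x) = rev_ord (w x)) (w \in weyl_hat n).
Proof. by rewrite inE; apply: (iffP forallP) => h x; apply/eqP. Qed.

Lemma weyl_hat1 : 1%g \in weyl_hat n.
Proof. by apply/weyl_hatP => x; rewrite !perm1. Qed.

Lemma weyl_hatM (v w : 'S_n) :
  v \in weyl_hat n -> w \in weyl_hat n -> (v * w)%g \in weyl_hat n.
Proof. by move=> /weyl_hatP hv /weyl_hatP hw; apply/weyl_hatP => x; rewrite !permM hv hw. Qed.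

Lemma weyl_hatV (w : 'S_n) : w \in weyl_hat n -> (w^-1)%g \in weyl_hat n.
Proof.
move=> /weyl_hatP hw; apply/weyl_hatP => x.
by apply: (@perm_inj _ w); rewrite hw !permKV.
Qed.

(** Every simple reflection is of this form. If b is the middle index of an
    odd n, this is the reflection in the short root given by a; the case b =
    rev_ord a is the sign change of a, which is a reflection in W only for odd
    n. *)
Definition root_swap a b : 'S_n :=
  if b == rev_ord b then tperm a (rev_ord a)
  else if b == rev_ord a then tperm a b
  else (tperm a b * tperm (rev_ord a) (rev_ord b))%g.

(** On values, all reflections are covered by one formula, and the case
    analyses below are left to linear arithmetic. *)
Definition root_swap_val (a b x : nat) : nat :=
  if b == n - b.+1 then
    if x == a then n - a.+1 else if x == n - a.+1 then a else x
  else
    if x == a then b else if x == b then a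
    else if x == n - a.+1 then n - b.+1 else if x == n - b.+1 then n - a.+1
    else x.

Lemma tperm_val a b x :
  tperm a b x =
    (if x == a :> nat then b : nat else if x == b :> nat then a : nat else x) :> nat.
Proof.
case: tpermP => [->|->|xa xb]; rewrite ?eqxx //.
  by case: ifP => [/eqP|].
by rewrite !(inj_eq val_inj); move/eqP/negbTE: xa => ->; move/eqP/negbTE: xb => ->.
Qed.

Lemma root_swapE a b x :
  a != rev_ord a -> root_swap a b x = root_swap_val a b x :> nat.
Proof.
rewrite /root_swap /root_swap_val -!(inj_eq val_inj) /= => ha.
case: ifP => hb; first by rewrite tperm_val.
case: ifP => hab; first by rewrite tperm_val; case_ifs; ordlia.
rewrite permM tperm_val; have := tperm_val a b x.
move: (tperm a b x) => y; case_ifs; ordlia.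
Qed.

Lemma tperm_comm a b x y : a != x -> a != y -> b != x -> b != y ->
  commute (tperm a b) (tperm x y).
Proof.
move=> ax ay bx by_.
by apply/commgP/conjg_fixP; rewrite tpermJ !tpermD // eq_sym.
Qed.

Lemma root_swap_comm a b :
  a != rev_ord a -> b != rev_ord b -> b != rev_ord a ->
  commute (tperm a b) (tperm (rev_ord a) (rev_ord b)).
Proof.
move=> ha hb hab; apply: tperm_comm => //.
by apply: contraNneq hab => ->; rewrite rev_ordK.
Qed.

Lemma rev_tperm a b x :
  tperm (rev_ord a) (rev_ord b) (rev_ord x) = rev_ord (tperm a b x).
Proof. by rewrite (inj_tperm _ _ _ rev_ord_inj). Qed.

Lemma root_swap_hat a b : a != rev_ord a -> root_swap a b \in weyl_hat n.
Proof.
move=> ha; apply/weyl_hatP => x; rewrite /root_swap.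
case: ifP => hb; first by rewrite -rev_tperm rev_ordK tpermC.
case: ifP => [/eqP->|hab]; first by rewrite -rev_tperm rev_ordK tpermC.
rewrite root_swap_comm ?hb ?hab // !permM -!rev_tperm !rev_ordK.
by rewrite -!permM root_swap_comm ?hb ?hab.
Qed.

Lemma root_swapK a b : a != rev_ord a -> (root_swap a b * root_swap a b)%g = 1%g.
Proof.
move=> ha; rewrite /root_swap.
case: ifP => hb; first by rewrite tperm2.
case: ifP => hab; first by rewrite tperm2.
have /= tu := root_swap_comm ha (negbT hb) (negbT hab).
by rewrite {1}tu -mulgA (mulgA (tperm a b)) tperm2 mul1g tperm2.
Qed.

Definition crossings (w : 'S_n) : nat := #|[set i : 'I_n | (i < m) && (m <= w i)]%SET|.

Lemma weylE (w : 'S_n) : (w \in weyl n) = (w \in weyl_hat n) && (odd n || ~~ odd (crossings w)).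
Proof. by rewrite inE. Qed.

(** As i runs over the lower half, so does the representative f (v i) of the
    pair of v i and rev_ord (v i); and a signed permutation sends exactly one
    index of each such pair to the upper half. *)
Lemma crossingsM (v w : 'S_n) : ~~ odd n -> v \in weyl_hat n -> w \in weyl_hat n ->
  odd (crossings (v * w)) = odd (crossings v) (+) odd (crossings w).
Proof.
move=> en /weyl_hatP hv /weyl_hatP hw.
(* the representative of i and rev_ord i in the lower half *)
pose f (i : 'I_n) := if i < m then i else rev_ord i.
have fm i : f i < m.
  rewrite /f; case: ifP => //; ordlia.
have cE u : crossings u = \sum_(i : 'I_n | i < m) (m <= u i).
  rewrite /crossings -sum1_card big_mkcond /= [RHS]big_mkcond; apply: eq_bigr => i _.
  by rewrite inE; case: (i < m); case: (m <= u i).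
have key i : odd (m <= (v * w)%g i) = odd (m <= v i) (+) odd (m <= w (f (v i))).
  rewrite permM /f; case: ifP => h; first by rewrite [m <= v i]leqNgt h.
  have -> : m <= v i by ordlia.
  have ? := ltn_ord (w (v i)); rewrite hw /=; ordlia.
rewrite !cE.
have -> : \sum_(i : 'I_n | i < m) (m <= w i) = \sum_(i : 'I_n | i < m) (m <= w (f (v i))).
  rewrite (reindex_onto (fun i => f (v i)) (fun i => f ((v^-1)%g i))) /=.
    apply: eq_bigl => i; rewrite fm /=.
    have hvV x : (v^-1)%g (rev_ord x) = rev_ord ((v^-1)%g x).
      by apply: (@perm_inj _ v); rewrite hv !permKV.
    apply/eqP/idP => [<-|h]; first exact: fm.
    rewrite {2}/f; case: ifP => _; rewrite ?hvV permK /f ?h //.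
    case: ifP => [/= h'|_]; first by ordlia.
    by rewrite rev_ordK.
  move=> i im; rewrite {2}/f.
  have vV : v ((v^-1)%g i) = i by rewrite permKV.
  case: ifP => _; rewrite ?hv vV /f ?im //.
  case: ifP => [/= h'|_]; first by ordlia.
  by rewrite rev_ordK.
rewrite -oddD -big_split /=.
elim/big_rec2: _ => // i x y _; rewrite !oddD => ->; rewrite key.
by case: (odd (m <= v i)); case: (odd (m <= w (f (v i)))).
Qed.

Lemma weylM (v w : 'S_n) : v \in weyl n -> w \in weyl n -> (v * w)%g \in weyl n.
Proof.
rewrite !weylE => /andP[hv pv] /andP[hw pw]; rewrite weyl_hatM //=.
move: pv pw; case: (boolP (odd n)) => //= en pv pw.
by rewrite crossingsM // (negbTE pv) (negbTE pw).
Qed.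

Lemma weyl1 : 1%g \in weyl n.
Proof.
rewrite weylE weyl_hat1 /=; apply/orP; right.
rewrite (_ : crossings _ = 0) //; apply: eq_card0 => i; rewrite !inE perm1; lia.
Qed.

Lemma weylV (w : 'S_n) : w \in weyl n -> (w^-1)%g \in weyl n.
Proof.
rewrite !weylE => /andP[hw pw]; rewrite weyl_hatV //=.
move: pw; case: (boolP (odd n)) => //= en pw.
have := crossingsM en (weyl_hatV hw) hw.
rewrite mulVg (negbTE pw) addbF => <-.
by have := weyl1; rewrite weylE (negbTE en) => /andP[].
Qed.

End SignedPermutations.

(** * Inversions and length *)

Section WeylLength.
Local Open Scope nat_scope.
Variable n : nat.
Hypothesis n_ge3 : 3 <= n.
Hypothesis n_even : ~~ odd n -> 3 <= n./2.
Local Notation m := n./2.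
Implicit Types (a b x y : 'I_n) (j : 'I_m) (w : 'S_n).

Lemma odd_or_half_ge3 : odd n || (3 <= m).
Proof. by case: (boolP (odd n)) => //= /n_even. Qed.

Lemma simple_root_val j :
  (simple_root j).1 = (if (j.+1 < m) || odd n then j : nat else j.-1) :> nat /\
  (simple_root j).2 = j.+1 :> nat.
Proof.
have jm := ltn_ord j; rewrite /simple_root; case: ifP => h /=.
  by rewrite modn_small //; lia.
have -> : (j + n).-1 = j.-1 + n by lia.
rewrite modnDr modn_small; lia.
Qed.

Lemma simple_rootP j (a := (simple_root j).1) (b := (simple_root j).2) :
  [/\ a < b, a < n - a.+1 & 
   (b : nat) = a.+1 /\ b <= n - b.+1 \/ (b : nat) = a.+2 /\ n = b.*2].
Proof.
have [aE bE] := simple_root_val j; rewrite {}/a {}/b aE bE.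
have jm := ltn_ord j; have ne := odd_or_half_ge3; case: ifP => h; split; lia.
Qed.

Lemma simple_root_rev j : (simple_root j).1 != rev_ord (simple_root j).1.
Proof. by have [_ h _] := simple_rootP j; rewrite -(inj_eq val_inj) /= ltn_eqF. Qed.

Lemma simple_reflE j :
  simple_refl j = root_swap (simple_root j).1 (simple_root j).2.
Proof.
have jm := ltn_ord j.
have [+ +] := simple_root_val j; rewrite /root_swap /simple_root /simple_refl.
have ne := odd_or_half_ge3.
case: (ltnP j.+1 m) => h1 /=; [|case: (boolP (odd n)) => h2 /=] => aE bE.
- by rewrite -!(inj_eq val_inj) /= bE !ifF //; lia.
- by rewrite -(inj_eq val_inj) /= bE ifT //; lia.
- rewrite -!(inj_eq val_inj) /= aE ifF; last by lia.
  by rewrite ifF ?rev_ordK 1?[tperm (rev_ord _) _]tpermC //; lia.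
Qed.

Lemma simple_refl_hat j : simple_refl j \in weyl_hat n.
Proof. by rewrite simple_reflE root_swap_hat // simple_root_rev. Qed.

Lemma simple_reflK j : (simple_refl j * simple_refl j)%g = 1%g.
Proof. by rewrite simple_reflE root_swapK // simple_root_rev. Qed.

Lemma simple_refl_weyl j : simple_refl j \in weyl n.
Proof.
rewrite weylE simple_refl_hat /=.
case: (boolP (odd n)) => //= en.
have [_ h [[bE bn]|[bE bn]]] := simple_rootP j.
  rewrite (_ : crossings _ = 0) //; apply: eq_card0 => x; rewrite !inE.
  rewrite simple_reflE root_swapE ?simple_root_rev // /root_swap_val; ifs_lia.
rewrite (_ : crossings _ = 2) //; rewrite /crossings.
rewrite (_ : [set i | _]%SET = [set (simple_root j).1; rev_ord (simple_root j).2]%SET).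
  rewrite cards2 -(inj_eq val_inj) /=; lia.
apply/setP => x; rewrite !inE -!(inj_eq val_inj) simple_reflE.
rewrite root_swapE ?simple_root_rev // /root_swap_val; ifs_lia.
Qed.

Lemma simple_refl_root j (a := (simple_root j).1) (b := (simple_root j).2) :
  simple_refl j a = (if b == n - b.+1 :> nat then rev_ord a else b) /\
  simple_refl j b = (if b == n - b.+1 :> nat then b else a).
Proof.
have := simple_root_rev j; have [] := simple_rootP j; rewrite -/a -/b => ab h hb ar.
split; apply: val_inj.
  rewrite /= simple_reflE -/a -/b root_swapE // /root_swap_val.
  by move: a b ab h hb {ar} => a b ab h hb; ifs_lia.
rewrite /= simple_reflE -/a -/b root_swapE // /root_swap_val.
by move: a b ab h hb {ar} => a b ab h hb; ifs_lia.
Qed.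

(** A simple reflection makes a single positive root negative; that root
    occurs as two pairs of indices. *)
Lemma simple_refl_pos j x y :
  x < y -> y != rev_ord x ->
  (x, y) != simple_root j ->
  (x, y) != (rev_ord (simple_root j).2, rev_ord (simple_root j).1) ->
  simple_refl j x < simple_refl j y.
Proof.
have [ab ar rP] := simple_rootP j.
rewrite [simple_root j]surjective_pairing !xpair_eqE -!(inj_eq val_inj).
rewrite !simple_reflE !root_swapE ?simple_root_rev // /root_swap_val.
move: (simple_root j).1 (simple_root j).2 ab ar rP => a b ab ar rP.
rewrite /= => xy yx h1 h2.
have nx := ltn_ord x; have ny := ltn_ord y; have na := ltn_ord a; have nb := ltn_ord b.
clear n_ge3 n_even; case: rP => -[bE rP]; case: ifP => hb; try (exfalso; lia); ifs_lia.
Qed.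

(** Every positive root occurs as exactly two such pairs, (x, y) and (rev_ord
    y, rev_ord x), which differ since y != rev_ord x. Inversions therefore
    count the roots that become negative twice. *)
Definition posroot (u : 'I_n * 'I_n) := (u.1 < u.2) && (u.2 != rev_ord u.1).

Definition inversions w : {set 'I_n * 'I_n} :=
  [set u | posroot u & w u.2 < w u.1]%SET.

Lemma mem_inversions w u : (u \in inversions w) = posroot u && (w u.2 < w u.1).
Proof. by rewrite inE. Qed.

Definition root_pair j : {set 'I_n * 'I_n} :=
  [set simple_root j; (rev_ord (simple_root j).2, rev_ord (simple_root j).1)]%SET.

Lemma posroot_refl j u : posroot u -> u \notin root_pair j ->
  posroot (simple_refl j u.1, simple_refl j u.2) /\
  (simple_refl j u.1, simple_refl j u.2) \notin root_pair j.
Proof.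
case: u => x y /andP[/= xy yx]; rewrite !inE negb_or => /andP[h1 h2].
have lt := simple_refl_pos xy yx h1 h2.
split.
  rewrite /posroot lt /=; apply: contra yx => /eqP.
  by rewrite -(weyl_hatP _ (simple_refl_hat j)) => /perm_inj ->.
have sK z : simple_refl j (simple_refl j z) = z.
  by rewrite -permM simple_reflK perm1.
have [sa sb] := simple_refl_root j.
have sr := weyl_hatP _ (simple_refl_hat j).
have [ab ar rP] := simple_rootP j.
apply/negP; rewrite [simple_root j]surjective_pairing !xpair_eqE.
case/orP => /andP[/eqP e1 /eqP e2];
  move: (congr1 (simple_refl j) e1) (congr1 (simple_refl j) e2);
  rewrite !sK ?sr ?sa ?sb => ex ey; move: xy; rewrite ex ey /=;
  case: ifP => hb /=; move: (ltn_ord (simple_root j).2); lia.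
Qed.

Lemma card_root_pair j : #|root_pair j| = 2.
Proof.
have [ab ar rP] := simple_rootP j.
rewrite cards2 [simple_root j]surjective_pairing !xpair_eqE -!(inj_eq val_inj) /=.
lia.
Qed.

(** Multiplication by a simple reflection permutes the positive roots other
    than its own, so that the numbers of inversions can differ only in the two
    pairs of that root. *)
Lemma inversions_mul j w : w \in weyl_hat n ->
  let b := w (simple_root j).1 < w (simple_root j).2 in
  #|inversions (simple_refl j * w)| + (~~ b).*2 = #|inversions w| + b.*2.
Proof.
move=> wh b.
have sK z : simple_refl j (simple_refl j z) = z.
  by rewrite -permM simple_reflK perm1.
have wr := weyl_hatP _ wh.
have sr := weyl_hatP _ (simple_refl_hat j).
have [sa sb] := simple_refl_root j.
have [ab ar rP] := simple_rootP j.
have wab : w (simple_root j).1 != w (simple_root j).2 :> nat.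
  rewrite (inj_eq val_inj) (inj_eq perm_inj) -(inj_eq val_inj) /=; lia.
pose f (u : 'I_n * 'I_n) := (simple_refl j u.1, simple_refl j u.2).
have fK : involutive f by case=> x y; rewrite /f /= !sK.
have out : #|inversions (simple_refl j * w) :\: root_pair j|
         = #|inversions w :\: root_pair j|.
  rewrite -(card_imset _ (inv_inj fK)); apply: eq_card => u.
  apply/imsetP/idP => [[v + ->]|].
    rewrite finset.in_setD mem_inversions => /and3P[nv pv].
    have [p1 p2] := posroot_refl pv nv.
    by rewrite !permM finset.in_setD mem_inversions p1 p2.
  rewrite finset.in_setD mem_inversions => /and3P[nu pu iu]; exists (f u); last by rewrite fK.
  have [p1 p2] := posroot_refl pu nu.
  by rewrite finset.in_setD mem_inversions p1 p2 !permM !sK iu.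
have inw (v : 'S_n) : v \in weyl_hat n ->
    #|inversions v :&: root_pair j| = (v (simple_root j).2 < v (simple_root j).1).*2.
  move=> /weyl_hatP vr.
  have pr : posroot (simple_root j).
    rewrite /posroot ab /= -(inj_eq val_inj) /=; lia.
  have pr' : posroot (rev_ord (simple_root j).2, rev_ord (simple_root j).1).
    rewrite /posroot /= rev_ordK -(inj_eq val_inj) /=; have := ltn_ord (simple_root j).2; lia.
  case: (boolP (v (simple_root j).2 < v (simple_root j).1)) => hv.
    rewrite (finset.setIidPr _) ?card_root_pair //.
    apply/fintype.subsetP => u; rewrite finset.in_set2 => /orP[] /eqP ->.
      by rewrite mem_inversions pr.
    rewrite mem_inversions pr' /= !vr /=; have := ltn_ord (v (simple_root j).1); lia.
  apply: eq_card0 => u; rewrite finset.in_setI mem_inversions finset.in_set2.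
  apply/negP => /andP[/andP[_ iu]].
  case/orP => /eqP uE; move: iu; rewrite uE ?(negbTE hv) //= !vr /= => h.
  move: hv; have := ltn_ord (v (simple_root j).2); lia.
rewrite -(cardsID (root_pair j) (inversions (simple_refl j * w))).
rewrite -(cardsID (root_pair j) (inversions w)) out !inw ?weyl_hatM ?simple_refl_hat //.
rewrite !permM sa sb /b; case: ifP => hb; last by lia.
have bE : (simple_root j).2 = rev_ord (simple_root j).2 by apply/val_inj/eqP.
have : w (simple_root j).2 = n - (w (simple_root j).2).+1 :> nat.
  by rewrite {1}bE wr.
rewrite wr /=.
have := ltn_ord (w (simple_root j).1).
have := ltn_ord (w (simple_root j).2).
lia.
Qed.

End WeylLength.

(** * Reduced words *)

Section WeylGeneration.
Local Open Scope nat_scope.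
Variable n : nat.
Hypothesis n_ge3 : 3 <= n.
Hypothesis n_even : ~~ odd n -> 3 <= n./2.
Local Notation m := n./2.
Implicit Types (a b x y : 'I_n) (j : 'I_m) (w : 'S_n).

Fact first_subproof : 0 < n. Proof. by clear n_even; lia. Qed.
Definition first : 'I_n := Ordinal first_subproof.
Fact half_pred_subproof : m.-1 < n. Proof. by clear n_even; lia. Qed.
Definition half_pred : 'I_n := Ordinal half_pred_subproof.

(** For even n this element represents the nontrivial component of the group
    of similitudes, and conjugation by it is the automorphism of the Dynkin
    diagram that exchanges the last two nodes. *)
Definition mid_flip : 'S_n := tperm half_pred (rev_ord half_pred).

Lemma half_pred_rev : half_pred != rev_ord half_pred.
Proof. by rewrite -(inj_eq val_inj) /=; lia. Qed.

Lemma mid_flipE : mid_flip = root_swap half_pred (rev_ord half_pred).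
Proof. by rewrite /root_swap rev_ordK eq_sym (negbTE half_pred_rev) eqxx. Qed.

Lemma mid_flip_hat : mid_flip \in weyl_hat n.
Proof. by rewrite mid_flipE root_swap_hat // half_pred_rev. Qed.

Lemma mid_flip_val x : ~~ odd n ->
  mid_flip x = (if x == m.-1 :> nat then m else if x == m :> nat then m.-1 else x) :> nat.
Proof.
move=> en; rewrite /mid_flip tperm_val /=.
have -> : n - m.-1.+1 = m by lia.
by case_ifs.
Qed.

Lemma weyl_mid_flip w : ~~ odd n -> w \in weyl_hat n -> w \notin weyl n ->
  (mid_flip * w)%g \in weyl n.
Proof.
move=> en wh; rewrite !weylE wh (negbTE en) /= negbK => cw.
rewrite weyl_hatM ?mid_flip_hat //= crossingsM ?mid_flip_hat // cw addbT negbK.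
rewrite (_ : crossings _ = 1) // /crossings.
rewrite (_ : [set i | _]%SET = [set half_pred]%SET) ?cards1 //.
apply/setP => x; rewrite !inE mid_flip_val // -(inj_eq val_inj).
by have := n_even en; ifs_lia.
Qed.

Lemma increasing_range (f : 'I_n -> nat) p q :
  (forall x y, p <= x -> y <= q -> y = x.+1 :> nat -> f x < f y) ->
  forall x y, p <= x -> x < y -> y <= q -> f x < f y.
Proof.
move=> H x y px; move dE: (y - x.+1) => d.
elim: d y dE => [|d IH] y dE xy yq; first by apply: H => //; lia.
have hy : y.-1 < n by have := ltn_ord y; lia.
apply: (ltn_trans (IH (Ordinal hy) _ _ _)) => /=; try lia.
by apply: H => //=; lia.
Qed.

Lemma increasing_perm w :
  (forall x y, x < y -> w x < w y) -> w = 1%g.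
Proof.
move=> H.
have ge k x : k = x :> nat -> k <= w x.
  elim: k x => // k IH x kx.
  have hk : k < n by have := ltn_ord x; lia.
  apply: (leq_ltn_trans (IH (Ordinal hk) erefl)); apply: H => /=; lia.
have le k x : k = rev_ord x :> nat -> k <= rev_ord (w x).
  elim: k x => // k IH x /= kx.
  have hk : x.+1 < n by have := ltn_ord x; lia.
  have /= h1 := IH (Ordinal hk) _.
  have /= h2 := H x (Ordinal hk) (ltnSn _).
  have := ltn_ord (w (Ordinal hk)); have := h1 _; lia.
apply/permP => x; rewrite perm1; apply: val_inj => /=.
have := ge x x erefl; have /= := le _ x erefl.
have := ltn_ord (w x); have := ltn_ord x; lia.
Qed.

Lemma simple_root_at k (km : k < m) (x y : 'I_n) : x = k :> nat -> y = k.+1 :> nat ->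
  (k.+1 < m) || odd n -> simple_root (Ordinal km) = (x, y).
Proof.
move=> xk yk h; have [aE bE] := simple_root_val n_ge3 n_even (Ordinal km).
rewrite [LHS]surjective_pairing; congr (_, _); apply: val_inj; rewrite /= ?aE ?bE //= ?h //.
Qed.

(** The simple roots compare the values of w at neighbouring indices, except
    at the middle of an even n. There a descent could occur only if the last
    index of the lower half were the only one that crosses the middle, which
    is excluded by parity. *)
Lemma no_descent_weyl w : w \in weyl n ->
  (forall j, w (simple_root j).1 < w (simple_root j).2) -> w = 1%g.
Proof.
rewrite weylE => /andP[/weyl_hatP wr wp] H.
have lower x y : y = x.+1 :> nat -> (y < m) || (odd n && (y == m :> nat)) -> w x < w y.
  move=> yx hy; have xm : x < m by lia.
  have := H (Ordinal xm); rewrite (@simple_root_at x xm x y) //; lia.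
have wn x := ltn_ord (w x).
have upper x y : y = x.+1 :> nat -> m <= x -> w x < w y.
  move=> yx mx.
  have : w (rev_ord y) < w (rev_ord x) by apply: lower => /=; move: (ltn_ord y); lia.
  rewrite !wr /=; have := wn x; have := wn y; lia.
(* A permutation is the identity once it increases at each step x, x + 1. *)
apply: increasing_perm => x y xy.
apply: (@increasing_range (fun z => w z) 0 n _ x y) => //; last by have := ltn_ord y; lia.
move=> {xy}x {}y _ _ yx.
case: (leqP m x) => mx; first exact: upper.
case: (boolP ((y < m) || (odd n && (y == m :> nat)))) => hy; first exact: lower.
have en : ~~ odd n by lia.
have m3 := n_even en.
have yE : y = rev_ord x by apply: val_inj => /=; lia.
suff wx : w x < m by rewrite yE wr /=; have := wn x; lia.
rewrite ltnNge; apply/negP => wx.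
move: wp; rewrite (negbTE en) /crossings /= => /negP; apply.
rewrite (_ : [set i | _]%SET = [set x]%SET) ?cards1 //.
apply/setP => i; rewrite !inE -(inj_eq val_inj) /=.
case: (ltngtP i x) => ix; last first.
- by rewrite (val_inj ix) wx; lia.
- by apply: negbTE; lia.
suff : w i < m by lia.
have m1 : m.-1 < m by lia.
have m2 : m.-2 < n by lia.
have := H (Ordinal m1).
have [aE bE] := simple_root_val n_ge3 n_even (Ordinal m1).
have -> : (simple_root (Ordinal m1)).1 = Ordinal m2.
  by apply: val_inj; rewrite /= aE ifF /= ; lia.
have -> : (simple_root (Ordinal m1)).2 = y by apply: val_inj; rewrite /= bE /=; lia.
rewrite yE wr /= => h.
have : w i <= w (Ordinal m2).
  case: (ltngtP i m.-2) => im; [|by lia|by rewrite (_ : i = Ordinal m2) //; apply: val_inj].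
  apply/ltnW/(@increasing_range (fun z => w z) 0 m.-1) => //=; try lia.
  by move=> x' y' _ h' yx'; apply: lower => //; lia.
have := wn x; lia.
Qed.

Lemma mid_flip_root j : ~~ odd n -> exists2 j',
  (mid_flip (simple_root j).1 = (simple_root j').1 /\
   mid_flip (simple_root j).2 = (simple_root j').2) & (j == 0 :> nat) = (j' == 0 :> nat).
Proof.
move=> en; have m3 := n_even en.
suff [j' jj'] : exists j' : 'I_m, (j = m.-1 :> nat /\ j' = m.-2 :> nat \/
    j = m.-2 :> nat /\ j' = m.-1 :> nat) \/ j < m.-2 /\ j = j'.
  exists j'; last by have jm := ltn_ord j; case: jj' => [[[-> ->]|[-> ->]]|[_ ->]] //; lia.
  have [aE bE] := simple_root_val n_ge3 n_even j.
  have [aE' bE'] := simple_root_val n_ge3 n_even j'.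
  have jm := ltn_ord j.
  split; apply: val_inj; rewrite /= mid_flip_val //.
    move: (simple_root j).1 (simple_root j').1 aE aE' {bE bE'} => a a'.
    by rewrite (negbTE en) !orbF; case: jj' => [[[-> ->]|[-> ->]]|[? <-]]; ifs_lia.
  move: (simple_root j).2 (simple_root j').2 bE bE' {aE aE'} => a a'.
  by case: jj' => [[[-> ->]|[-> ->]]|[? <-]]; ifs_lia.
have m1 : m.-1 < m by lia.
have m2 : m.-2 < m by lia.
have jm := ltn_ord j.
case: (ltngtP j m.-2) => h; first by exists j; right.
  by exists (Ordinal m2); left; left; split => //=; lia.
by exists (Ordinal m1); left; right.
Qed.

Lemma no_descent_hat w : w \in weyl_hat n ->
  (forall j, w (simple_root j).1 < w (simple_root j).2) ->
  w = 1%g \/ ~~ odd n /\ w = mid_flip.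
Proof.
move=> wh H; case: (boolP (w \in weyl n)) => ww; first by left; exact: no_descent_weyl.
have en : ~~ odd n by move: ww; rewrite weylE wh /=; case: (odd n).
right; split => //.
suff : (mid_flip * w)%g = 1%g.
  by move=> /(congr1 (fun u => mid_flip * u)%g); rewrite mulgA tperm2 mul1g mulg1.
apply: no_descent_weyl; first exact: weyl_mid_flip.
by move=> j; rewrite !permM; have [j' [-> ->] _] := mid_flip_root j en.
Qed.

Definition fixes_first w := w first == first.

Lemma simple_refl_fix j : j != 0 :> nat -> fixes_first (simple_refl j).
Proof.
move=> j0; rewrite /fixes_first -(inj_eq val_inj) (simple_reflE n_ge3 n_even) /=.
rewrite root_swapE ?(simple_root_rev n_ge3 n_even) //.
have [aE bE] := simple_root_val n_ge3 n_even j; have jm := ltn_ord j.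
have ne := odd_or_half_ge3 n_even.
rewrite /root_swap_val; move: (simple_root j).1 (simple_root j).2 aE bE => a b + bE.
by ifs_lia.
Qed.

Lemma mid_flip_fix : ~~ odd n -> fixes_first mid_flip.
Proof.
move=> en; rewrite /fixes_first -(inj_eq val_inj) /= mid_flip_val //=.
by have := n_even en; ifs_lia.
Qed.

Lemma fixes_firstM v w : fixes_first v -> fixes_first w -> fixes_first (v * w).
Proof. by rewrite /fixes_first permM => /eqP-> /eqP->. Qed.

Lemma inversions1 : #|inversions (1%g : 'S_n)| = 0.
Proof.
apply: eq_card0 => -[x y]; apply/negbTE/negP; rewrite mem_inversions !perm1.
by move=> /andP[/andP[/=]]; lia.
Qed.

(** By induction on the number of inversions: w = 1 or some simple root is a
    descent. If w fixes the index 0, then the simple root of s_1 is no descent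
    because 0 is the smallest value, and s_1 does not occur in the word. *)
Lemma weyl_word w : w \in weyl n -> exists t : seq 'I_m,
  [/\ w = (\prod_(j <- t) simple_refl j)%g, (size t).*2 = #|inversions w|
    & fixes_first w -> all (fun j => j != 0 :> nat) t].
Proof.
move cE: #|inversions w| => c; move: w cE.
have [N] := ubnP c; elim: N c => // N IH c cN w wc ww.
case: (pickP (fun j => ~~ (w (simple_root j).1 < w (simple_root j).2))) => [j jP|noj].
  have wh : w \in weyl_hat n by move: ww; rewrite weylE => /andP[].
  have := inversions_mul n_ge3 n_even j wh; rewrite (negbTE jP) /= addn0 wc.
  move c'E: #|inversions _| => c' vc.
  have vw : (simple_refl j * w)%g \in weyl n by rewrite weylM ?(simple_refl_weyl n_ge3 n_even).
  have [|t [tE ts tf]] := IH _ _ _ c'E vw; first by lia.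
  exists (j :: t); split.
  - by rewrite big_cons -tE mulgA (simple_reflK n_ge3 n_even) ?mul1g.
  - by rewrite /= -vc -ts; lia.
  - move=> /eqP wf.
    have j0 : j != 0 :> nat.
      apply: contra jP => /eqP j0; have [aE bE] := simple_root_val n_ge3 n_even j.
      have -> : (simple_root j).1 = first.
        by apply: val_inj; rewrite /= aE j0; case: ifP.
      rewrite wf /= lt0n -[0]/(val first) -wf (inj_eq val_inj) (inj_eq perm_inj).
      by rewrite -(inj_eq val_inj) /= bE.
    by rewrite /= j0 tf // fixes_firstM ?simple_refl_fix //; apply/eqP.
have w1 : w = 1%g.
  by apply: no_descent_weyl => // j; have /negbFE := noj j.
by exists [::]; split => //; rewrite ?big_nil // -wc w1 inversions1.
Qed.

Lemma word_weyl (t : seq 'I_m) : (\prod_(j <- t) simple_refl j)%g \in weyl n.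
Proof.
elim: t => [|j t IH]; first by rewrite big_nil weyl1.
by rewrite big_cons weylM ?(simple_refl_weyl n_ge3 n_even).
Qed.

Lemma weyl_sub_hat w : w \in weyl n -> w \in weyl_hat n.
Proof. by rewrite weylE => /andP[]. Qed.

Lemma inversions_word (t : seq 'I_m) :
  #|inversions (\prod_(j <- t) simple_refl j)%g| <= (size t).*2.
Proof.
elim: t => [|j t IH]; first by rewrite big_nil inversions1.
rewrite big_cons /=.
have /= := inversions_mul n_ge3 n_even j (weyl_sub_hat (word_weyl t)).
move: IH; move: #|_| #|_| => p q; rewrite doubleS.
by case: (_ < _) => /=; lia.
Qed.

(** A letter changes the number of inversions by two at most, and the word of
    weyl_word attains the resulting bound. It has fewer than n! letters, so
    that it is found by the search that defines the length. *)
Lemma weyl_lengthE w : w \in weyl n -> (weyl_length w).*2 = #|inversions w|.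
Proof.
move=> ww; have [t [tE ts _]] := weyl_word ww.
pose P k := [exists t : k.-tuple 'I_m, w == (\prod_(j <- t) simple_refl j)%g].
have Pt : P (size t) by apply/existsP; exists (in_tuple t); apply/eqP.
have tn : size t < #|{perm 'I_n}|.
  rewrite card_Sn.
  have : #|inversions w| <= n * n.
    by apply: leq_trans (max_card _) _; rewrite card_prod card_ord.
  have : n * n < (n`!).*2.
    move: n n_ge3 => [|[|[|k]]] // _; rewrite !factS doubleMr ltn_pmul2l //.
    have : 0 < k.+1 * k`! by rewrite muln_gt0 fact_gt0.
    by move: (_ * _) => g; nia.
  lia.
have hP : has P (iota 0 #|{perm 'I_n}|).
  by apply/hasP; exists (size t) => //; rewrite mem_iota.
have lN : weyl_length w < #|{perm 'I_n}|.
  by move: (hP); rewrite has_find size_iota.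
have : P (weyl_length w).
  by have := nth_find 0 hP; rewrite nth_iota.
move=> /existsP[u /eqP uE].
have le1 : #|inversions w| <= (weyl_length w).*2.
  by rewrite {1}uE; apply: leq_trans (inversions_word _) _; rewrite size_tuple.
have le2 : weyl_length w <= size t.
  rewrite leqNgt; apply/negP => lt.
  by have /negbT/negP := before_find 0 lt; rewrite nth_iota // add0n; apply.
lia.
Qed.

End WeylGeneration.

(** * Double cosets in the Weyl group *)

Section DoubleCosets.
Local Open Scope nat_scope.
Variable n : nat.
Hypothesis n_ge3 : 3 <= n.
Hypothesis n_even : ~~ odd n -> 3 <= n./2.
Local Notation m := n./2.
Implicit Types (x y : 'I_n) (j : 'I_m) (v w : 'S_n).
Local Notation first := (first n_ge3).
Local Notation flip := (mid_flip n_ge3).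

Definition stab_refl : {set 'S_n} :=
  [set simple_refl j | j : 'I_m & j != 0 :> nat]%SET.

Lemma leq_weyl_length v w : v \in weyl n -> w \in weyl n ->
  (weyl_length v <= weyl_length w) = (#|inversions v| <= #|inversions w|).
Proof. by move=> hv hw; rewrite -!weyl_lengthE // leq_double. Qed.

Definition rev_perm : 'S_n := perm (@rev_ord_inj n).

Lemma rev_perm_hat : rev_perm \in weyl_hat n.
Proof. by apply/weyl_hatP => x; rewrite !permE. Qed.

Lemma rev_permK : (rev_perm * rev_perm)%g = 1%g.
Proof. by apply/permP => x; rewrite permM !permE rev_ordK. Qed.

Lemma rev_permC w : w \in weyl_hat n -> (rev_perm * w = w * rev_perm)%g.
Proof. by move=> /weyl_hatP wr; apply/permP => x; rewrite !permM !permE wr. Qed.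

(** A longest element has a descent at every simple root, so that its product
    with the reversal has none. The second case is that of a reversal outside
    W, for n = 2m with m odd. *)
Lemma longestE :
  longest n = rev_perm \/ ~~ odd n /\ longest n = (flip * rev_perm)%g.
Proof.
rewrite /longest; case: arg_maxnP; first exact: weyl1.
move=> w ww wmax.
have wh := weyl_sub_hat ww.
have desc j : (w * rev_perm)%g (simple_root j).1 < (w * rev_perm)%g (simple_root j).2.
  rewrite !permM !permE /=.
  have sw : (simple_refl j * w)%g \in weyl n.
    by rewrite weylM // simple_refl_weyl.
  have := wmax _ sw; rewrite [X in is_true X]leq_weyl_length //.
  have /= := inversions_mul n_ge3 n_even j wh.
  move: #|_| #|_| => p q.
  have : w (simple_root j).1 != w (simple_root j).2 :> nat.
    rewrite (inj_eq val_inj) (inj_eq perm_inj) -(inj_eq val_inj) /=.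
    by have [h _ _] := simple_rootP n_ge3 n_even j; rewrite ltn_eqF.
  have := ltn_ord (w (simple_root j).1); have := ltn_ord (w (simple_root j).2).
  by case: ltngtP => //= *; lia.
have h u : (w * rev_perm = u)%g -> w = (u * rev_perm)%g.
  by move=> <-; rewrite -mulgA rev_permK mulg1.
have := no_descent_hat n_ge3 n_even (weyl_hatM wh rev_perm_hat) desc.
by case=> [/h ->|[en /h ->]]; [left; rewrite mul1g|right].
Qed.

Lemma root_swapJ v x y : v \in weyl_hat n ->
  (root_swap x y ^ v)%g = root_swap (v x) (v y).
Proof.
move=> /weyl_hatP vr; rewrite /root_swap -!vr !(inj_eq perm_inj).
case: ifP => _; first by rewrite tpermJ.
by case: ifP => _; rewrite ?conjMg !tpermJ.
Qed.

Lemma mid_flipJ w : (flip * w * flip = w ^ flip)%g.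
Proof. by rewrite /conjg {3}/mid_flip tpermV mulgA. Qed.

Lemma mid_flip_refl j : ~~ odd n ->
  exists2 j', (flip * simple_refl j * flip)%g = simple_refl j'
    & (j == 0 :> nat) = (j' == 0 :> nat).
Proof.
move=> en; have [j' [j1 j2] jj'] := mid_flip_root n_ge3 n_even j en.
exists j' => //; rewrite mid_flipJ !(simple_reflE n_ge3 n_even).
by rewrite root_swapJ ?mid_flip_hat // j1 j2.
Qed.

Lemma stab_refl_flip w : ~~ odd n ->
  w \in stab_refl -> (flip * w * flip)%g \in stab_refl.
Proof.
move=> en /imsetP[j]; rewrite inE => j0 ->.
have [j' -> jj'] := mid_flip_refl j en.
by apply/imsetP; exists j'; rewrite // inE -jj'.
Qed.

(** The reversal is central, and the exchange of the two middle indices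
    permutes the simple reflections and fixes s_1. *)
Lemma longest_stab_refl :
  [set (longest n * s * longest n)%g | s in stab_refl]%SET = stab_refl.
Proof.
have conj s : s \in stab_refl -> s \in weyl_hat n.
  by move=> /imsetP[j _ ->]; exact: simple_refl_hat.
case: longestE => [->|[en ->]].
  rewrite -[RHS]imset_id; apply: eq_in_imset => s /conj sh.
  by rewrite rev_permC // -mulgA rev_permK mulg1.
have E s : s \in stab_refl ->
    (flip * rev_perm * s * (flip * rev_perm) = flip * s * flip)%g.
  move=> /conj sh; have fh := mid_flip_hat n_ge3 n_even.
  rewrite -(mulgA flip rev_perm s) (rev_permC sh) !mulgA.
  rewrite -(mulgA _ rev_perm flip) (rev_permC fh) !mulgA.
  by rewrite -[LHS]mulgA rev_permK mulg1.
apply/setP => s; apply/imsetP/idP => [[u us ->]|sJ].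
  by rewrite E // stab_refl_flip.
exists (flip * s * flip)%g; first exact: stab_refl_flip.
rewrite E ?stab_refl_flip // !mulgA tperm2 mul1g -mulgA tperm2 mulg1 //.
Qed.

(** The reduced word of an element fixing the index 0 avoids s_1. *)
Lemma mem_gen_stab w : (w \in <<stab_refl>>%g) = (w \in weyl n) && fixes_first n_ge3 w.
Proof.
apply/idP/andP => [|[ww wf]].
  case/gen_prodgP => k [f fJ ->].
  elim/big_ind: _ => [|u v [? ?] [? ?]|i _].
  - by rewrite weyl1 /fixes_first perm1.
  - by rewrite weylM ?fixes_firstM.
  - have /imsetP[j + ->] := fJ i; rewrite inE => j0.
    by rewrite simple_refl_weyl ?simple_refl_fix.
have [t [tE _ /(_ wf)]] := weyl_word n_ge3 n_even ww.
rewrite {}tE {wf ww}; elim: t => [|j t IH] /=; first by rewrite big_nil group1.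
move=> /andP[j0 /IH]; rewrite big_cons; apply: groupM.
by apply/mem_gen/imsetP; exists j; rewrite ?inE.
Qed.

Lemma weyl_dcosetP v w : w \in weyl n ->
  reflect (exists k l, [/\ k \in <<stab_refl>>%g, l \in <<stab_refl>>%g & v = (k * w * l)%g])
    (v \in weyl_dcoset stab_refl stab_refl w).
Proof.
move=> ww; apply: (iffP mulsgP) => [[x l /rcosetP[k kJ ->] lJ ->]|[k [l [kJ lJ ->]]]].
  by exists k, l.
by exists (k * w)%g l => //; apply/rcosetP; exists k.
Qed.

Lemma stab_first l : l \in <<stab_refl>>%g -> l first = first /\ l (rev_ord first) = rev_ord first.
Proof.
rewrite mem_gen_stab => /andP[lw /eqP lf]; split => //.
by rewrite (weyl_hatP _ (weyl_sub_hat lw)) lf.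
Qed.

(** Elements of the stabiliser of 0 fix both 0 and n - 1. *)
Lemma dcoset_weyl v w : w \in weyl n -> v \in weyl_dcoset stab_refl stab_refl w ->
  [/\ v \in weyl n, (v first == first) = (w first == first)
    & (v first == rev_ord first) = (w first == rev_ord first)].
Proof.
move=> ww /weyl_dcosetP-/(_ ww)[k [l [kJ lJ ->]]].
have [k1 k2] := stab_first kJ; have [l1 l2] := stab_first lJ.
rewrite !permM k1; split.
- by move: kJ lJ; rewrite !mem_gen_stab => /andP[kw _] /andP[lw _]; rewrite !weylM.
- by rewrite -{2}l1 (inj_eq perm_inj).
- by rewrite -{1}l2 (inj_eq perm_inj).
Qed.

(** The product v * l^-1 * w^-1 fixes the index 0, so that a double coset is
    determined by the orbit of w 0 under the stabiliser of 0. *)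
Lemma dcoset_transport v w l : v \in weyl n -> w \in weyl n ->
  l \in <<stab_refl>>%g -> l (w first) = v first ->
  v \in weyl_dcoset stab_refl stab_refl w.
Proof.
move=> vw ww lJ lwv; apply/weyl_dcosetP => //.
exists (v * l^-1 * w^-1)%g, l; split; rewrite ?mulgKV //.
rewrite mem_gen_stab; apply/andP; split.
  by move: lJ; rewrite mem_gen_stab => /andP[lw _]; rewrite !weylM ?weylV.
by rewrite /fixes_first !permM -lwv !permK.
Qed.

Lemma weyl_first_mid w : w \in weyl_hat n -> w first != rev_ord (w first).
Proof.
move=> /weyl_hatP <-; rewrite (inj_eq perm_inj) -(inj_eq val_inj) /=; lia.
Qed.

Fact second_subproof : 1 < n. Proof. by clear n_even; lia. Qed.
Definition second : 'I_n := Ordinal second_subproof.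

(** The reflection that exchanges the indices 1 and x fixes 0. If it is not in
    W, it is corrected by the exchange of the two middle indices, which fixes
    0 and 1 since n >= 6. *)
Lemma stab_transitive x : n != 3 -> x != rev_ord x -> x != first -> x != rev_ord first ->
  exists2 l, l \in <<stab_refl>>%g & l second = x.
Proof.
move=> n3 xr x0 xn.
have sr : second != rev_ord second by rewrite -(inj_eq val_inj) /=; lia.
have rh := root_swap_hat x sr.
have r0 : root_swap second x first = first.
  apply: val_inj; move: xr x0 xn; rewrite -!(inj_eq val_inj) /= root_swapE // /root_swap_val /=.
  by have xn := ltn_ord x; ifs_lia.
have r1 : root_swap second x second = x.
  apply: val_inj; move: xr; rewrite -!(inj_eq val_inj) /= root_swapE // /root_swap_val /=.
  by ifs_lia.
case: (boolP (root_swap second x \in weyl n)) => h.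
  by exists (root_swap second x); rewrite // mem_gen_stab h /fixes_first r0 eqxx.
have en : ~~ odd n by move: h; rewrite weylE rh /=; case: (odd n).
exists (flip * root_swap second x)%g.
  rewrite mem_gen_stab weyl_mid_flip //= /fixes_first permM.
  rewrite (_ : flip first = first) ?r0 //; apply: val_inj; rewrite /= mid_flip_val //=.
  by have := n_even en; ifs_lia.
rewrite permM (_ : flip second = second) //; apply: val_inj; rewrite /= mid_flip_val //=.
by have := n_even en; ifs_lia.
Qed.

(** The exchange of 0 and n - 1 changes one sign; for even n it belongs to W
    only after a second sign change. *)
Definition longest_rep : 'S_n :=
  if odd n then tperm first (rev_ord first) else (flip * tperm first (rev_ord first))%g.

Lemma longest_rep_val x : longest_rep x = 
  (if x == 0 :> nat then n.-1 else if x == n.-1 :> nat then 0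
   else if ~~ odd n then if x == m.-1 :> nat then m else if x == m :> nat then m.-1 else x
   else x) :> nat.
Proof.
have xn := ltn_ord x.
have ne := odd_or_half_ge3 n_even.
rewrite /longest_rep; case: (boolP (odd n)) => on.
  by rewrite tperm_val /=; ifs_lia.
rewrite permM tperm_val /=; have := mid_flip_val n_ge3 n_even x on.
by move: (flip x) => y; ifs_lia.
Qed.

Lemma longest_rep_weyl : longest_rep \in weyl n.
Proof.
have f0 : first != rev_ord first by rewrite -(inj_eq val_inj) /=; lia.
have th : tperm first (rev_ord first) \in weyl_hat n.
  by have := root_swap_hat (rev_ord first) f0; rewrite /root_swap rev_ordK eq_sym (negbTE f0) eqxx.
rewrite /longest_rep; case: (boolP (odd n)) => on; first by rewrite weylE th on.
apply: weyl_mid_flip => //; rewrite weylE th (negbTE on) /= negbK.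
rewrite (_ : crossings _ = 1) // /crossings.
rewrite (_ : [set i | _]%SET = [set first]%SET) ?cards1 //.
apply/setP => x; rewrite !inE -(inj_eq val_inj) tperm_val /=.
by have := n_even on; ifs_lia.
Qed.

Lemma longest_rep_first : longest_rep first = rev_ord first.
Proof. by apply: val_inj; rewrite /= longest_rep_val /=; lia. Qed.

Lemma longest_rep_inversions :
  inversions longest_rep = [set u | posroot u & (u.1 == first) || (u.2 == rev_ord first)]%SET.
Proof.
apply/setP => -[x y]; rewrite mem_inversions !inE.
case: (boolP (posroot (x, y))) => //= /andP[/= xy yx].
move: yx; rewrite -!(inj_eq val_inj) /=.
have := longest_rep_val x; have := longest_rep_val y.
move: (longest_rep x) (longest_rep y) => x' y'.
have xn := ltn_ord x; have yn := ltn_ord y.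
have ne := odd_or_half_ge3 n_even.
case: (boolP (odd n)) => on /=; ifs_lia.
Qed.

(** The inversions of longest_rep are the pairs that involve 0 or n - 1, and
    they are inverted by every v that exchanges these two. *)
Lemma inversions_longest_rep v : v \in weyl n -> v first = rev_ord first ->
  inversions longest_rep \subset inversions v.
Proof.
move=> vw v0; have vr := weyl_hatP _ (weyl_sub_hat vw).
have ne x y : x != y -> v x != v y :> nat.
  by rewrite (inj_eq val_inj) (inj_eq perm_inj).
apply/fintype.subsetP => -[x y]; rewrite longest_rep_inversions mem_inversions !inE.
case/andP => /andP[/= xy yx] h; apply/andP; split; first by apply/andP.
have hxy : x != y by rewrite -(inj_eq val_inj) /=; lia.
have := ne _ _ hxy; have := ltn_ord (v x); have := ltn_ord (v y).
case/orP: h => /eqP E.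
  by rewrite E v0 /=; lia.
by rewrite E vr v0 rev_ordK /=; lia.
Qed.

(** If v has no inversions besides those of longest_rep, then the product of
    longest_rep with v has no descent and is 1. *)
Lemma longest_rep_min v : v \in weyl n -> v first = rev_ord first ->
  #|inversions longest_rep| <= #|inversions v| ?= iff (v == longest_rep).
Proof.
move=> vw v0; have sub := inversions_longest_rep vw v0.
have [le eq] := subset_leqif_cards sub.
split => //; rewrite eq; apply/eqP/eqP => [iv|->] //.
have vr := weyl_hatP _ (weyl_sub_hat vw).
have wr := weyl_hatP _ (weyl_sub_hat longest_rep_weyl).
have inv : (longest_rep * longest_rep = 1)%g.
  apply/permP => x; apply: val_inj; rewrite permM perm1 /= longest_rep_val.
  have := longest_rep_val x; move: (longest_rep x) => y.
  have xn := ltn_ord x; have ne := odd_or_half_ge3 n_even.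
  by case: (boolP (odd n)) => on /=; ifs_lia.
suff : (longest_rep * v)%g = 1%g.
  by move=> /(congr1 (fun u => longest_rep * u)%g); rewrite mulgA inv mul1g mulg1.
apply: no_descent_weyl => //; first by rewrite weylM ?longest_rep_weyl.
move=> j; rewrite !permM.
have [ab ar rP] := simple_rootP n_ge3 n_even j.
have lr x : longest_rep x = _ :> nat := longest_rep_val x.
have [a0|a0] := eqVneq (simple_root j).1 first.
  rewrite a0 longest_rep_first vr v0 rev_ordK /= lt0n -[0]/(val first).
  have -> : first = v (rev_ord first) by rewrite vr v0 rev_ordK.
  rewrite (inj_eq val_inj) (inj_eq perm_inj) -longest_rep_first (inj_eq perm_inj).
  rewrite -a0 -(inj_eq val_inj) /=; lia.
have : (longest_rep (simple_root j).1, longest_rep (simple_root j).2) \notin inversions v.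
  rewrite -iv longest_rep_inversions inE /= -longest_rep_first (inj_eq perm_inj).
  apply/nandP; right; apply/norP; split.
    rewrite -(inj_eq val_inj) /= lr; move: a0; rewrite -(inj_eq val_inj) /=.
    by have := ltn_ord (simple_root j).2; ifs_lia.
  by rewrite -(inj_eq val_inj) /=; lia.
rewrite mem_inversions /posroot /=.
rewrite -wr (inj_eq perm_inj).
have -> : (longest_rep (simple_root j).1 < longest_rep (simple_root j).2).
  rewrite !lr; move: a0; rewrite -(inj_eq val_inj) /=.
  have := ltn_ord (simple_root j).2.
  have ne := odd_or_half_ge3 n_even.
  by case: (boolP (odd n)) => on /=; case: rP => -[bE rP]; ifs_lia.
have -> : (simple_root j).2 != rev_ord (simple_root j).1.
  rewrite -(inj_eq val_inj) /=; lia.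
rewrite -leqNgt leq_eqVlt => /orP[|//].
rewrite (inj_eq val_inj) !(inj_eq perm_inj) -(inj_eq val_inj) /=; lia.
Qed.

End DoubleCosets.

(** * Representatives of minimal length *)

Section MinimalRepresentatives.
Local Open Scope nat_scope.
Variable n : nat.
Hypothesis n_ge3 : 3 <= n.
Hypothesis n_even : ~~ odd n -> 3 <= n./2.
Local Notation m := n./2.
Implicit Types (x y : 'I_n) (j : 'I_m) (v w : 'S_n).
Local Notation first := (first n_ge3).
Local Notation stab_refl := (stab_refl n).
Local Notation second := (second n_ge3).
Local Notation longest_rep := (longest_rep n_ge3).

Lemma inversions_simple_refl j : #|inversions (simple_refl j)| = 2.
Proof.
have := inversions_mul n_ge3 n_even j (weyl_hat1 n); rewrite !perm1 mulg1 inversions1 //.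
by have [-> _ _] := simple_rootP n_ge3 n_even j; rewrite /= addn0.
Qed.

Lemma card_longest_rep : #|inversions longest_rep| = (n - 2).*2.
Proof.
pose A := [set (first, y) | y in ~: [set first; rev_ord first]]%SET.
pose B := [set (y, rev_ord first) | y in ~: [set first; rev_ord first]]%SET.
have f0 : first != rev_ord first by rewrite -(inj_eq val_inj) /=; lia.
have cC : #|~: [set first; rev_ord first]| = n - 2.
  by rewrite cardsCs finset.setCK cards2 f0 card_ord.
have -> : inversions longest_rep = (A :|: B)%SET.
  apply/setP => -[x y]; rewrite (longest_rep_inversions n_ge3 n_even) !inE.
  apply/andP/orP => [[/andP[/= xy yx]]|].
    case/orP => /eqP E; [left|right]; subst; apply/imsetP.
      by exists y => //; rewrite !inE negb_or yx andbT -(inj_eq val_inj) /=; lia.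
    exists x => //; rewrite !inE negb_or; apply/andP; split.
      by apply: contra yx => /eqP->.
    by rewrite -(inj_eq val_inj) /=; move: xy => /=; lia.
  case=> /imsetP[z]; rewrite !inE negb_or => /andP[z0 zn] [-> ->].
    rewrite /posroot /= zn ?eqxx; split=> //; move: z0; rewrite -(inj_eq val_inj) /=; lia.
  rewrite /posroot /= eqxx orbT (inj_eq rev_ord_inj) eq_sym z0 andbT; split=> //.
  by move: zn z0; rewrite -!(inj_eq val_inj) /=; have := ltn_ord z; lia.
rewrite cardsU (_ : A :&: B = finset.set0)%SET; last first.
  apply/setP => -[x y]; rewrite !inE; apply/negbTE/negP => /andP[/imsetP[z]].
  rewrite !inE negb_or => /andP[z0 zn] [-> ->] /imsetP[z' _ [_ /eqP]].
  by rewrite (negbTE zn).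
rewrite cards0 subn0 !card_imset ?cC ?addnn //; first by move=> ? ? [].
by move=> ? ? [].
Qed.

Lemma simple_refl_first (i1 : 'I_m) : i1 = 0 :> nat ->
  simple_refl i1 first = (if n == 3 then rev_ord first else second).
Proof.
move=> i10; have [aE bE] := simple_root_val n_ge3 n_even i1.
have [sa _] := simple_refl_root n_ge3 n_even i1.
have a0 : (simple_root i1).1 = first by apply: val_inj; rewrite /= aE i10; case: ifP.
have b1 : (simple_root i1).2 = second by apply: val_inj; rewrite /= bE i10.
by rewrite -{1}a0 sa b1 a0 /=; congr (if _ then _ else _); lia.
Qed.

Lemma simple_refl_longest_rep (i1 : 'I_m) : i1 = 0 :> nat -> n = 3 ->
  simple_refl i1 = longest_rep.
Proof.
move=> i10 n3.
have s0 : simple_refl i1 first = rev_ord first by rewrite simple_refl_first // ifT //; apply/eqP.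
have [_ eq] := longest_rep_min n_even (simple_refl_weyl n_ge3 n_even i1) s0.
by apply/eqP; rewrite -eq card_longest_rep inversions_simple_refl; apply/eqP; lia.
Qed.

Lemma inversions_gt0 w : w \in weyl n -> w != 1%g -> 2 <= #|inversions w|.
Proof.
move=> ww; have [t [tE ts _]] := weyl_word n_ge3 n_even ww.
rewrite -ts; apply: contraNleq; case: t tE {ts} => [->|//].
by rewrite big_nil.
Qed.

Lemma inversions_le2 w : w \in weyl n -> #|inversions w| <= 2 ->
  w = 1%g \/ exists j, w = simple_refl j.
Proof.
move=> ww; have [t [tE ts _]] := weyl_word n_ge3 n_even ww.
rewrite -ts; case: t tE {ts} => [|j [|//]] -> _; first by left; rewrite big_nil.
by right; exists j; rewrite big_seq1.
Qed.

(** The values w 0 = 0, w 0 = n - 1 and the remaining values of w 0 give one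
    double coset each, the last one being empty for n = 3. Their elements of
    minimal length are the identity, longest_rep by longest_rep_min, and the
    only simple reflection that moves 0. *)
Lemma min_dcoset_repsE (i1 : 'I_m) : i1 = 0 :> nat ->
  min_dcoset_reps stab_refl stab_refl = [set 1%g; simple_refl i1; longest_rep]%SET.
Proof.
move=> i10; have f0 : first != rev_ord first by rewrite -(inj_eq val_inj) /=; lia.
have s1w := simple_refl_weyl n_ge3 n_even i1; have lw := longest_rep_weyl n_ge3 n_even.
have w1 := weyl1 n.
have l0 := longest_rep_first n_ge3 n_even.
apply/setP => w; rewrite inE !finset.in_setU !finset.in_set1.
have [ww /=|nw /=] := boolP (w \in weyl n); last first.
  by apply/esym/negbTE; apply: contraNN nw => /orP[/orP[]|] /eqP->.
have wr := weyl_first_mid n_ge3 n_even (weyl_sub_hat ww).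
apply/forall_inP/idP => [wmin|].
  have le v : v \in weyl n -> v \in weyl_dcoset stab_refl stab_refl w ->
      #|inversions w| <= #|inversions v|.
    by move=> vw vd; rewrite -(leq_weyl_length n_ge3 n_even) // wmin.
  have [wf|wf] := eqVneq (w first) first.
    suff -> : w = 1%g by rewrite eqxx.
    apply/eqP; apply: contraT => /(inversions_gt0 ww); rewrite ltnNge.
    rewrite (leq_trans (le _ w1 _)) ?inversions1 //.
    by apply: (@dcoset_transport _ n_ge3 n_even _ _ 1%g); rewrite ?group1 // !perm1.
  have [wl|wl] := eqVneq (w first) (rev_ord first).
    suff -> : w = longest_rep by rewrite eqxx orbT.
    have [ge eq] := longest_rep_min n_even ww wl; apply/eqP; rewrite -eq eqn_leq ge le //.
    by apply: (@dcoset_transport _ n_ge3 n_even _ _ 1%g); rewrite ?group1 // !perm1 wl.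
  have n3 : n != 3.
    apply/eqP => n3; move: wf wl wr; rewrite -!(inj_eq val_inj) /=.
    by have := ltn_ord (w first); lia.
  have s1f : simple_refl i1 first = second by rewrite simple_refl_first // (negbTE n3).
  have [l lJ l2] := stab_transitive n_even n3 wr wf wl.
  have : #|inversions w| <= 2.
    rewrite -(inversions_simple_refl i1); apply: le => //.
    apply: (@dcoset_transport _ n_ge3 n_even _ _ (l^-1)%g); rewrite ?groupV //.
    by rewrite s1f -l2 permK.
  case/inversions_le2 => // [wE|[j wE]]; first by rewrite wE perm1 eqxx in wf.
  suff ji : j = i1 by rewrite wE ji eqxx orbT.
  apply: val_inj; rewrite /= i10; apply/eqP; apply: contraT => j0.
  by move: wf; rewrite wE (eqP (simple_refl_fix n_ge3 n_even j0)) eqxx.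
have lmin v : v \in weyl_dcoset stab_refl stab_refl longest_rep ->
    weyl_length longest_rep <= weyl_length v.
  move=> /(dcoset_weyl n_ge3 n_even lw)[vw _]; rewrite l0 eqxx => /eqP v0.
  by rewrite (leq_weyl_length n_ge3 n_even) //; have [] := longest_rep_min n_even vw v0.
case/orP=> [/orP[]|] /eqP-> v // vd; last exact: lmin.
  have [vw _ _] := dcoset_weyl n_ge3 n_even w1 vd.
  by rewrite (leq_weyl_length n_ge3 n_even) // inversions1.
have [n3|n3] := eqVneq n 3.
  by move: vd; rewrite simple_refl_longest_rep //; apply: lmin.
have [vw vf _] := dcoset_weyl n_ge3 n_even s1w vd.
rewrite (leq_weyl_length n_ge3 n_even) // inversions_simple_refl inversions_gt0 //.
apply/eqP => v1; move: vf; rewrite v1 perm1 eqxx simple_refl_first // (negbTE n3).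
by rewrite -(inj_eq val_inj).
Qed.

Lemma longest_rep_longest (i1 : 'I_m) w : i1 = 0 :> nat ->
  w \in [set 1%g; simple_refl i1; longest_rep]%SET -> w != longest_rep ->
  weyl_length w < weyl_length longest_rep.
Proof.
move=> i10; rewrite !inE.
have lw := longest_rep_weyl n_ge3 n_even; have s1w := simple_refl_weyl n_ge3 n_even i1.
have w1 := weyl1 n.
have E v : v \in weyl n ->
    (weyl_length v < weyl_length longest_rep) = (#|inversions v| < (n - 2).*2).
  by move=> vw; rewrite -card_longest_rep !ltnNge (leq_weyl_length n_ge3 n_even).
case/orP=> [/orP[]|] /eqP-> // wl; rewrite ?eqxx // in wl *; rewrite E //.
  by rewrite inversions1 //; lia.
rewrite inversions_simple_refl.
suff : n != 3 by lia.
by apply: contraNneq wl => n3; rewrite simple_refl_longest_rep.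
Qed.

End MinimalRepresentatives.

(** * Similitudes, Eichler transformations and reflections *)

Section Similitudes.
Variables (R : comNzRingType) (n : nat).
Implicit Types (A g h : 'M[R]_n) (x y v : 'cV[R]_n).

Definition simil A h (c : R) : Prop := h^T *m A *m h = c *: A.

Lemma simil1 A : simil A 1%:M 1.
Proof. by rewrite /simil trmx1 mul1mx mulmx1 scale1r. Qed.

Lemma similM A g h c d : simil A g c -> simil A h d -> simil A (g *m h) (c * d).
Proof.
move=> gc hd; rewrite /simil trmx_mul -!mulmxA (mulmxA A) (mulmxA g^T) (mulmxA g^T) gc.
by rewrite -scalemxAl -scalemxAr mulmxA hd scalerA.
Qed.

Lemma simil_scalar A (c : R) : simil A c%:M (c ^+ 2).
Proof.
by rewrite /simil tr_scalar_mx mul_scalar_mx -scalemxAl mul_mx_scalar scalerA expr2.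
Qed.

Lemma simil_conj (E E' : 'M[R]_n) A h c : E *m E' = 1%:M ->
  simil (E^T *m A *m E) h c -> simil A (E *m h *m E') c.
Proof.
rewrite /simil => EE' hc.
have -> : (E *m h *m E')^T *m A *m (E *m h *m E') =
    E'^T *m (h^T *m (E^T *m A *m E) *m h) *m E'.
  by rewrite !trmx_mul !mulmxA.
rewrite hc -scalemxAr -scalemxAl; congr (_ *: _).
rewrite -!mulmxA EE' mulmx1 mulmxA -trmx_mul EE' trmx1 mul1mx //.
Qed.

Definition bform A x y : R := (x^T *m A *m y) 0 0.

(** For x isotropic, y orthogonal to x and bform A y y = 2 q this is an
    isometry which fixes x. *)
Definition eichler A x y (q : R) : 'M[R]_n :=
  1%:M - y *m (A *m x)^T + x *m (A *m y)^T - q *: (x *m (A *m x)^T).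

Lemma eichlerE A x y q k l :
  eichler A x y q k l = (k == l)%:R - y k 0 * (A *m x) l 0
    + x k 0 * (A *m y) l 0 - q * (x k 0 * (A *m x) l 0).
Proof.
rewrite /eichler; move: (A *m x) (A *m y) => X Y.
by rewrite !mxE !big_ord1 !mxE.
Qed.

Lemma eichler_mul A x y q z : A^T = A -> eichler A x y q *m z =
  z - bform A x z *: y + bform A y z *: x - (q * bform A x z) *: x.
Proof.
move=> As; have dot v : (A *m v)^T *m z = (bform A v z)%:M.
  by rewrite [LHS]mx11_scalar /bform trmx_mul As.
rewrite /eichler; move: (A *m x) (A *m y) (dot x) (dot y) => X Y dx dy.
rewrite !mulmxBl mulmxDl mulmxBl mul1mx -scalemxAl -!mulmxA dx dy.
by rewrite !mul_mx_scalar scalerA.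
Qed.

Lemma eichler_simil A x y q : A^T = A ->
  bform A x x = 0 -> bform A x y = 0 -> bform A y y = q + q ->
  simil A (eichler A x y q) 1.
Proof.
move=> As xx xy yy.
rewrite /eichler /simil.
have [X XE] : exists X, X = A *m x by exists (A *m x).
have [Y YE] : exists Y, Y = A *m y by exists (A *m y).
have sc u v (c : R) : bform A u v = c -> u^T *m (A *m v) = c%:M.
  by move=> <-; rewrite [LHS]mx11_scalar mulmxA.
have XT : X^T = x^T *m A by rewrite XE trmx_mul As.
have YT : Y^T = y^T *m A by rewrite YE trmx_mul As.
have xX : x^T *m X = 0 by rewrite XE (sc _ _ _ xx) raddf0.
have xY : x^T *m Y = 0 by rewrite YE (sc _ _ _ xy) raddf0.
have yX : y^T *m X = 0 by apply: trmx_inj; rewrite trmx_mul trmxK trmx0 XT -mulmxA -YE xY.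
have yY : y^T *m Y = (q + q)%:M by rewrite YE (sc _ _ _ yy).
rewrite -XE -YE.
pose M := A - Y *m X^T + X *m Y^T - q *: (X *m X^T).
have AE : A *m (1%:M - y *m X^T + x *m Y^T - q *: (x *m X^T)) = M.
  by rewrite mulmxBr mulmxDr mulmxBr mulmx1 -scalemxAr 3!(mulmxA A) -XE -YE.
have xAE : x^T *m M = X^T.
  rewrite mulmxBr mulmxDr mulmxBr -scalemxAr 3!(mulmxA x^T) xX xY.
  by rewrite !mul0mx scaler0 !subr0 addr0 XT.
have yAE : y^T *m M = Y^T - (q + q) *: X^T.
  rewrite mulmxBr mulmxDr mulmxBr -scalemxAr 3!(mulmxA y^T) yX yY.
  by rewrite !mul0mx scaler0 subr0 addr0 YT mul_scalar_mx.
rewrite -mulmxA AE.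
have -> : (1%:M - y *m X^T + x *m Y^T - q *: (x *m X^T))^T =
    1%:M - X *m y^T + Y *m x^T - q *: (X *m x^T).
  by rewrite !raddfB raddfD raddfB /= [(q *: _)^T]linearZ /= trmx1 !trmx_mul !trmxK.
rewrite mulmxBl mulmxDl mulmxBl mul1mx -scalemxAl -3!mulmxA xAE yAE.
rewrite mulmxBr -scalemxAr scale1r /M.
move: (X *m X^T) (X *m Y^T) (Y *m X^T) => a b d.
by apply/matrixP => i j; rewrite !mxE; ring.
Qed.

(** The reflection is multiplied by bform A v v, so that its entries are
    polynomials in v. *)
Definition refl_mx A v : 'M[R]_n :=
  (bform A v v)%:M - 2%:R *: (v *m (A *m v)^T).

Lemma refl_mx_simil A v : A^T = A -> simil A (refl_mx A v) (bform A v v ^+ 2).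
Proof.
move=> As; rewrite /refl_mx /simil; set q := bform A v v.
have [V VE] : exists V, V = A *m v by exists (A *m v).
have VT : V^T = v^T *m A by rewrite VE trmx_mul As.
have vV : v^T *m V = q%:M by rewrite VE mulmxA [LHS]mx11_scalar.
rewrite -VE -mulmxA.
have -> : A *m (q%:M - 2%:R *: (v *m V^T)) = q *: A - 2%:R *: (V *m V^T).
  by rewrite mulmxBr mul_mx_scalar -scalemxAr mulmxA -VE.
have -> : (q%:M - 2%:R *: (v *m V^T))^T = q%:M - 2%:R *: (V *m v^T).
  by rewrite raddfB /= [(2%:R *: _)^T]linearZ /= tr_scalar_mx trmx_mul trmxK.
rewrite mulmxBl mul_scalar_mx -scalemxAl -mulmxA (mulmxBr v^T) -!scalemxAr mulmxA vV.
rewrite -VT mul_scalar_mx mulmxBr -!scalemxAr.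
move: (V *m V^T) => a.
by apply/matrixP => i j; rewrite !mxE; ring.
Qed.

End Similitudes.

Lemma simil_map (R S : comNzRingType) (f : {rmorphism R -> S}) n (A h : 'M[R]_n) c :
  simil A h c -> simil (map_mx f A) (map_mx f h) (f c).
Proof. by move=> hc; rewrite /simil map_trmx -!map_mxM hc map_mxZ. Qed.

Lemma bform_map (R S : comNzRingType) (f : {rmorphism R -> S}) n
    (A : 'M[R]_n) (x y : 'cV[R]_n) :
  f (bform A x y) = bform (map_mx f A) (map_mx f x) (map_mx f y).
Proof. by rewrite /bform map_trmx -!map_mxM [RHS]mxE. Qed.

Lemma refl_mx_map (R S : comNzRingType) (f : {rmorphism R -> S}) n
    (A : 'M[R]_n) (v : 'cV[R]_n) :
  map_mx f (refl_mx A v) = refl_mx (map_mx f A) (map_mx f v).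
Proof.
by rewrite /refl_mx map_mxB map_scalar_mx map_mxZ rmorph_nat map_mxM -map_trmx map_mxM bform_map.
Qed.

(** * Monomial matrices and antidiagonal forms *)

Section AntidiagonalForms.
Variables (R : comNzRingType) (n : nat) (A : 'M[R]_n).
Hypothesis A_anti : forall k l : 'I_n, l != rev_ord k -> A k l = 0.
Implicit Types (x y v : 'cV[R]_n) (g h : 'M[R]_n) (k l r : 'I_n) (w : 'S_n).
Local Notation a r := (A r (rev_ord r)).

Lemma anti_mul v r : (A *m v) r 0 = a r * v (rev_ord r) 0.
Proof.
rewrite mxE (bigD1 (rev_ord r)) //= big1 ?addr0 // => l lr.
by rewrite A_anti ?mul0r.
Qed.

Lemma bform_anti x y : bform A x y = \sum_r x r 0 * a r * y (rev_ord r) 0.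
Proof.
rewrite /bform -mulmxA mxE; apply: eq_bigr => r _.
by rewrite mxE anti_mul mulrA.
Qed.

Lemma form_entry h k l :
  (h^T *m A *m h) k l = \sum_r h r k * a r * h (rev_ord r) l.
Proof.
have -> : (h^T *m A *m h) k l = bform A (col k h) (col l h).
  rewrite /bform mxE [RHS]mxE; apply: eq_bigr => j _; rewrite !mxE; congr (_ * _).
  by apply: eq_bigr => i _; rewrite !mxE.
by rewrite bform_anti; apply: eq_bigr => r _; rewrite !mxE.
Qed.

Definition monomial (w : 'S_n) h := forall k l, k != w l -> h k l = 0.

Lemma monomial_mul w g h k l : monomial w g -> (g *m h) (w k) l = g (w k) k * h k l.
Proof.
move=> gw; rewrite mxE (bigD1 k) //= big1 ?addr0 // => j jk.
by rewrite gw ?mul0r // (inj_eq perm_inj) eq_sym.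
Qed.

Lemma monomial_mulr w g h k l : monomial w g -> (h *m g) k l = h k (w l) * g (w l) l.
Proof.
move=> gw; rewrite mxE (bigD1 (w l)) //= big1 ?addr0 // => j jk.
by rewrite gw ?mulr0.
Qed.

Lemma monomialM w w' g h :
  monomial w g -> monomial w' h -> monomial (w' * w)%g (g *m h).
Proof.
move=> gw hw k l; rewrite permM => kl.
by rewrite (monomial_mulr _ _ _ hw) gw ?mul0r.
Qed.

Lemma monomial_simil w g c : w \in weyl_hat n -> monomial w g ->
    (forall k, g (w k) k * a (w k) * g (w (rev_ord k)) (rev_ord k) = c * a k) ->
  simil A g c.
Proof.
move=> /weyl_hatP wr gw gc; apply/matrixP => k l.
rewrite form_entry (bigD1 (w k)) //= big1 ?addr0 => [|j jk]; last by rewrite gw ?mul0r.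
have [->|lk] := eqVneq l (rev_ord k); first by rewrite mxE -gc !wr.
rewrite [g (rev_ord (w k)) l]gw ?mulr0 ?mxE ?A_anti ?mulr0 //.
by rewrite -wr (inj_eq perm_inj) eq_sym.
Qed.

End AntidiagonalForms.

(** * Elimination in the stabiliser of an isotropic line *)

Section Antidiagonal.
Variables (K : fieldType) (n : nat) (A : 'M[K]_n).
Hypothesis A_sym : A^T = A.
Hypothesis A_unit : A \in unitmx.
Hypothesis A_anti : forall k l : 'I_n, l != rev_ord k -> A k l = 0.
Implicit Types (g h u : 'M[K]_n) (x y v : 'cV[K]_n) (k l r p : 'I_n) (c : K).
Local Notation a r := (A r (rev_ord r)).

Lemma simil_unit h c : c != 0 -> simil A h c -> h \in unitmx.
Proof.
move=> c0 hc; have : (c^-1 *: (invmx A *m h^T *m A)) *m h = 1%:M.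
  by rewrite -scalemxAl -!mulmxA (mulmxA h^T) hc -scalemxAr mulVmx // scalerA mulVf ?scale1r.
by case/mulmx1_unit.
Qed.

Lemma similV h c : c != 0 -> simil A h c -> simil A (invmx h) c^-1.
Proof.
move=> c0 hc; have hu := simil_unit c0 hc.
apply: (scalerI c0); rewrite scalerA mulfV // scale1r scalemxAl scalemxAr -hc trmx_inv.
by rewrite !mulmxA mulVmx ?unitmx_tr // mul1mx -mulmxA mulmxV ?mulmx1.
Qed.

Lemma anti_neq0 k : a k != 0.
Proof.
apply/eqP => ak; have : row k A = 0.
  by apply/rowP => l; rewrite !mxE; have [->|/A_anti] := eqVneq l (rev_ord k).
rewrite rowE => /(congr1 (mulmx^~ (invmx A))); rewrite mulmxK // mul0mx.
by move=> /matrixP/(_ 0 k); rewrite !mxE !eqxx => /eqP; rewrite oner_eq0.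
Qed.

Lemma anti_rev k : A (rev_ord k) k = a k.
Proof. by rewrite -{1}A_sym mxE. Qed.

Lemma simil_colsum h c k l : simil A h c ->
  \sum_r h r k * a r * h (rev_ord r) l = c * A k l.
Proof. by move=> hc; rewrite -(form_entry A_anti) hc mxE. Qed.

Definition upper u := forall k l, (l < k)%N -> u k l = 0.

(** An Eichler transformation has this effect: x is proportional to e_(rev_ord
    p), so that the pairing with x is the coordinate p, and y is v / v p
    without its coordinates p and rev_ord p. It is upper triangular since y
    vanishes beyond p. *)
Lemma clear_vector v p :
    v p 0 != 0 -> (forall r, (p < r)%N -> v r 0 = 0) -> bform A v v = 0 ->
  p != rev_ord p /\
  exists u, [/\ upper u, simil A u 1, u *m v = v p 0 *: delta_mx p 0
    & forall l, l != p -> v (rev_ord l) 0 = 0 -> forall k, u k l = (k == l)%:R].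
Proof.
move=> vp vmax vv; set s := rev_ord p.
have sp : p != s.
  apply: contra_eqN vv => /eqP ps; rewrite (bform_anti A_anti) (bigD1 p) //= big1 ?addr0.
    by rewrite !mulf_neq0 ?anti_neq0 // -/s -ps.
  move=> r rp; case: (ltngtP p r) => [/vmax->|pr|/val_inj E]; rewrite ?mul0r //.
    rewrite (vmax (rev_ord r)) ?mulr0 //; move/(congr1 val): ps => /=.
    by have := ltn_ord r; lia.
  by rewrite E eqxx in rp.
split => //.
pose w := (v p 0)^-1 *: v.
have wE r : w r 0 = v r 0 / v p 0 by rewrite mxE mulrC.
have wp : w p 0 = 1 by rewrite wE divff.
have wmax r : (p < r)%N -> w r 0 = 0 by move=> /vmax h; rewrite wE h mul0r.
pose x : 'cV[K]_n := (a p)^-1 *: delta_mx s 0.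
pose y : 'cV[K]_n := \col_r (if (r == p) || (r == s) then 0 else w r 0).
pose q := - (w s 0 * a p).
have xE r : x r 0 = (r == s)%:R / a p by rewrite !mxE andbT mulrC.
have yE r : y r 0 = if (r == p) || (r == s) then 0 else w r 0 by rewrite mxE.
have xz z : bform A x z = z p 0.
  rewrite (bform_anti A_anti) (bigD1 s) //= big1 ?addr0 => [|r /negbTE rs].
    by rewrite xE eqxx /s rev_ordK anti_rev div1r mulVf ?anti_neq0 ?mul1r.
  by rewrite xE rs !mul0r.
have ps : (s == p) = false by rewrite eq_sym (negbTE sp).
have xx : bform A x x = 0 by rewrite xz xE (negbTE sp) mul0r.
have xy : bform A x y = 0 by rewrite xz yE eqxx.
have yrev r : y (rev_ord r) 0 = if (r == p) || (r == s) then 0 else w (rev_ord r) 0.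
  rewrite yE [rev_ord r == s](inj_eq rev_ord_inj).
  by rewrite -[rev_ord r == p](inj_eq rev_ord_inj) rev_ordK orbC.
have yw : bform A y w = bform A y y.
  rewrite !(bform_anti A_anti); apply: eq_bigr => r _; rewrite yrev yE.
  by case: ifP => _; rewrite ?mul0r.
have ww : bform A w w = 0.
  have wT : w^T = (v p 0)^-1 *: v^T by rewrite linearZ.
  by rewrite /bform wT -!scalemxAl -scalemxAr mxE [X in _ * X]mxE -/(bform A v v) vv !mulr0.
have yy : bform A y y = q + q.
  move: ww; rewrite !(bform_anti A_anti).
  rewrite (bigD1 p) //= (bigD1 s) /= 1?eq_sym // -/s wp mul1r /s rev_ordK anti_rev wp mulr1.
  rewrite [in X in _ -> X](bigD1 p) //= [in X in _ -> X](bigD1 s) /= 1?eq_sym //.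
  rewrite !yE !eqxx orbT !mul0r !add0r.
  rewrite [in X in _ -> X](eq_bigr (fun r => w r 0 * a r * w (rev_ord r) 0)) => [|r /andP[rp rs]].
    by move=> /eqP; rewrite /q [a p * _]mulrC addrA addrC addr_eq0 opprD => /eqP.
  by rewrite yrev yE (negbTE rp) (negbTE rs).
pose u := eichler A x y q.
have us : simil A u 1 by exact: eichler_simil.
have uE k l : u k l = (k == l)%:R - y k 0 * (l == p)%:R
    + x k 0 * (a l * y (rev_ord l) 0) - q * x k 0 * (l == p)%:R.
  have AxE : (A *m x) l 0 = (l == p)%:R.
    rewrite (anti_mul A_anti) xE [rev_ord l == s](inj_eq rev_ord_inj).
    have [->|] := eqVneq l p; first by rewrite div1r mulfV ?anti_neq0.
    by rewrite mul0r mulr0.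
  by rewrite /u eichlerE AxE (anti_mul A_anti) [q * (_ * _)]mulrA.
exists u; split => //.
- move=> k l lk; rewrite uE xE.
  have -> : (k == l) = false by rewrite -(inj_eq val_inj) /=; lia.
  have yk : y k 0 * (l == p)%:R = 0.
    have [lp|] := eqVneq l p; last by rewrite mulr0.
    by rewrite yE wmax ?if_same ?mul0r // -lp.
  have xk : (k == s)%:R * (l == p)%:R * w s 0 = 0 :> K.
    have [ks|] := eqVneq k s; last by rewrite !mul0r.
    have [lp|] := eqVneq l p; last by rewrite mulr0 mul0r.
    by rewrite wmax ?mulr0 // -ks -lp.
  have xy' : (k == s)%:R * y (rev_ord l) 0 = 0.
    have [ks|] := eqVneq k s; last by rewrite mul0r.
    rewrite yE wmax ?if_same ?mulr0 //=; move/(congr1 val): ks => /=.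
    by have := ltn_ord p; lia.
  rewrite yk subr0 add0r [_ / _]mulrC -!mulrA.
  rewrite [(k == s)%:R * (a l * _)]mulrCA xy' !mulr0 add0r /q.
  rewrite mulNr opprK -[w s 0 * _ * _]mulrA mulVKf ?anti_neq0 //.
  by rewrite mulrC xk.
- have -> : v = v p 0 *: w by rewrite scalerA mulfV // scale1r.
  rewrite -scalemxAr mxE wp mulr1; congr (_ *: _).
  rewrite eichler_mul // xz yw yy wp mulr1 scale1r scalerDl.
  have -> : q *: x = - w s 0 *: delta_mx s 0.
    by rewrite scalerA /q mulNr -mulrA mulfV ?anti_neq0 // mulr1.
  apply/colP => k; move: (w) (y) (yE k) (wp) => W Y YE Wp; rewrite !mxE YE andbT.
  have [->|kp] := eqVneq k p; last have [->|ks] := eqVneq k s.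
  - by rewrite Wp (negbTE sp) eqxx !mulr0 !addr0 !subr0.
  - by rewrite eqxx /=; ring.
  - by rewrite /=; ring.
- move=> l lp vl k; rewrite uE (negbTE lp) !mulr0 !subr0 yrev.
  by rewrite wE vl mul0r if_same !mulr0 addr0.
Qed.

Lemma unit_col g l : g \in unitmx -> (forall r, r != l -> g r l = 0) -> g l l != 0.
Proof.
move=> gu gl; apply/eqP => g0.
have /(congr1 (mulmx (invmx g))) : g *m delta_mx l (0 : 'I_1) = 0.
  rewrite -colE; apply/colP => r; rewrite !mxE.
  by have [->|/gl] := eqVneq r l.
rewrite mulKmx // mulmx0 => /matrixP/(_ l 0); rewrite !mxE !eqxx => /eqP.
by rewrite oner_eq0.
Qed.

Lemma monomial_coef w g l : g \in unitmx -> monomial w g -> g (w l) l != 0.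
Proof.
move=> gu gw; apply/eqP => g0.
have /(congr1 (mulmx (invmx g))) : g *m delta_mx l (0 : 'I_1) = 0.
  rewrite -colE; apply/colP => r; rewrite !mxE.
  by have [->|/gw] := eqVneq r (w l).
rewrite mulKmx // mulmx0 => /matrixP/(_ l 0); rewrite !mxE !eqxx => /eqP.
by rewrite oner_eq0.
Qed.

Lemma monomialV w g : g \in unitmx -> monomial w g -> monomial w^-1 (invmx g).
Proof.
move=> gu gw k l kl; have := monomial_coef ((w^-1)%g l) gu gw.
rewrite permKV => /negbTE g0; have := congr1 (fun M : 'M_n => M k ((w^-1)%g l)) (mulVmx gu).
rewrite (monomial_mulr _ _ _ gw) permKV !mxE (negbTE kl) => /eqP.
by rewrite mulf_eq0 g0 orbF => /eqP.
Qed.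

Lemma monomial1P g : monomial 1 g -> upper g.
Proof. by move=> g1 k l lk; rewrite g1 // perm1 -(inj_eq val_inj) /= gtn_eqF. Qed.

(** The coefficients are those for which the matrix is an isometry: of the two
    indices of a pair l, rev_ord l the smaller one gets coefficient 1. *)
Definition wmx (w : 'S_n) : 'M[K]_n := \matrix_(k, l)
  if k == w l then if (l < rev_ord l)%N then 1 else a l / a (w l) else 0.

Lemma wmx_monomial w : monomial w (wmx w).
Proof. by move=> k l /negbTE kl; rewrite mxE kl. Qed.

Lemma wmx_simil w : w \in weyl_hat n -> simil A (wmx w) 1.
Proof.
move=> wh; have wr := weyl_hatP _ wh.
apply: (monomial_simil A_anti wh (@wmx_monomial w)) => k.
rewrite !mxE !eqxx rev_ordK mul1r wr rev_ordK !anti_rev.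
have := anti_neq0 (w k).
case: ltngtP => [kr|kr|kr] h.
- by rewrite mul1r mulrC divfK.
- by rewrite mulr1 divfK.
- have wk : w k = k.
    have kE : rev_ord k = k by apply: val_inj.
    have := congr1 val (wr k); rewrite kE /= => wE; apply: val_inj => /=.
    by have := ltn_ord (w k); have := ltn_ord k; move: kr => /=; lia.
  by rewrite divfK // wk divff ?mulr1 ?anti_neq0.
Qed.

Definition col_diag (k : nat) h := forall l r, (l < k)%N -> r != l -> h r l = 0.

(** Column l of h is a multiple of e_l, so the pairing of the columns l and r
    is a multiple of the entry of h at (rev_ord l, r). *)
Lemma diag_row_rev h c (k : nat) l r : c != 0 -> simil A h c -> col_diag k h -> (l < k)%N ->
  (h (rev_ord l) r == 0) = (r != rev_ord l).
Proof.
move=> c0 hc hk lk; have := simil_colsum l r hc.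
have hl := unit_col (simil_unit c0 hc) (fun r => hk l r lk).
rewrite (bigD1 l) //= big1 ?addr0 => [E|j jl]; last by rewrite (hk l) ?mul0r.
have [rl|rl] := eqVneq r (rev_ord l).
  apply/negbTE/eqP => h0; move: E; rewrite h0 mulr0 rl => /esym/eqP.
  by rewrite mulf_eq0 (negbTE c0) (negbTE (anti_neq0 _)).
move: E; rewrite (A_anti rl) mulr0 => /eqP.
by rewrite !mulf_eq0 (negbTE hl) (negbTE (anti_neq0 _)).
Qed.

(** Column k of a similitude is isotropic, and clear_vector applies.
    Orthogonality to the columns already cleared confines its last nonzero
    entry p to the range from k to rev_ord k, and for this reason the
    transformation does not change these columns. *)
Lemma clear_column h c (k : 'I_n) : c != 0 -> simil A h c -> (k < rev_ord k)%N ->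
  col_diag k h -> exists u p,
  [/\ upper u, simil A u 1, (k <= p <= rev_ord k)%N, p != rev_ord p
    & col_diag k (u *m h) /\ forall r, r != p -> (u *m h) r k = 0].
Proof.
move=> c0 hc kr hk; have hu := simil_unit c0 hc.
have [r0 r0P] : exists r, h r k != 0.
  have [r rk|h0] := pickP (fun r => h r k != 0); first by exists r.
  suff : h k k != 0 by rewrite h0.
  by apply: unit_col => // r _; apply/eqP/negbFE/h0.
pose p := [arg max_(r > r0 | (h r k != 0)%R) (r : nat)]%N.
have [pk pmax] : h p k != 0 /\ forall r, (p < r)%N -> h r k = 0.
  rewrite /p; case: arg_maxnP => // p' pk' pmax'; split => // r pr.
  by apply/eqP/negPn/negP => /pmax' /=; rewrite leqNgt pr.
have iso : bform A (col k h) (col k h) = 0.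
  have := simil_colsum k k hc; rewrite A_anti ?mulr0; last first.
    by rewrite -(inj_eq val_inj) ltn_eqF.
  by move=> <-; rewrite (bform_anti A_anti); apply: eq_bigr => r _; rewrite !mxE.
have [|//|sp [u [uu us uv ul]]] := @clear_vector (col k h) p _ _ iso.
- by rewrite mxE.
- by move=> r pr; rewrite mxE pmax.
have rk l : (l < k)%N -> h (rev_ord l) k = 0.
  move=> lk; apply/eqP; rewrite (diag_row_rev _ c0 hc hk lk) -(inj_eq val_inj) /=.
  by move: kr => /=; lia.
have pr : (p <= rev_ord k)%N.
  rewrite leqNgt; apply/negP => kp; move: pk; rewrite -[p]rev_ordK rk ?eqxx //=.
  by move: kp => /=; have := ltn_ord p; have := ltn_ord k; lia.
have kp : (k <= p)%N.
  rewrite leqNgt; apply/negP => pk'.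
  have := simil_colsum k (rev_ord p) hc.
  rewrite A_anti; last by rewrite (inj_eq rev_ord_inj) -(inj_eq val_inj) /= ltn_eqF.
  rewrite mulr0 (bigD1 p) //= big1 ?addr0 => [/eqP|r rp].
    by rewrite !mulf_eq0 (negbTE pk) (negbTE (anti_neq0 _)) (diag_row_rev _ c0 hc hk pk') eqxx.
  have [pr'|pr'|/val_inj E] := ltngtP p r; first by rewrite pmax ?mul0r.
    apply/eqP; rewrite !mulf_eq0 (diag_row_rev _ c0 hc hk (ltn_trans pr' pk')).
    by rewrite (inj_eq rev_ord_inj) [p == r]eq_sym rp orbT.
  by rewrite E eqxx in rp.
exists u, p; split => //; first by rewrite kp pr.
split=> [l r lk rl|r rp].
  rewrite mxE (bigD1 l) //= big1 ?addr0 => [|j jl]; last by rewrite (hk l) ?mulr0.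
  rewrite ul ?(negbTE rl) ?mul0r ?mxE ?rk //.
  by rewrite -(inj_eq val_inj) /= ltn_eqF // (leq_trans lk).
have -> : (u *m h) r k = (u *m col k h) r 0 by rewrite colE mulmxA -colE [RHS]mxE.
by rewrite uv !mxE (negbTE rp) mulr0.
Qed.

(** A reflection moves the remaining entry from p to the diagonal. *)
Lemma col_diag_swap g (k p : 'I_n) : (k < rev_ord k)%N -> (k <= p <= rev_ord k)%N ->
  col_diag k g -> (forall r, r != p -> g r k = 0) -> p != rev_ord p ->
  let w := root_swap k p in
  [/\ w \in weyl_hat n, (forall l : 'I_n, (l < k)%N -> w l = l), w p = k
    & col_diag k.+1 (wmx w *m g)].
Proof.
move=> kr /andP[kp pr] gk gp pp w; have kk : k != rev_ord k by rewrite -(inj_eq val_inj) ltn_eqF.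
have wl l : (l < k)%N -> w l = l.
  move=> lk; apply: val_inj; rewrite /= root_swapE // /root_swap_val.
  by move: kr pr => /=; ifs_lia.
have wp : w p = k.
  apply: val_inj; rewrite /= root_swapE // /root_swap_val.
  by move: pp; rewrite -(inj_eq val_inj) /=; move: kr pr => /=; ifs_lia.
split => //; first exact: root_swap_hat.
move=> l r; rewrite ltnS -[r](permKV w) (monomial_mul _ _ _ (@wmx_monomial w)).
set j := (w^-1)%g r; rewrite leq_eqVlt => /orP[/eqP/val_inj ->|lk] jl.
  by rewrite gp ?mulr0 //; apply: contra jl => /eqP->; rewrite wp.
by rewrite (gk l) ?mulr0 //; apply: contra jl => /eqP->; rewrite wl.
Qed.

(** It suffices to clear the first half of the columns, as the last rows are
    then diagonal as well by diag_row_rev. *)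
Lemma col_diag_upper h c : c != 0 -> simil A h c -> col_diag n./2 h -> upper h.
Proof.
move=> c0 hc hm k l lk.
have [lm|lm] := ltnP l n./2; first by rewrite (hm l) // -(inj_eq val_inj) /= gtn_eqF.
have km : (rev_ord k < n./2)%N by move: lk lm => /=; have := ltn_ord k; lia.
apply/eqP; rewrite -[k]rev_ordK (diag_row_rev _ c0 hc hm km) rev_ordK.
by rewrite -(inj_eq val_inj) /= ltn_eqF.
Qed.

Hypothesis n_ge3 : (3 <= n)%N.

(** Elimination column by column reduces a similitude fixing the line of e_0
    to an upper triangular one, by upper triangular isometries and monomial
    isometries which fix e_0. The form of an induction principle makes it
    applicable to double cosets. *)
Lemma stab_ind (S : 'M[K]_n -> Prop) :
    (forall u c, c != 0 -> upper u -> simil A u c -> S u) ->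
    (forall u h c, c != 0 -> simil A h c -> upper u -> simil A u 1 ->
       S (u *m h) -> S h) ->
    (forall w h c, w \in weyl_hat n -> fixes_first n_ge3 w -> c != 0 -> simil A h c ->
       S (wmx w *m h) -> S h) ->
  forall h c, c != 0 -> simil A h c ->
    (forall r, r != first n_ge3 -> h r (first n_ge3) = 0) -> S h.
Proof.
move=> Sbase Supper Smon h c c0 hc h1.
have {h1} : col_diag 1 h.
  move=> l r l1; have -> : l = first n_ge3 by apply: val_inj => /=; lia.
  exact: h1.
have n1 : (1 <= n./2)%N by lia.
suff gen d (k : nat) g : (n./2 - k)%N = d -> (0 < k)%N -> (k <= n./2)%N -> simil A g c ->
    col_diag k g -> S g by move=> h1; apply: (gen _ 1%N h erefl).
elim: d k g {h hc} => [|d IH] k h dE k0 km hc hk.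
  have kE : k = n./2 by lia.
  by apply: (Sbase _ c) => //; apply: (col_diag_upper c0 hc); rewrite -kE.
have kn : (k < n)%N by lia.
have kr : (Ordinal kn < rev_ord (Ordinal kn))%N by move=> /=; lia.
have [u [p [uu us kp pp [uk up]]]] := clear_column c0 hc kr hk.
have [wh wl wp wk] := col_diag_swap kr kp uk up pp.
apply: (Supper u h c) => //.
have uhc : simil A (u *m h) c by rewrite -[c]mul1r; apply: similM.
apply: (Smon (root_swap (Ordinal kn) p) _ c) => //.
  by apply/eqP/wl; exact: k0.
apply: (IH k.+1) => //; try lia.
by rewrite -[c]mul1r; apply: similM => //; apply: wmx_simil.
Qed.

Lemma upper_diag u c k : c != 0 -> simil A u c -> upper u -> u k k != 0.
Proof.
move=> c0 uc uu; have := simil_unit c0 uc; rewrite -unitmx_tr unitmxE det_trig; last first.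
  by apply/is_trig_mxP => i j ij; rewrite mxE uu.
by rewrite (bigD1 k) //= unitfE mulf_eq0 negb_or mxE => /andP[].
Qed.

Hypothesis two_neq0 : 2%:R != 0 :> K.
Hypothesis n_even : ~~ odd n -> (3 <= n./2)%N.

(** The form pairs the column y = m with itself to twice the product of the
    entry in question and nonzero numbers. *)
Lemma upper_mid u c : ~~ odd n -> c != 0 -> simil A u c -> upper u ->
  u (half_pred n_ge3) (rev_ord (half_pred n_ge3)) = 0.
Proof.
move=> en c0 uc uu; set x := half_pred n_ge3; set y := rev_ord x.
have xy : x != y by rewrite half_pred_rev.
have := simil_colsum y y uc.
rewrite A_anti ?mulr0; last by rewrite /y rev_ordK eq_sym.
rewrite (bigD1 x) //= (bigD1 y) 1?eq_sym //= big1 ?addr0 => [|r /andP[rx ry]].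
  rewrite -/y /y rev_ordK -/y anti_rev.
  have -> : u x y * a x * u y y + u y y * a x * u x y = 2%:R * (u x y * a x * u y y) by ring.
  move/eqP; rewrite !mulf_eq0 (negbTE two_neq0) (negbTE (anti_neq0 _)) orbF.
  by rewrite (negbTE (upper_diag _ c0 uc uu)) orbF => /eqP.
have [yr|ry'] := ltnP y r; first by rewrite uu ?mul0r.
rewrite (uu (rev_ord r)) ?mulr0 //.
move: rx ry ry'; rewrite /y -!(inj_eq val_inj) /=; have := ltn_ord r; lia.
Qed.

(** Conjugation moves only the entry at the two middle indices below the
    diagonal, and that entry vanishes by upper_mid. *)
Lemma upper_conj_flip u c : ~~ odd n -> c != 0 -> simil A u c -> upper u ->
  forall g, g \in unitmx -> monomial (mid_flip n_ge3) g -> upper (g *m u *m invmx g).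
Proof.
move=> en c0 uc uu g gu gw k l lk.
have gV : monomial (mid_flip n_ge3) (invmx g).
  by have := monomialV gu gw; rewrite tpermV.
pose w := mid_flip n_ge3; have wK (z : 'I_n) : w (w z) = z by rewrite -permM tperm2 perm1.
rewrite -mulmxA -[k]wK (monomial_mul _ _ _ gw) (monomial_mulr _ _ _ gV) -/w.
suff -> : u (w k) (w l) = 0 by rewrite mul0r mulr0.
have [lt|le] := ltnP (w l) (w k); first exact: uu.
rewrite -(upper_mid en c0 uc uu); congr (u _ _); apply: val_inj => /=;
  move: le; rewrite !(mid_flip_val n_ge3 n_even) //; ifs_lia.
Qed.

End Antidiagonal.

(** * Polynomial paths of similitudes *)

Section Paths.
Variables (K : fieldType) (n : nat).
Implicit Types (B g h x : 'M[K]_n) (G : 'M[{poly K}]_n).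

Local Notation constP := (map_mx (polyC : K -> {poly K})).
Definition at_point (t : K) G : 'M[K]_n := map_mx (horner_eval t) G.

(** The path is defined on the complement of the zeros of the multiplier c in
    the affine line. *)
Definition linked B g h : Prop := exists G (c : {poly K}),
  [/\ simil (constP B) G c, c.[0] != 0 /\ c.[1] != 0, at_point 0 G = g & at_point 1 G = h].

Definition path_component B g h : Prop := clos_refl_sym_trans _ (linked B) g h.

Definition is_simil B g : Prop := exists2 c : K, c != 0 & simil B g c.

Lemma at_point_const t (m1 m2 : nat) (x : 'M[K]_(m1, m2)) :
  map_mx (horner_eval t) (constP x) = x.
Proof. by apply/matrixP => k l; rewrite !mxE /horner_eval hornerC. Qed.

Lemma at_pointM t G H : at_point t (G *m H) = at_point t G *m at_point t H.
Proof. exact: map_mxM. Qed.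

Lemma simil_at B G c t : simil (constP B) G c -> simil B (at_point t G) c.[t].
Proof.
move=> Gc; have := simil_map (horner_eval t) Gc.
by rewrite at_point_const.
Qed.

Lemma is_similM B g h : is_simil B g -> is_simil B h -> is_simil B (g *m h).
Proof. by move=> [c c0 gc] [d d0 hd]; exists (c * d); rewrite ?mulf_neq0 //; apply: similM. Qed.

Lemma is_simil1 B : is_simil B 1%:M.
Proof. by exists 1; rewrite ?oner_neq0 //; apply: simil1. Qed.

Lemma linked_simil B g h : linked B g h -> is_simil B g /\ is_simil B h.
Proof.
move=> [G [c [Gc [c0 c1] <- <-]]].
by split; [exists c.[0] | exists c.[1]] => //; apply: simil_at.
Qed.

Lemma path_component_simil B g h : path_component B g h -> is_simil B g <-> is_simil B h.
Proof.
by elim=> [x y /linked_simil[xs ys]|x|x y _ [xy yx]|x y z _ [xy yx] _ [yz zy]]; split; auto.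
Qed.

Lemma linked_mull B x g h : is_simil B x -> linked B g h -> linked B (x *m g) (x *m h).
Proof.
move=> [d d0 xd] [G [c [Gc [c0 c1] <- <-]]].
exists (constP x *m G), (d%:P * c); split.
- by apply: similM => //; have := simil_map (polyC : {rmorphism K -> {poly K}}) xd.
- by rewrite !hornerM !hornerC !mulf_neq0.
- by rewrite at_pointM /at_point at_point_const.
- by rewrite at_pointM /at_point at_point_const.
Qed.

Lemma path_component_mull B x g h : is_simil B x ->
  path_component B g h -> path_component B (x *m g) (x *m h).
Proof.
move=> xs; elim=> [? ? /(linked_mull xs)|?|? ? _|? ? ? _ + _].
- exact: rst_step.
- exact: rst_refl.
- exact: rst_sym.
- exact: rst_trans.
Qed.

Definition neutral B g := path_component B 1%:M g.

Lemma neutral1 B : neutral B 1%:M.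
Proof. exact: rst_refl. Qed.

Lemma neutral_simil B g : neutral B g -> is_simil B g.
Proof. by move=> /path_component_simil[h _]; apply: h; apply: is_simil1. Qed.

Lemma neutralM B g h : neutral B g -> neutral B h -> neutral B (g *m h).
Proof.
move=> gB hB; have := path_component_mull (neutral_simil gB) hB.
by rewrite mulmx1; apply: rst_trans.
Qed.

Lemma neutralZ B g (d : K) : d != 0 -> neutral B g -> neutral B (d *: g).
Proof.
move=> d0; rewrite -mul_scalar_mx; apply: neutralM; apply: rst_step.
pose l : {poly K} := 1 + 'X * (d - 1)%:P.
have l0 : l.[0] = 1 by rewrite /l !hornerE.
have l1 : l.[1] = d by rewrite /l !hornerE /=; ring.
exists l%:M, (l ^+ 2); split.
- exact: simil_scalar.
- by rewrite !horner_exp l0 l1 !expf_neq0 ?oner_neq0.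
- by apply/matrixP => i j; rewrite !mxE /horner_eval hornerMn l0.
- by apply/matrixP => i j; rewrite !mxE /horner_eval hornerMn l1.
Qed.

Lemma neutral_conj B (E E' : 'M[K]_n) h : E *m E' = 1%:M ->
  neutral (E^T *m B *m E) h -> neutral B (E *m h *m E').
Proof.
move=> EE' hB.
suff : path_component B (E *m 1%:M *m E') (E *m h *m E') by rewrite mulmx1 EE'.
elim: hB => [g g' [G [c [Gc c01 <- <-]]]|?|? ? _|? ? ? _ + _];
  [apply: rst_step|exact: rst_refl|exact: rst_sym|exact: rst_trans].
have EE'P : constP E *m constP E' = 1%:M by rewrite -map_mxM EE' map_mx1.
exists (constP E *m G *m constP E'), c; split => //.
- by apply: simil_conj => //; move: Gc; rewrite !map_mxM -map_trmx.
- by rewrite !at_pointM /at_point !at_point_const.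
- by rewrite !at_pointM /at_point !at_point_const.
Qed.

Lemma refl_mx_mul B v : B^T = B -> refl_mx B v *m refl_mx B v = (bform B v v ^+ 2)%:M.
Proof.
move=> Bs; rewrite /refl_mx; set q := bform B v v.
have vv : (B *m v)^T *m v = q%:M by rewrite [LHS]mx11_scalar /q /bform trmx_mul Bs.
move: (B *m v) vv => V vv.
have -> : (q%:M - 2%:R *: (v *m V^T)) *m (q%:M - 2%:R *: (v *m V^T)) =
   q *: q%:M - (2%:R * q) *: (v *m V^T) - (2%:R * q) *: (v *m V^T)
     + 4%:R *: (v *m (V^T *m v) *m V^T).
  rewrite mulmxBl mul_scalar_mx -scalemxAl mulmxBr mul_mx_scalar -scalemxAr.
  rewrite scalerBr scalerBr !scalerA -!mulmxA opprB addrA.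
  rewrite addrAC; congr (_ - _ + _ *: _); last by ring.
  by rewrite [q * _]mulrC.
rewrite vv mul_mx_scalar -scalemxAl scale_scalar_mx expr2.
by apply/matrixP => i j; rewrite !mxE; ring.
Qed.

Lemma linked_refl B v w : B^T = B -> bform B v v != 0 -> bform B w w != 0 ->
  linked B (refl_mx B w *m refl_mx B w) (refl_mx B v *m refl_mx B w).
Proof.
move=> Bs qv qw.
pose V := constP w + 'X *: constP (v - w).
have V0 : map_mx (horner_eval 0) V = w.
  by apply/matrixP => i j; rewrite !mxE /horner_eval !hornerE.
have V1 : map_mx (horner_eval 1) V = v.
  by apply/matrixP => i j; rewrite !mxE /horner_eval !hornerE /=; ring.
have q t : (bform (constP B) V V).[t] =
    bform B (map_mx (horner_eval t) V) (map_mx (horner_eval t) V).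
  by rewrite -[LHS]/(horner_eval t _) bform_map at_point_const.
have BPs : (constP B)^T = constP B by rewrite map_trmx Bs.
exists (refl_mx (constP B) V *m constP (refl_mx B w)),
  (bform (constP B) V V ^+ 2 * (bform B w w ^+ 2)%:P); split.
- apply: similM; first exact: refl_mx_simil.
  exact: (simil_map (polyC : {rmorphism K -> {poly K}}) (refl_mx_simil w Bs)).
- by split; rewrite hornerM horner_exp hornerC q ?V0 ?V1 mulf_neq0 ?expf_neq0.
- by rewrite at_pointM /at_point refl_mx_map !at_point_const V0.
- by rewrite at_pointM /at_point refl_mx_map !at_point_const V1.
Qed.

(** Moving v to w along a segment joins the product to a scalar matrix. *)
Lemma neutral_refl B v w : B^T = B -> bform B v v != 0 -> bform B w w != 0 ->
  neutral B (refl_mx B v *m refl_mx B w).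
Proof.
move=> Bs qv qw.
have hw : neutral B (refl_mx B w *m refl_mx B w).
  rewrite refl_mx_mul // -scalemx1; apply: neutralZ; rewrite ?expf_neq0 //.
  exact: neutral1.
exact: rst_trans hw (rst_step _ _ _ _ (linked_refl Bs qv qw)).
Qed.

End Paths.

Lemma sum_delta (R : pzRingType) (I : finType) (x : I) (f : I -> R) :
  \sum_r (r == x)%:R * f r = f x.
Proof.
rewrite (bigD1 x) //= big1 ?addr0 ?eqxx ?mul1r // => r /negbTE ->.
by rewrite mul0r.
Qed.

(** * Paths from the identity to monomial and triangular similitudes *)

Section NeutralElements.
Variables (K : fieldType) (n : nat) (A : 'M[K]_n).
Hypothesis A_sym : A^T = A.
Hypothesis A_unit : A \in unitmx.
Hypothesis A_anti : forall k l : 'I_n, l != rev_ord k -> A k l = 0.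
Implicit Types (g h u : 'M[K]_n) (x y k l r : 'I_n) (c : K).
Local Notation a r := (A r (rev_ord r)).
Local Notation constP := (map_mx (polyC : K -> {poly K})).

Lemma constP_anti k l : l != rev_ord k -> constP A k l = 0.
Proof. by move=> kl; rewrite mxE A_anti. Qed.

(** Conjugation of u with a one-parameter group of diagonal matrices
    multiplies the entry (k, l) by t ^ (l - k), and the limit for t = 0 is the
    diagonal of u. *)
Lemma upper_linked u c : c != 0 -> simil A u c -> upper u ->
  exists g, [/\ monomial 1 g, simil A g c & linked A g u].
Proof.
move=> c0 uc uu; pose G := \matrix_(k, l) ((u k l)%:P * 'X^(l - k)) : 'M[{poly K}]_n.
have Gc : simil (constP A) G c%:P.
  apply/matrixP => k l; rewrite (form_entry constP_anti).
  transitivity ((\sum_r u r k * a r * u (rev_ord r) l)%:P * 'X^(k + l - n.-1)).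
    rewrite rmorph_sum mulr_suml; apply: eq_bigr => r _; rewrite !mxE !rmorphM /=.
    have [rk|kr] := leqP r k; last by rewrite (uu r k) // !(mulr0, mul0r, polyC0).
    have [rl|lr] := leqP (rev_ord r) l; last first.
      by rewrite (uu (rev_ord r) l) // !(mulr0, mul0r, polyC0).
    have -> : (k + l - n.-1 = (k - r) + (l - rev_ord r))%N.
      by move: rl => /=; have := ltn_ord r; lia.
    by rewrite exprD; ring.
  rewrite (simil_colsum A_anti k l uc) !mxE rmorphM /=.
  have [->|lk] := eqVneq l (rev_ord k); last first.
    by rewrite A_anti // !(mulr0, mul0r, polyC0).
  have -> : (k + rev_ord k - n.-1 = 0)%N by rewrite /=; have := ltn_ord k; lia.
  by rewrite expr0 mulr1.
exists (at_point 0 G); split.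
- move=> k l; rewrite perm1 => kl; rewrite !mxE /horner_eval !hornerE expr0n.
  have [kl'|lk] := ltnP k l; last first.
    by rewrite uu ?mul0r //; move: kl lk; rewrite -(inj_eq val_inj) /=; lia.
  by rewrite subn_eq0 leqNgt kl' mulr0.
- by have := simil_at 0 Gc; rewrite hornerC.
- exists G, c%:P; split => //; first by rewrite !hornerC.
  by apply/matrixP => k l; rewrite !mxE /horner_eval !hornerE ?expr1n ?mulr1.
Qed.

(** The entries d k satisfy d k * d (rev_ord k) = c. They are joined to 1 by
    the segments l k for k in the lower half, and the opposite entries have to
    be quotients of a segment from 1 to c by l k. Multiplying everything by
    the product P of the l k gives a polynomial path, from 1 to a scalar
    multiple of g. *)
Lemma torus_neutral g c : c != 0 -> simil A g c -> monomial 1 g -> neutral A g.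
Proof.
move=> c0 gc g1; pose d k := g k k.
have dd k : d k * d (rev_ord k) = c.
  have := simil_colsum A_anti k (rev_ord k) gc.
  rewrite (bigD1 k) //= big1 ?addr0 => [|r rk]; last by rewrite g1 ?perm1 ?mul0r.
  rewrite [_ * a k]mulrC -mulrA [RHS]mulrC.
  by apply/mulfI/(anti_neq0 A_unit A_anti).
have d0 k : d k != 0 by apply: contra_neq c0 => dk; rewrite -(dd k) dk mul0r.
pose l k : {poly K} := 1 + 'X * (d k - 1)%:P.
have l0 k : (l k).[0] = 1 by rewrite /l !hornerE.
have l1 k : (l k).[1] = d k by rewrite /l !hornerE /=; ring.
pose lc : {poly K} := 1 + 'X * (c - 1)%:P.
(* Q k is P / l k, and C runs from 1 to c; if there is a middle index k, then
   C has to be the square of l k. *)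
pose P := \prod_(j : 'I_n | (j < rev_ord j)%N) l j.
pose Q k := \prod_(j : 'I_n | (j < rev_ord j)%N && (j != k)) l j.
have PQ k : (k < rev_ord k)%N -> P = l k * Q k by move=> kr; rewrite /P (bigD1 k).
pose C := if [pick k : 'I_n | k == rev_ord k] is Some k then l k ^+ 2 else lc.
have Ck k : k = rev_ord k -> C = l k ^+ 2.
  rewrite /C; case: pickP => [j /eqP jr|/(_ k) /eqP //] kr.
  have -> // : j = k; apply: val_inj; move/(congr1 val): jr; move/(congr1 val): kr => /=.
  by have := ltn_ord j; have := ltn_ord k; lia.
have C0 : C.[0] = 1.
  by rewrite /C; case: pickP => *; rewrite ?horner_exp ?l0 ?expr1n // /lc !hornerE.
have C1 : C.[1] = c.
  rewrite /C; case: pickP => [j /eqP jr|*]; last by rewrite /lc !hornerE /=; ring.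
  by rewrite horner_exp l1 expr2 {2}jr dd.
have P0 : P.[0] = 1 by rewrite /P horner_prod big1.
have Q0 k : (Q k).[0] = 1 by rewrite /Q horner_prod big1.
have P1 : P.[1] != 0 by rewrite /P horner_prod; apply/prodf_neq0 => j _; rewrite l1.
pose D k := if (k <= rev_ord k)%N then l k * P else C * Q (rev_ord k).
have DD k : D k * D (rev_ord k) = C * P ^+ 2.
  rewrite /D rev_ordK; case: (ltngtP k (rev_ord k)) => [kr|kr|/val_inj kr].
  - by rewrite (PQ _ kr); ring.
  - have kr' : (rev_ord k < rev_ord (rev_ord k))%N by rewrite rev_ordK.
    by rewrite (PQ _ kr'); ring.
  - by rewrite -kr (Ck _ kr); ring.
pose G := \matrix_(k, j) (if k == j then D k else 0) : 'M[{poly K}]_n.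
have G1 : monomial 1 G by move=> k j; rewrite perm1 mxE => /negbTE ->.
have Gc : simil (constP A) G (C * P ^+ 2).
  apply: (monomial_simil constP_anti (weyl_hat1 n) G1) => k.
  by rewrite !perm1 !mxE !eqxx -(DD k); ring.
have gP : linked A 1%:M (P.[1] *: g).
  exists G, (C * P ^+ 2); split => //.
  - split; rewrite hornerM horner_exp; last by rewrite C1 mulf_neq0 ?expf_neq0.
    by rewrite C0 P0 expr1n mulr1 oner_neq0.
  - apply/matrixP => k j; rewrite !mxE /horner_eval.
    case: (k == j); last by rewrite horner0.
    by rewrite /D; case: ifP => _; rewrite hornerM ?l0 ?C0 ?P0 ?Q0 mulr1.
  - apply/matrixP => k j; rewrite !mxE /horner_eval.
    have [<-|kj] := eqVneq k j; last by rewrite horner0 g1 ?perm1 ?mulr0.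
    rewrite /D; case: leqP => kr; first by rewrite hornerM l1 mulrC.
    have kr' : (rev_ord k < rev_ord (rev_ord k))%N by rewrite rev_ordK.
    by rewrite hornerM C1 (PQ _ kr') hornerM l1 -(dd k) -/(d k); ring.
have -> : g = P.[1]^-1 *: (P.[1] *: g) by rewrite scalerA mulVf ?scale1r.
by apply: neutralZ; rewrite ?invr_neq0 //; apply: rst_step.
Qed.

Lemma upper_neutral u c : c != 0 -> simil A u c -> upper u -> neutral A u.
Proof.
move=> c0 uc uu; have [g [g1 gc gu]] := upper_linked c0 uc uu.
exact: rst_trans (torus_neutral c0 gc g1) (rst_step _ _ _ _ gu).
Qed.

Hypothesis two_neq0 : 2%:R != 0 :> K.

Lemma refl_mx_orth (v w : 'cV[K]_n) k l : bform A v w = 0 ->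
  (refl_mx A v *m refl_mx A w) k l =
  bform A v v * bform A w w * (k == l)%:R
  - 2%:R * bform A w w * (v k 0 * (a l * v (rev_ord l) 0))
  - 2%:R * bform A v v * (w k 0 * (a l * w (rev_ord l) 0)).
Proof.
move=> vw; rewrite /refl_mx; set q := bform A v v; set q' := bform A w w.
have VW : (A *m v)^T *m w = 0.
  by rewrite [LHS]mx11_scalar trmx_mul A_sym -/(bform A v w) vw raddf0.
have := anti_mul A_anti v l; have := anti_mul A_anti w l.
move: (A *m v) (A *m w) VW => V W VW WE VE.
have -> : (q%:M - 2%:R *: (v *m V^T)) *m (q'%:M - 2%:R *: (w *m W^T)) =
   (q * q')%:M - (2%:R * q) *: (w *m W^T) - (2%:R * q') *: (v *m V^T).
  rewrite mulmxBl !mulmxBr !mul_scalar_mx mul_mx_scalar -!scalemxAl -!scalemxAr.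
  rewrite -mulmxA (mulmxA V^T) VW mul0mx mulmx0 !scaler0 subr0 !scalerA.
  by rewrite scale_scalar_mx ![q * _]mulrC ![q' * _]mulrC.
rewrite !mxE !big_ord1 !mxE VE WE -mulr_natr; ring.
Qed.

(** In the orthogonal group the reflection in a root is the product of two
    reflections in orthogonal anisotropic vectors. These are e_x - e_(rev x)
    and e_y if y is the middle index, and otherwise the sum and the difference
    of e_x - e_y and e_(rev x) / a x - e_(rev y) / a y. *)
Lemma root_swap_neutral x y : x != rev_ord x -> x != y -> y != rev_ord x ->
  exists2 g, neutral A g & monomial (root_swap x y) g.
Proof.
move=> xr xy yxr.
have yrx : rev_ord y != x by apply: contra yxr => /eqP <-; rewrite rev_ordK.
have rxry : rev_ord x != rev_ord y by rewrite (inj_eq rev_ord_inj).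
have a0 := anti_neq0 A_unit A_anti.
have ar := anti_rev A_sym.
have [yr|yr] := eqVneq y (rev_ord y).
  pose v : 'cV[K]_n := \col_r ((r == x)%:R - (r == rev_ord x)%:R).
  pose w : 'cV[K]_n := \col_r (r == y)%:R.
  have vE r : v r 0 = (r == x)%:R - (r == rev_ord x)%:R by rewrite mxE.
  have wE r : w r 0 = (r == y)%:R by rewrite mxE.
  have bw z : bform A w z = a y * z y 0.
    rewrite (bform_anti A_anti) (eq_bigr (fun r => (r == y)%:R * (a r * z (rev_ord r) 0))).
      by rewrite sum_delta -yr.
    by move=> r _; rewrite wE mulrA.
  have bv z : bform A v z = a x * (z (rev_ord x) 0 - z x 0).
    rewrite (bform_anti A_anti) (eq_bigr (fun r => (r == x)%:R * (a r * z (rev_ord r) 0)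
       - (r == rev_ord x)%:R * (a r * z (rev_ord r) 0))).
      by rewrite sumrB !sum_delta rev_ordK ar mulrBr.
    by move=> r _; rewrite vE; ring.
  have vv : bform A v v = - (2%:R * a x).
    by rewrite bv !vE !eqxx [rev_ord x == x]eq_sym (negbTE xr) /=; ring.
  have ww : bform A w w = a y by rewrite bw wE eqxx mulr1.
  have vw : bform A v w = 0.
    by rewrite bv !wE (negbTE xy) [rev_ord x == y]eq_sym (negbTE yxr) subrr mulr0.
  exists (refl_mx A v *m refl_mx A w).
    by apply: neutral_refl; rewrite // ?vv ?ww ?oppr_eq0 ?mulf_neq0.
  move=> k l; rewrite /root_swap {1}yr eqxx => kl.
  rewrite refl_mx_orth // vv ww !vE !wE.
  have revl z : (rev_ord l == z) = (l == rev_ord z).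
    by rewrite -[in RHS](inj_eq rev_ord_inj) rev_ordK.
  rewrite !revl rev_ordK -yr.
  have [lx|lx] := eqVneq l x.
    subst l; move: kl; rewrite tpermL => /negbTE kl.
    rewrite kl ?eqxx (negbTE xr) (negbTE xy) /=; ring.
  have [lx'|lx'] := eqVneq l (rev_ord x).
    subst l; move: kl; rewrite tpermR => /negbTE kl.
    rewrite kl ?eqxx [rev_ord x == y]eq_sym (negbTE yxr) ?rev_ordK ?ar /=; ring.
  have xl : x != l by rewrite eq_sym.
  have rxl : rev_ord x != l by rewrite eq_sym.
  move: kl; rewrite (tpermD xl rxl) => /negbTE kl; rewrite kl.
  have [ly|ly] := eqVneq l y; last by rewrite /=; ring.
  by move: kl; rewrite ly => -> /=; ring.
pose P k : K := (k == x)%:R - (k == y)%:R.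
pose N k : K := (k == rev_ord x)%:R / a x - (k == rev_ord y)%:R / a y.
pose v : 'cV[K]_n := \col_r (P r + N r).
pose w : 'cV[K]_n := \col_r (P r - N r).
have vE r : v r 0 = P r + N r by rewrite mxE.
have wE r : w r 0 = P r - N r by rewrite mxE.
have rP (f : 'I_n -> K) : \sum_r P r * f r = f x - f y.
  by rewrite -(sum_delta x f) -(sum_delta y f) -sumrB; apply: eq_bigr => r _; rewrite mulrBl.
have rN (f : 'I_n -> K) :
    \sum_r N r * f r = f (rev_ord x) / a x - f (rev_ord y) / a y.
  rewrite -(sum_delta (rev_ord x) f) -(sum_delta (rev_ord y) f) !mulr_suml -sumrB.
  by apply: eq_bigr => r _; rewrite /N; ring.
have ryx : (rev_ord y == x) = false by exact: negbTE.
have rxy : (rev_ord x == y) = false by rewrite eq_sym (negbTE yxr).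
have Px : P x = 1 by rewrite /P eqxx (negbTE xy) subr0.
have Py : P y = -1 by rewrite /P eqxx eq_sym (negbTE xy) sub0r.
have Prx : P (rev_ord x) = 0 by rewrite /P eq_sym (negbTE xr) rxy subr0.
have Pry : P (rev_ord y) = 0 by rewrite /P ryx eq_sym (negbTE yr) subr0.
have Nx : N x = 0 by rewrite /N (negbTE xr) eq_sym ryx !mul0r subr0.
have Ny : N y = 0 by rewrite /N (negbTE yr) (negbTE yxr) !mul0r subr0.
have Nrx : N (rev_ord x) = (a x)^-1 by rewrite /N eqxx (negbTE rxry) mul0r subr0 mul1r.
have Nry : N (rev_ord y) = - (a y)^-1.
  by rewrite /N eqxx eq_sym (negbTE rxry) mul0r sub0r mul1r.
have bs (s t : K) : bform A (\col_r (P r + s * N r)) (\col_r (P r + t * N r)) = 2%:R * (s + t).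
  rewrite (bform_anti A_anti).
  rewrite (eq_bigr (fun r => P r * (a r * (P (rev_ord r) + t * N (rev_ord r)))
     + s * (N r * (a r * (P (rev_ord r) + t * N (rev_ord r)))))); last first.
    by move=> r _; rewrite !mxE; ring.
  rewrite big_split /= -mulr_sumr rP rN !rev_ordK !ar Px Py Prx Pry Nx Ny Nrx Nry.
  by field; rewrite !a0.
have vv : bform A v v = 4%:R.
  have -> : v = \col_r (P r + 1 * N r) by apply/colP => r; rewrite !mxE mul1r.
  by rewrite bs; ring.
have wEN : w = \col_r (P r + (-1) * N r) by apply/colP => r; rewrite !mxE mulN1r.
have ww : bform A w w = - 4%:R by rewrite wEN bs; ring.
have vw : bform A v w = 0.
  have -> : v = \col_r (P r + 1 * N r) by apply/colP => r; rewrite !mxE mul1r.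
  by rewrite wEN bs subrr mulr0.
have four : 4%:R != 0 :> K by rewrite (natrM _ 2 2) mulf_neq0.
exists (refl_mx A v *m refl_mx A w).
  by apply: neutral_refl; rewrite // ?vv ?ww ?oppr_eq0.
move=> k l; rewrite /root_swap (negbTE yr) (negbTE yxr) => kl.
rewrite refl_mx_orth // vv ww !vE !wE.
transitivity (16%:R * (a l * (P k * N (rev_ord l) + N k * P (rev_ord l)) - (k == l)%:R)).
  by ring.
suff -> : a l * (P k * N (rev_ord l) + N k * P (rev_ord l)) = (k == l)%:R.
  by rewrite subrr mulr0.
move: kl; rewrite permM.
have [->|lx] := eqVneq l x.
  rewrite tpermL tpermD ?rxy ?[rev_ord y == y]eq_sym // => /negbTE ky.
  rewrite Nrx Prx mulr0 addr0 /P ky subr0; field; exact: a0.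
have [->|ly] := eqVneq l y.
  rewrite tpermR tpermD ?ryx ?[rev_ord x == x]eq_sym // => /negbTE kx.
  rewrite Nry Pry mulr0 addr0 /P kx sub0r; field; exact: a0.
have xl : x != l by rewrite eq_sym.
have yl : y != l by rewrite eq_sym.
rewrite (tpermD xl yl).
have [->|lrx] := eqVneq l (rev_ord x).
  rewrite tpermL rev_ordK Nx Px mulr0 add0r mulr1 ar /N => /negbTE ->.
  by rewrite /=; field; rewrite !a0.
have [->|lry] := eqVneq l (rev_ord y).
  rewrite tpermR rev_ordK Ny Py mulr0 add0r ar /N => /negbTE ->.
  by rewrite /=; field; rewrite !a0.
have rxl : rev_ord x != l by rewrite eq_sym.
have ryl : rev_ord y != l by rewrite eq_sym.
rewrite (tpermD rxl ryl) => /negbTE ->.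
have revl z : (rev_ord l == z) = (l == rev_ord z).
  by rewrite -[in RHS](inj_eq rev_ord_inj) rev_ordK.
rewrite /P /N !revl !rev_ordK (negbTE lx) (negbTE ly) (negbTE lrx) (negbTE lry).
by rewrite /=; ring.
Qed.

End NeutralElements.

(** * Points and specialisations of the group *)

Lemma mmap_morph (F R S : comNzRingType) k (f : F -> R) (h : 'I_k -> R)
    (phi : {rmorphism R -> S}) (p : {mpoly F[k]}) :
  phi (mmap f h p) = mmap (phi \o f) (phi \o h) p.
Proof.
rewrite /mmap rmorph_sum; apply: eq_bigr => m _; rewrite rmorphM /=; congr (_ * _).
by rewrite /mmap1 rmorph_prod; apply: eq_bigr => i _; rewrite rmorphXn.
Qed.

Lemma eq_mmap (F R : comNzRingType) k (f f' : F -> R) (h h' : 'I_k -> R)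
    (p : {mpoly F[k]}) : f =1 f' -> h =1 h' -> mmap f h p = mmap f' h' p.
Proof.
move=> ff hh; rewrite /mmap; apply: eq_bigr => m _; rewrite ff; congr (_ * _).
by apply: eq_bigr => i _; rewrite hh.
Qed.

Section Points.
Variables (F : fieldType) (n : nat) (b : 'M[F]_n).

Lemma eq_GOspace (x y : GOspace b) : pt_ideal x = pt_ideal y -> x = y.
Proof.
case: x y => [I hI] [J hJ] /= E; subst J.
by rewrite (Prop_irrelevance hI hJ).
Qed.

Lemma entry_eval_morph (K L : fieldType) (i : {rmorphism F -> K})
    (j : {rmorphism K -> L}) (g : 'M[K]_n) p :
  j (entry_eval i g p) = entry_eval (j \o i) (map_mx j g) p.
Proof.
rewrite /entry_eval mmap_morph; apply: eq_mmap => // k /=.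
by rewrite -map_mxvec mxE.
Qed.

(** A total version of GOpt, with the point of 1 as default value. *)
Definition gpt (K : fieldType) (i : {rmorphism F -> K}) (g : 'M[K]_n) : GOspace b :=
  if pselect (GO b i g) is left h then GOpt h else GOpt (GO_one b).

Lemma gptE (K : fieldType) (i : {rmorphism F -> K}) (g : 'M[K]_n) (h : GO b i g) :
  gpt i g = GOpt h.
Proof. by rewrite /gpt; case: pselect => // h'; apply: eq_GOspace. Qed.

Lemma gpt_ideal (K : fieldType) (i : {rmorphism F -> K}) (g : 'M[K]_n) :
  GO b i g -> pt_ideal (gpt i g) = eval_ker i g.
Proof. by move=> h; rewrite (gptE h). Qed.

Lemma GOspaceP (x : GOspace b) :
  exists (K : fieldType) (i : {rmorphism F -> K}) (g : 'M[K]_n),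
    GO b i g /\ x = gpt i g.
Proof.
have [K [i [g [gGO xE]]]] := pt_GO x; exists K, i, g; split => //.
by apply: eq_GOspace; rewrite gpt_ideal.
Qed.

Lemma GO_map (K L : fieldType) (i : {rmorphism F -> K}) (j : {rmorphism K -> L})
    (g : 'M[K]_n) : GO b i g -> GO b (j \o i) (map_mx j g).
Proof.
move=> [c c0 gc]; exists (j c); first by rewrite fmorph_eq0.
have := simil_map j gc; rewrite /simil -map_mx_comp //.
Qed.

Lemma gpt1 (K : fieldType) (i : {rmorphism F -> K}) :
  gpt i 1%:M = GOpt (GO_one b).
Proof.
rewrite -(gptE (GO_one b)); apply: eq_GOspace.
have i1 : GO b i 1%:M by exists 1; rewrite ?oner_neq0 //; apply: simil1.
rewrite !gpt_ideal //; last exact: GO_one.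
have E p : entry_eval i 1%:M p = i (entry_eval idfun 1%:M p).
  rewrite /entry_eval mmap_morph; apply: eq_mmap => // k /=.
  by rewrite -[in LHS](map_mx1 i) -map_mxvec mxE.
apply/seteqP; split => p /=; rewrite /eval_ker /= E => /eqP.
  by rewrite fmorph_eq0 => /eqP.
by move=> /eqP ->; rewrite rmorph0.
Qed.

Lemma specialization (x y : GOspace b) :
  pt_ideal x `<=` pt_ideal y -> closure [set x] y.
Proof.
move=> xy B; rewrite nbhsE => -[U [[S UE] Uy] UB].
exists x; split => //; apply: UB; move: Uy; rewrite UE /= => ySn xS; apply: ySn.
by apply: subset_trans xy.
Qed.

Lemma specialization_component (x y : GOspace b) : closure [set x] y ->
  connected_component setT x y.
Proof.
move=> xy; apply: (@connected_component_max _ setT (closure [set x])) => //.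
  exact: subset_closure.
by apply/connected_closure/connected1.
Qed.

Section Specialization.
Variables (K : fieldType) (i : {rmorphism F -> K}).
Local Notation B := (map_mx i b).
Local Notation Kt := {fraction {poly K}}.

Definition generic_field : {rmorphism F -> Kt} :=
  (@tofrac {poly K}) \o ((polyC : {rmorphism K -> {poly K}}) \o i).
Definition generic_mx (G : 'M[{poly K}]_n) : 'M[Kt]_n := map_mx (@tofrac {poly K}) G.

Lemma generic_GO (G : 'M[{poly K}]_n) c : c != 0 ->
  simil (map_mx polyC B) G c -> GO b generic_field (generic_mx G).
Proof.
move=> c0 Gc; exists (tofrac c); first by rewrite tofrac_eq0.
by have := simil_map (@tofrac {poly K} : {rmorphism {poly K} -> Kt}) Gc;
  rewrite /simil -!map_mx_comp.
Qed.

(** A polynomial in the entries that vanishes at the generic point, over the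
    field of rational functions, vanishes at all values of the path. *)
Lemma path_specialization (G : 'M[{poly K}]_n) c t :
  simil (map_mx polyC B) G c -> c.[t] != 0 ->
  closure [set gpt generic_field (generic_mx G)] (gpt i (at_point t G)).
Proof.
move=> Gc ct; have c0 : c != 0 by apply: contra_neq ct => ->; rewrite horner0.
have gGO := generic_GO c0 Gc.
have aGO : GO b i (at_point t G) by exists c.[t] => //; apply: simil_at.
apply: specialization; rewrite !gpt_ideal // => p; rewrite /eval_ker /=.
pose P : {poly K} := mmap (polyC \o i) (fun k => mxvec G ord0 k) p.
have -> : entry_eval generic_field (generic_mx G) p = tofrac P.
  rewrite /P (mmap_morph _ _ (@tofrac {poly K} : {rmorphism {poly K} -> Kt})).
  by apply: eq_mmap => // k /=; rewrite /generic_mx -map_mxvec mxE.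
have -> : entry_eval i (at_point t G) p = P.[t].
  rewrite -[RHS]/(horner_eval t P) /P mmap_morph; apply: eq_mmap => k /=.
    by rewrite /horner_eval hornerC.
  by rewrite /at_point -map_mxvec mxE.
by move=> /eqP; rewrite tofrac_eq0 => /eqP ->; rewrite horner0.
Qed.

Lemma linked_component g h : linked B g h ->
  connected_component setT (gpt i g) (gpt i h).
Proof.
move=> [G [c [Gc [c0 c1] <- <-]]].
apply: (@connected_component_trans _ _ (gpt generic_field (generic_mx G))).
  apply: connected_component_sym; apply: specialization_component.
  exact: path_specialization Gc c0.
by apply: specialization_component; apply: path_specialization Gc c1.
Qed.

Lemma path_component_component g h : path_component B g h ->
  connected_component setT (gpt i g) (gpt i h).
Proof.
elim=> [? ? /linked_component|x|x y _|x y z _ + _] //.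
- exact: connected_component_refl.
- exact: connected_component_sym.
- exact: connected_component_trans.
Qed.

Lemma neutral_GOo g : neutral B g -> GOo b i g.
Proof.
move=> gn; have gGO : GO b i g by exact: neutral_simil.
exists gGO; rewrite -(gpt1 i) -(gptE gGO).
exact: path_component_component.
Qed.

End Specialization.
End Points.

(** * The weights of the cocharacter *)

Section Cocharacter.
Variables (F : fieldType) (n : nat) (b e : 'M[F]_n) (c : 'I_n -> int).
Hypothesis n_ge3 : (3 <= n)%N.
Hypothesis n_even : ~~ odd n -> (3 <= n./2)%N.
Hypothesis b_unit : b \in unitmx.
Hypothesis e_adapted : adapted_basis b e.
Local Notation first := (first n_ge3).

Definition gram : 'M[F]_n := e^T *m b *m e.

Lemma gram_unit : gram \in unitmx.
Proof. by have [eu _] := e_adapted; rewrite !unitmx_mul unitmx_tr eu b_unit. Qed.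

Lemma gram_anti k l : l != rev_ord k -> gram k l = 0.
Proof. by have [_ h] := e_adapted; apply: h. Qed.

Lemma gram_sym : b^T = b -> gram^T = gram.
Proof. by move=> bs; rewrite /gram !trmx_mul trmxK bs mulmxA. Qed.

Section BaseChange.
Variables (K : fieldType) (i : {rmorphism F -> K}).
Local Notation E := (map_mx i e).
Local Notation A := (map_mx i gram).

Definition of_coord (h : 'M[K]_n) : 'M[K]_n := E *m h *m invmx E.

Lemma basis_unit : E \in unitmx.
Proof. by have [eu _] := e_adapted; rewrite map_unitmx. Qed.

Lemma map_gramE : A = E^T *m map_mx i b *m E.
Proof. by rewrite /gram !map_mxM map_trmx. Qed.

Lemma map_gram_unit : A \in unitmx.
Proof. by rewrite map_unitmx gram_unit. Qed.

Lemma map_gram_anti k l : l != rev_ord k -> A k l = 0.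
Proof. by move=> kl; rewrite mxE gram_anti ?rmorph0. Qed.

Lemma map_gram_sym : b^T = b -> A^T = A.
Proof. by move=> bs; rewrite map_trmx gram_sym. Qed.

Lemma of_coordK h : in_basis e i (of_coord h) = h.
Proof. by rewrite /in_basis /of_coord !mulmxA mulVmx ?basis_unit // mul1mx mulmxKV ?basis_unit. Qed.

Lemma in_basisK g : of_coord (in_basis e i g) = g.
Proof. by rewrite /in_basis /of_coord !mulmxA mulmxV ?basis_unit // mul1mx mulmxK ?basis_unit. Qed.

Lemma of_coordM g h : of_coord (g *m h) = of_coord g *m of_coord h.
Proof.
by rewrite /of_coord -!mulmxA (mulmxA (invmx E) E) mulVmx ?basis_unit // mul1mx.
Qed.

Lemma of_coord1 : of_coord 1%:M = 1%:M.
Proof. by rewrite /of_coord mulmx1 mulmxV ?basis_unit. Qed.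

Lemma GO_of_coord h : GO b i (of_coord h) <-> is_simil A h.
Proof.
split=> -[d d0 hd]; exists d => //; last first.
  by apply: simil_conj; rewrite ?mulmxV ?basis_unit // -map_gramE.
rewrite -[h]of_coordK /in_basis; apply: simil_conj; first by rewrite mulVmx ?basis_unit.
rewrite map_gramE !mulmxA -trmx_mul mulmxV ?basis_unit // trmx1 mul1mx.
by rewrite -mulmxA mulmxV ?basis_unit // mulmx1.
Qed.

Lemma GO_in_basis g : GO b i g -> is_simil A (in_basis e i g).
Proof. by rewrite -{1}[g]in_basisK => /GO_of_coord. Qed.

Lemma neutral_of_coord h : neutral A h -> neutral (map_mx i b) (of_coord h).
Proof. by rewrite map_gramE; apply: neutral_conj; rewrite mulmxV ?basis_unit. Qed.

(** The form pairs the weight spaces of k and rev_ord k, on which t acts by t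
    ^ (c k + c (rev_ord k)); this has to be the multiplier. *)
Lemma cochar_coord (t : K) : t != 0 -> GO b i (cochar e c i t) ->
  exists d, forall k, t ^ (c k + c (rev_ord k)) = d.
Proof.
move=> t0; rewrite -[cochar _ _ _ _]/(of_coord _) => /GO_of_coord[d _ hd]; exists d => k.
have := simil_colsum map_gram_anti k (rev_ord k) hd.
rewrite (bigD1 k) //= big1 ?addr0 => [|r rk]; last by rewrite !mxE (negbTE rk) mulr0n !mul0r.
have := anti_neq0 map_gram_unit map_gram_anti k.
move: (A k (rev_ord k)) => a a0.
rewrite !mxE !eqxx !mulr1n mulrAC -expfzDr // => E.
exact: mulIf a0 _ _ E.
Qed.

End BaseChange.

Lemma exprz_fracX_inj (x y : int) :
  (tofrac ('X : {poly F})) ^ x = tofrac 'X ^ y -> x = y.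
Proof.
have X0 : tofrac ('X : {poly F}) != 0 by rewrite tofrac_eq0 polyX_eq0.
have pos (m : nat) : tofrac ('X : {poly F}) ^+ m = 1 -> m = 0%N.
  rewrite -rmorphXn -(rmorph1 (@tofrac {poly F})) => /eqP.
  rewrite tofrac_eq => /eqP /(congr1 (fun p : {poly F} => size p)).
  by rewrite size_polyXn size_poly1 => -[].
move=> xy; apply/eqP; rewrite -subr_eq0; apply/eqP.
have : tofrac ('X : {poly F}) ^ (x - y) = 1.
  by rewrite expfzDr // xy -expfzDr // subrr expr0z.
case: (x - y) => m; first by rewrite -exprnP => /pos ->.
rewrite NegzE -exprnN => /(congr1 GRing.inv); rewrite invrK invr1 => /pos //.
Qed.

(** The exponents are compared at t = X over the field F(X), where X has
    infinite order. *)
Lemma cochar_pairing : is_cochar b e c ->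
  forall k l, c k + c (rev_ord k) = c l + c (rev_ord l).
Proof.
move=> mu; pose i : {rmorphism F -> {fraction {poly F}}} :=
  (@tofrac {poly F}) \o (polyC : {rmorphism F -> {poly F}}).
have X0 : tofrac ('X : {poly F}) != 0 by rewrite tofrac_eq0 polyX_eq0.
have [d E] := cochar_coord X0 (mu _ i (tofrac 'X) X0).
by move=> k l; apply: exprz_fracX_inj; rewrite !E.
Qed.

(** Since c k + c (rev_ord k) is constant, the indices z of weight 0 and t of
    weight 2 are opposite. If t were not the first index, then the simple root
    that ends at t or starts at z would violate dominance. *)
Lemma cocharE : is_cochar b e c -> dominant c ->
  #|[set k | c k == 0]%SET| = 1%N -> #|[set k | c k == 1]%SET| = (n - 2)%N ->
  #|[set k | c k == 2]%SET| = 1%N ->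
  forall k, c k = (if k == first then 2 else if k == rev_ord first then 0 else 1).
Proof.
have one (d : int) : #|[set k | c k == d]%SET| = 1%N ->
    exists z : 'I_n, forall k : 'I_n, (c k == d) = (k == z).
  move=> /eqP/cards1P[z zE]; exists z => k.
  by have := finset.in_set1 k z; rewrite -zE inE.
move=> mu dom /one[z cz] h1 /one[t ct].
have czz : c z = 0 by apply/eqP; rewrite cz.
have ctt : c t = 2 by apply/eqP; rewrite ct.
have zt : z != t by rewrite -ct czz.
have c1 (k : 'I_n) : k != z -> k != t -> c k = 1.
  have sub : [set k | c k == 1]%SET \subset (~: [set z; t])%SET.
    apply/fintype.subsetP => l; rewrite !inE => /eqP cl; apply/norP; split.
      by rewrite -cz cl.
    by rewrite -ct cl.
  have E : [set k | c k == 1]%SET = (~: [set z; t])%SET.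
    by apply/eqP; rewrite eqEcard sub /= h1 cardsCs finset.setCK cards2 zt card_ord.
  move=> kz kt; have : k \in (~: [set z; t])%SET by rewrite !inE negb_or kz.
  by rewrite -E inE => /eqP.
have pair := cochar_pairing mu.
have zr : rev_ord z = t.
  have p1 := pair z t; have p2 := pair z first.
  have [//|rzt] := eqVneq (rev_ord z) t.
  have [zz|rzz] := eqVneq (rev_ord z) z.
    have rt : rev_ord t != t.
      apply/eqP => tt; move/(congr1 val): tt; move/(congr1 val): zz => /= zz tt.
      case/eqP: zt; apply: val_inj => /=; have := ltn_ord z; have := ltn_ord t; lia.
    move: p1; rewrite zz czz ctt (c1 (rev_ord t)) // -zz (inj_eq rev_ord_inj) eq_sym //.
  move: p1; rewrite czz ctt (c1 (rev_ord z)) // add0r.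
  have [->|rtz] := eqVneq (rev_ord t) z; first by rewrite czz.
  have [->|rtt] := eqVneq (rev_ord t) t; first by rewrite ctt.
  by rewrite c1.
have root j := simple_root_val n_ge3 n_even j.
have dom' k l : (exists j : 'I_n./2, (simple_root j).1 = k /\ (simple_root j).2 = l) -> c l <= c k.
  by move=> [j [<- <-]]; have := dom j; rewrite /root_pairing Num.Theory.subr_ge0.
have t0 : t = first.
  apply/eqP; apply: contraT => t0; exfalso.
  have tn := ltn_ord t; have zv : z = (n - t.+1)%N :> nat.
    by rewrite -[z]rev_ordK zr.
  have t0' : (0 < t)%N by rewrite lt0n; move: t0; rewrite -(inj_eq val_inj).
  have ne := odd_or_half_ge3 n_even.
  have neq2 k : k != t -> ~ (2 <= c k).
    move=> kt; have [->|kz] := eqVneq k z; first by rewrite czz.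
    by rewrite c1.
  have neq0 k : k != z -> ~ (c k <= 0).
    move=> kz; have [->|kt] := eqVneq k t; first by rewrite ctt.
    by rewrite c1.
  have [tm|tm] := ltnP t n./2.
    have jm : (t.-1 < n./2)%N by lia.
    have [aE bE] := root (Ordinal jm).
    have kn : (t.-1 < n)%N by lia.
    have /dom' : exists j : 'I_n./2, (simple_root j).1 = Ordinal kn /\ (simple_root j).2 = t.
      exists (Ordinal jm); split; apply: val_inj; rewrite /= ?aE ?bE /= ?ifT //; lia.
    rewrite ctt; apply: neq2; rewrite -(inj_eq val_inj) /=; lia.
  have tmid : (z : nat) != t by rewrite (inj_eq val_inj).
  have jm : (z < n./2)%N by lia.
  have [aE bE] := root (Ordinal jm).
  case: (boolP ((z.+1 < n./2)%N || odd n)) => hz.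
    have kn : (z.+1 < n)%N by lia.
    have /dom' : exists j : 'I_n./2, (simple_root j).1 = z /\ (simple_root j).2 = Ordinal kn.
      by exists (Ordinal jm); split; apply: val_inj; rewrite /= ?aE ?bE /= ?hz.
    rewrite czz; apply: neq0; rewrite -(inj_eq val_inj) /=; lia.
  have kn : (z.-1 < n)%N by lia.
  have /dom' : exists j : 'I_n./2, (simple_root j).1 = Ordinal kn /\ (simple_root j).2 = t.
    exists (Ordinal jm); split; apply: val_inj; rewrite /= ?aE ?bE /= ?(negbTE hz) //; lia.
  rewrite ctt; apply: neq2; rewrite -(inj_eq val_inj) /=; lia.
move=> k; rewrite -t0 -zr rev_ordK zr.
have [->|kt] := eqVneq k t; first exact: ctt.
have [->|kz] := eqVneq k z; first exact: czz.
exact: c1.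
Qed.

End Cocharacter.

Section TypeOfCocharacter.
Variables (n : nat) (c : 'I_n -> int).
Hypothesis n_ge3 : (3 <= n)%N.
Hypothesis n_even : ~~ odd n -> (3 <= n./2)%N.
Local Notation first := (first n_ge3).

Lemma typeJE :
  (forall k, c k = (if k == first then 2 else if k == rev_ord first then 0 else 1)) ->
  typeJ c = stab_refl n.
Proof.
move=> cE.
have E (j : 'I_n./2) : (root_pairing c j == 0) = (j != 0%N :> nat).
  have [aE bE] := simple_root_val n_ge3 n_even j; have jm := ltn_ord j.
  have ne := odd_or_half_ge3 n_even.
  rewrite /root_pairing !cE -!(inj_eq val_inj) /= aE bE.
  have [j0|j0] := eqVneq (j : nat) 0%N.
    have nn : (0 == n - 1)%N = false by lia.
    have -> : ((j.+1 < n./2)%N || odd n) by lia.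
    by rewrite j0 eqxx /= ifF //; lia.
  have -> : ((if (j.+1 < n./2)%N || odd n then j : nat else j.-1) == 0%N) = false.
    by case: ifP => ?; lia.
  have -> : ((if (j.+1 < n./2)%N || odd n then j : nat else j.-1) == (n - 1)%N) = false.
    by case: ifP => ?; lia.
  by rewrite ifF //; lia.
apply/setP => s; apply/imsetP/imsetP => -[j]; rewrite inE => hj ->; exists j => //;
  by move: hj; rewrite inE E.
Qed.

Lemma typeKE :
  (forall k, c k = (if k == first then 2 else if k == rev_ord first then 0 else 1)) ->
  typeK c = stab_refl n.
Proof. by move=> /typeJE cJ; rewrite /typeK cJ longest_stab_refl. Qed.

End TypeOfCocharacter.

(** * The parabolic subgroup *)

Section Parabolic.
Variables (F : fieldType) (n : nat) (b e : 'M[F]_n).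
Hypothesis n_ge3 : (3 <= n)%N.
Hypothesis n_even : ~~ odd n -> (3 <= n./2)%N.
Hypothesis two_neq0 : 2%:R != 0 :> F.
Hypothesis b_sym : b^T = b.
Hypothesis b_unit : b \in unitmx.
Hypothesis e_adapted : adapted_basis b e.
Local Notation first := (first n_ge3).
Local Notation flip := (mid_flip n_ge3).
Local Notation J := (stab_refl n).

Lemma map_of_coord (K L : fieldType) (i : {rmorphism F -> K}) (j : {rmorphism K -> L})
    (h : 'M[K]_n) :
  map_mx j (of_coord e i h) = of_coord e (j \o i) (map_mx j h).
Proof. by rewrite /of_coord !map_mxM map_invmx -!map_mx_comp. Qed.

Lemma map_upper (K L : fieldType) (j : {rmorphism K -> L}) (h : 'M[K]_n) :
  upper h -> upper (map_mx j h).
Proof. by move=> hu k l lk; rewrite mxE hu ?rmorph0. Qed.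

Lemma map_monomial (K L : fieldType) (j : {rmorphism K -> L}) w (h : 'M[K]_n) :
  monomial w h -> monomial w (map_mx j h).
Proof. by move=> hw k l kl; rewrite mxE hw ?rmorph0. Qed.

Lemma map_is_simil (K L : fieldType) (i : {rmorphism F -> K}) (j : {rmorphism K -> L})
    (h : 'M[K]_n) :
  is_simil (map_mx i (gram b e)) h -> is_simil (map_mx (j \o i) (gram b e)) (map_mx j h).
Proof.
move=> [d d0 hd]; exists (j d); first by rewrite fmorph_eq0.
by have := simil_map j hd; rewrite -map_mx_comp.
Qed.

Definition fixes_line (K : fieldType) (h : 'M[K]_n) :=
  forall r, r != first -> h r first = 0.

Section OverExtension.
Variables (K : fieldType) (i : {rmorphism F -> K}).
Local Notation A := (map_mx i (gram b e)).
Local Notation oc := (of_coord e i).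
Implicit Types (g h u : 'M[K]_n).

Let A_sym : A^T = A := map_gram_sym e i b_sym.
Let A_unit : A \in unitmx := map_gram_unit b_unit e_adapted i.
Let A_anti : forall k l : 'I_n, l != rev_ord k -> A k l = 0 := map_gram_anti e_adapted i.

Let ocK := of_coordK e_adapted i.
Let ibK := in_basisK e_adapted i.
Let ocM := of_coordM e_adapted i.
Let oc1 := of_coord1 e_adapted i.
Let GO_oc := GO_of_coord e_adapted i.

Lemma two_neq0_ext : 2%:R != 0 :> K.
Proof. by rewrite -(rmorph_nat i) fmorph_eq0. Qed.
Let K2 := two_neq0_ext.

Lemma is_simil_unit h : is_simil A h -> h \in unitmx.
Proof. by move=> [d d0 hd]; exact: simil_unit A_unit _ _ d0 hd. Qed.

Lemma is_similV h : is_simil A h -> is_simil A (invmx h).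
Proof. by move=> [d d0 hd]; exists d^-1; rewrite ?invr_neq0 //; exact: similV. Qed.

Lemma of_coordV h : is_simil A h -> oc (invmx h) = invmx (oc h).
Proof.
move=> hs; have hu := is_simil_unit hs.
have hV : oc h *m oc (invmx h) = 1%:M by rewrite -ocM // mulmxV // oc1.
have [ou _] := mulmx1_unit hV.
by rewrite -[LHS](mulKmx ou) hV mulmx1.
Qed.

Lemma par_incl g :
  borel b e i g \/ (exists2 s, s \in J & weyl_rep b e s i g) -> parabolic b e J i g.
Proof. by move=> h X [_ sub]; apply: sub. Qed.

Lemma par_group : subgroup_mx (parabolic b e J i).
Proof.
split=> [X [[X1 _ _] _] //|g h gP hP X XG|g gP X XG].
  by have [[_ XM _] _] := XG; apply: XM; [apply: gP|apply: hP].
by have [[_ _ XV] _] := XG; apply: XV; apply: gP.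
Qed.

Lemma par_ind (X : set 'M[K]_n) : subgroup_mx X ->
  (forall u, upper u -> is_simil A u -> X (oc u)) ->
  (forall s u, s \in J -> monomial s u -> is_simil A u -> X (oc u)) ->
  parabolic b e J i `<=` X.
Proof.
move=> Xg Xu Xw; apply: smallest_sub => // g [[[gGO _] gu]|[s sJ [[gGO _] gw]]].
  by rewrite -(ibK g); apply: Xu => //; apply: GO_in_basis.
by rewrite -(ibK g); apply: (Xw s) => //; apply: GO_in_basis.
Qed.

Lemma upper_GOo u : upper u -> is_simil A u -> GOo b i (oc u).
Proof.
move=> uu [d d0 ud]; apply: neutral_GOo; apply: (neutral_of_coord e_adapted).
exact: upper_neutral d0 ud uu.
Qed.

Lemma upper_par u : upper u -> is_simil A u -> parabolic b e J i (oc u).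
Proof.
move=> uu us; apply: par_incl; left; split; first exact: upper_GOo.
by move=> k l lk; rewrite ocK // uu.
Qed.

Lemma refl_neutral (j : 'I_n./2) : exists2 g, neutral A g & monomial (simple_refl j) g.
Proof.
rewrite (simple_reflE n_ge3 n_even).
have [ab ar rP] := simple_rootP n_ge3 n_even j.
apply: root_swap_neutral => //; rewrite -(inj_eq val_inj) /=; lia.
Qed.

Lemma weyl_neutral w : w \in weyl n -> exists2 g, neutral A g & monomial w g.
Proof.
move=> ww; have [t [-> _ _]] := weyl_word n_ge3 n_even ww.
elim: t => [|j t [g gn gw]].
  rewrite big_nil; exists 1%:M; first exact: neutral1.
  by move=> k l; rewrite perm1 mxE => /negbTE ->.
have [h hn hw] := refl_neutral j.
by exists (g *m h); [exact: neutralM|rewrite big_cons; apply: monomialM].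
Qed.

Lemma monomial_quot w g h : is_simil A g -> is_simil A h -> monomial w g -> monomial w h ->
  exists t, [/\ upper t, is_simil A t & h = g *m t].
Proof.
move=> gs hs gw hw; have gu := is_simil_unit gs.
exists (invmx g *m h); split; last by rewrite mulKVmx.
  apply: monomial1P; rewrite -(mulgV w).
  by apply: monomialM => //; apply: monomialV.
by apply: is_similM => //; apply: is_similV.
Qed.

(** Only one representative of s is known to lie in the identity component,
    namely the one of weyl_neutral; the quotient of any other one by it is a
    diagonal similitude. *)
Lemma refl_par s h : s \in J -> monomial s h -> is_simil A h -> parabolic b e J i (oc h).
Proof.
move=> sJ hs hd; have sw : s \in weyl n.
  by case/imsetP: sJ => j _ ->; apply: simple_refl_weyl.
have [g gn gw] := weyl_neutral sw.
have [t [tu td ->]] := monomial_quot (neutral_simil gn) hd gw hs.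
have [_ parM _] := par_group; rewrite ocM //; apply: parM; last exact: upper_par.
apply: par_incl; right; exists s => //; split.
  by apply: neutral_GOo; apply: (neutral_of_coord e_adapted).
by move=> k l kl; rewrite ocK // gw.
Qed.

Lemma fixes_lineM g h : fixes_line g -> fixes_line h -> fixes_line (g *m h).
Proof.
move=> gl hl r r1; rewrite mxE (bigD1 first) //= big1 ?addr0 ?gl ?mul0r // => j j1.
by rewrite hl ?mulr0.
Qed.

Lemma fixes_lineV g : g \in unitmx -> fixes_line g -> fixes_line (invmx g).
Proof.
move=> gu gl r r1.
have := congr1 (fun M : 'M_n => M r first) (mulVmx gu).
rewrite mxE (bigD1 first) //= big1 ?addr0 => [|j j1]; last by rewrite gl ?mulr0.
rewrite mxE (negbTE r1) => /eqP; rewrite mulf_eq0 => /orP[/eqP //|].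
by rewrite (negbTE (unit_col gu gl)).
Qed.

Lemma monomial_fixes_line w h : fixes_first n_ge3 w -> monomial w h -> fixes_line h.
Proof. by move=> /eqP wf hw r r1; rewrite hw // wf. Qed.

Lemma upper_fixes_line u : upper u -> fixes_line u.
Proof. by move=> uu r; rewrite -(inj_eq val_inj) /= => r0; rewrite uu //= lt0n. Qed.

Lemma stab_refl_fix s : s \in J -> fixes_first n_ge3 s.
Proof. by case/imsetP => j; rewrite inE => j0 ->; apply: simple_refl_fix. Qed.

Lemma par_fixes_line g : parabolic b e J i g -> fixes_line (in_basis e i g).
Proof.
move=> gP; suff [] : GO b i g /\ fixes_line (in_basis e i g) by [].
move: g gP; apply: par_ind.
- split=> [|g h [gGO gl] [hGO hl]|g [gGO gl]] /=.
  + split; first exact: is_simil1.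
    rewrite -(oc1) ocK //.
    by move=> r; rewrite mxE => /negbTE ->.
  + split; first exact: is_similM gGO hGO.
    rewrite -(ibK g) -(ibK h) -ocM //.
    by rewrite ocK //; apply: fixes_lineM.
  + have gs := GO_in_basis e_adapted gGO.
    rewrite -(ibK g) -of_coordV //; split.
      by apply/GO_oc => //; apply: is_similV.
    by rewrite ocK //; apply: fixes_lineV => //; apply: is_simil_unit.
- move=> u uu us; split; first exact/GO_oc.
  by rewrite ocK //; apply: upper_fixes_line.
- move=> s u sJ su us; split; first exact/GO_oc.
  by rewrite ocK //; apply: monomial_fixes_line su; apply: stab_refl_fix.
Qed.

Lemma invmx_conj g x : g \in unitmx ->
  invmx (g *m x *m invmx g) = g *m invmx x *m invmx g.
Proof.
move=> gu; have [xu|xu] := boolP (x \in unitmx); last first.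
  have nu : g *m x *m invmx g \notin unitmx by rewrite !unitmx_mul gu unitmx_inv gu andbT.
  by rewrite !/invmx (negbTE xu) (negbTE nu).
have E : g *m x *m invmx g *m (g *m invmx x *m invmx g) = 1%:M.
  by rewrite -!mulmxA (mulKmx gu) (mulKVmx xu) mulmxV.
have [ou _] := mulmx1_unit E.
by rewrite -[RHS](mulKmx ou) E mulmx1.
Qed.

Lemma mulmx_conj g x y : g \in unitmx ->
  g *m (x *m y) *m invmx g = (g *m x *m invmx g) *m (g *m y *m invmx g).
Proof. by move=> gu; rewrite -!mulmxA (mulKmx gu). Qed.

(** The exchange of the two middle basis vectors preserves both kinds of
    generators of the parabolic subgroup. *)
Lemma par_conj_flip g h : ~~ odd n -> is_simil A h -> monomial flip h ->
  parabolic b e J i g -> parabolic b e J i (oc h *m g *m invmx (oc h)).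
Proof.
move=> en hs hw; have hu := is_simil_unit hs.
have [par1 parM parV] := par_group.
have ou : oc h \in unitmx by rewrite !unitmx_mul hu unitmx_inv (basis_unit e_adapted).
have conj u : oc h *m oc u *m invmx (oc h) = oc (h *m u *m invmx h).
  by rewrite -of_coordV // !ocM.
apply: (par_ind (X := [set g | parabolic b e J i (oc h *m g *m invmx (oc h))])).
- split=> [|x y xP yP|x xP] /=.
  + by rewrite mulmx1 mulmxV.
  + by rewrite mulmx_conj //; apply: parM.
  + by rewrite -invmx_conj //; apply: parV.
- move=> u uu [d d0 ud] /=; rewrite conj; apply: upper_par.
    exact: (upper_conj_flip A_sym A_unit A_anti K2 n_even en d0 ud uu hu hw).
  by apply: is_similM; [apply: is_similM => //; exists d|apply: is_similV].
- move=> s u sJ su us /=; rewrite conj.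
  apply: (@refl_par (flip * s * flip)%g); first exact: stab_refl_flip.
    have fV : (flip^-1 = flip)%g by rewrite tpermV.
    rewrite -mulgA -{1}fV; apply: monomialM; last exact: monomialV.
    exact: monomialM.
  by apply: is_similM; [apply: is_similM|apply: is_similV].
Qed.

End OverExtension.
End Parabolic.

(** * The extended parabolic subgroup *)

Section ParabolicHat.
Variables (F : fieldType) (n : nat) (b e : 'M[F]_n) (c : 'I_n -> int).
Hypothesis n_ge3 : (3 <= n)%N.
Hypothesis n_even : ~~ odd n -> (3 <= n./2)%N.
Hypothesis two_neq0 : 2%:R != 0 :> F.
Hypothesis b_sym : b^T = b.
Hypothesis b_unit : b \in unitmx.
Hypothesis e_adapted : adapted_basis b e.
Local Notation first := (first n_ge3).
Local Notation flip := (mid_flip n_ge3).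
Local Notation J := (stab_refl n).
Hypothesis cE : forall k, c k = (if k == first then 2 else if k == rev_ord first then 0 else 1).

Section OverExtension.
Variables (K : fieldType) (i : {rmorphism F -> K}).
Local Notation A := (map_mx i (gram b e)).
Local Notation oc := (of_coord e i).
Implicit Types (g h u : 'M[K]_n).

Let GO_oc := GO_of_coord e_adapted i.

Lemma of_coord_unit h : is_simil A h -> oc h \in unitmx.
Proof.
move=> /(is_simil_unit b_unit e_adapted) hu.
by rewrite !unitmx_mul hu unitmx_inv (basis_unit e_adapted).
Qed.

Lemma conj_mulmxK (L : fieldType) (g x : 'M[L]_n) : g \in unitmx ->
  invmx g *m (g *m x *m invmx g) *m g = x.
Proof. by move=> gu; rewrite !mulmxA mulVmx // mul1mx mulmxKV. Qed.

Lemma conj_par (L : fieldType) (k : {rmorphism F -> L}) (g x : 'M[L]_n) :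
  g \in unitmx -> parabolic b e J k g ->
  parabolic b e J k (g *m x *m invmx g) <-> parabolic b e J k x.
Proof.
move=> gu gP; have [_ parM parV] := par_group b e k; split=> xP; last first.
  exact: parM (parM _ _ gP xP) (parV _ gP).
rewrite -(conj_mulmxK x gu).
exact: parM (parM _ _ (parV _ gP) xP) gP.
Qed.

Lemma norm_of_par h : is_simil A h ->
  (forall (L : fieldType) (j : {rmorphism K -> L}),
     parabolic b e J (j \o i) (of_coord e (j \o i) (map_mx j h))) ->
  norm_parabolic b e J i (oc h).
Proof.
move=> hs hP; split; first exact/GO_oc.
move=> L j x; rewrite map_of_coord; apply: conj_par => //.
have := map_is_simil j hs; move=> /(is_simil_unit b_unit e_adapted) hu.
by rewrite !unitmx_mul hu unitmx_inv (basis_unit e_adapted).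
Qed.

Lemma norm_upper u : upper u -> is_simil A u -> norm_parabolic b e J i (oc u).
Proof.
move=> uu us; apply: norm_of_par => // L j.
by apply: upper_par => //; [apply: map_upper|apply: map_is_simil].
Qed.

Lemma norm_refl s h : s \in J -> monomial s h -> is_simil A h ->
  norm_parabolic b e J i (oc h).
Proof.
move=> sJ sh hs; apply: norm_of_par => // L j.
by apply: refl_par sJ _ _ => //; [apply: map_monomial|apply: map_is_simil].
Qed.

Lemma norm_flip h : ~~ odd n -> monomial flip h -> is_simil A h ->
  norm_parabolic b e J i (oc h).
Proof.
move=> en hw hs; split; first exact/GO_oc.
move=> L j x; rewrite map_of_coord.
have hs' := map_is_simil j hs.
have hw' := map_monomial j hw.
have hu' := is_simil_unit b_unit e_adapted hs'.
have ou : of_coord e (j \o i) (map_mx j h) \in unitmx.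
  by rewrite !unitmx_mul hu' unitmx_inv (basis_unit e_adapted).
split=> xP; last exact: par_conj_flip.
have wV : monomial flip (invmx (map_mx j h)).
  by have := monomialV hu' hw'; rewrite tpermV.
have := par_conj_flip n_even two_neq0 b_sym b_unit e_adapted en
  (is_similV b_unit e_adapted hs') wV xP.
by rewrite (of_coordV b_unit e_adapted) // invmxK conj_mulmxK.
Qed.

Lemma cent_monomial w h : fixes_first n_ge3 w -> w \in weyl_hat n -> monomial w h ->
  is_simil A h -> cent_cochar b e c i (oc h).
Proof.
move=> /eqP wf /weyl_hatP wr hw hs; split; first exact/GO_oc.
move=> L j t t0; rewrite map_of_coord -[cochar _ _ _ _]/(of_coord e (j \o i) _).
rewrite -!(of_coordM e_adapted); congr of_coord.
apply/matrixP => k l; rewrite mul_mx_diag mul_diag_mx !mxE mulrC.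
have [->|kl] := eqVneq k (w l); last by rewrite hw // rmorph0 !mulr0.
have cw : c (w l) = c l; last by rewrite cw.
have wl : w (rev_ord first) = rev_ord first by rewrite wr wf.
have e1 : (w l == first) = (l == first) by rewrite -{1}wf (inj_eq perm_inj).
have e2 : (w l == rev_ord first) = (l == rev_ord first) by rewrite -{1}wl (inj_eq perm_inj).
by rewrite !cE e1 e2.
Qed.

End OverExtension.

(** Upper triangular similitudes lie in the identity component. *)
Lemma in_Theta_upper (K : fieldType) (i : {rmorphism F -> K}) (u : 'M[K]_n) :
  upper u -> is_simil (map_mx i (gram b e)) u -> in_Theta b e c i (of_coord e i u).
Proof.
move=> uu us; split; first exact/(GO_of_coord e_adapted).
exists K, (idfun : {rmorphism K -> K}), 1%:M; split; last first.
  rewrite invmx1 mulmx1 map_mx_id //.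
  exact: (@upper_GOo F n b e b_unit e_adapted K (idfun \o i) u uu us).
split; first exact: is_simil1.
by move=> L j t t0; rewrite map_mx1 mul1mx mulmx1.
Qed.

(** A monomial similitude that fixes e_0 preserves the weights of the
    cocharacter, hence centralises it. *)
Lemma in_Theta_monomial (K : fieldType) (i : {rmorphism F -> K}) w (h : 'M[K]_n) :
  fixes_first n_ge3 w -> w \in weyl_hat n -> monomial w h ->
  is_simil (map_mx i (gram b e)) h -> in_Theta b e c i (of_coord e i h).
Proof.
move=> wf wh hw hs; split; first exact/(GO_of_coord e_adapted).
exists K, (idfun : {rmorphism K -> K}), (of_coord e i h); split; last first.
  rewrite map_mx_id // mulmxV ?(of_coord_unit hs) //.
  by apply: (@neutral_GOo F n b K (idfun \o i)); apply: neutral1.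
exact: (@cent_monomial K (idfun \o i) w h wf wh hw hs).
Qed.

Section ParabolicHatElements.
Variables (K : fieldType) (i : {rmorphism F -> K}).
Local Notation A := (map_mx i (gram b e)).
Local Notation oc := (of_coord e i).
Implicit Types (g h u : 'M[K]_n).
Let A_sym : A^T = A := map_gram_sym e i b_sym.
Let A_unit : A \in unitmx := map_gram_unit b_unit e_adapted i.
Let A_anti : forall k l : 'I_n, l != rev_ord k -> A k l = 0 := map_gram_anti e_adapted i.
Let ocK := of_coordK e_adapted i.
Let ibK := in_basisK e_adapted i.
Let ocM := of_coordM e_adapted i.

Lemma hat_upper u : upper u -> is_simil A u -> parabolic_hat b e c J i (oc u).
Proof. by move=> uu us; split; [apply: norm_upper|apply: in_Theta_upper]. Qed.

Lemma hat_refl s h : s \in J -> monomial s h -> is_simil A h ->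
  parabolic_hat b e c J i (oc h).
Proof.
move=> sJ sh hs; split; first exact: norm_refl sJ sh hs.
apply: in_Theta_monomial sh hs; first exact: stab_refl_fix.
by case/imsetP: sJ => j _ ->; apply: simple_refl_hat.
Qed.

Lemma hat_flip h : ~~ odd n -> monomial flip h -> is_simil A h ->
  parabolic_hat b e c J i (oc h).
Proof.
move=> en hw hs; split; first exact: norm_flip.
by apply: in_Theta_monomial hw hs; [apply: mid_flip_fix|apply: mid_flip_hat].
Qed.

(** The Eichler transformations for x = e_0 and y = e_l are upper triangular.
    Comparing coefficients in their eigenvalue equations for v yields v (n -
    1) = 0, and then v (rev_ord l) = 0 for each l other than 0 and n - 1. *)
Lemma par_eigenvector (v : 'cV[K]_n) :
  (forall u, upper u -> is_simil A u -> exists d, u *m v = d *: v) ->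
  forall r, r != first -> v r 0 = 0.
Proof.
move=> vP; pose last := rev_ord first.
have [a aE] : exists a : 'I_n -> K, forall l, A l (rev_ord l) = a l.
  by exists (fun l => A l (rev_ord l)).
have a0 l : a l != 0 by rewrite -aE anti_neq0.
pose x : 'cV[K]_n := delta_mx first 0.
have K2 : 2%:R != 0 :> K by exact: (two_neq0_ext two_neq0 i).
have xb z : bform A x z = a first * z last 0.
  rewrite (bform_anti A_anti) (bigD1 first) //= big1 ?addr0 => [|r r1].
    by rewrite aE mxE !eqxx mul1r.
  by rewrite mxE (negbTE r1) !mul0r.
have fl : first != last by rewrite -(inj_eq val_inj) /=; lia.
have main l : l != first -> l != last -> exists d q,
    v + (- (a first * v last 0) *: delta_mx l 0 + q *: x)
      + a l * v (rev_ord l) 0 *: x = d *: v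
    /\ (v last 0 = 0 -> q = 0).
  move=> l1 ll; pose y : 'cV[K]_n := delta_mx l 0.
  have yb z : bform A y z = a l * z (rev_ord l) 0.
    rewrite (bform_anti A_anti) (bigD1 l) //= big1 ?addr0 => [|r r1].
      by rewrite aE mxE !eqxx mul1r.
    by rewrite mxE (negbTE r1) !mul0r.
  pose q := bform A y y / 2%:R.
  have es : simil A (eichler A x y q) 1.
    apply: eichler_simil => //.
    - by rewrite xb !mxE eq_sym (negbTE fl) mulr0.
    - by rewrite xb !mxE eq_sym (negbTE ll) mulr0.
    - by rewrite -mulr2n -mulr_natr /q divfK.
  have [||d] := vP (eichler A x y q).
  - move=> k r rk; rewrite eichlerE.
    have k1 : k != first by rewrite -(inj_eq val_inj) /= -lt0n (leq_ltn_trans _ rk).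
    have kr : k != r by rewrite -(inj_eq val_inj) /= gtn_eqF.
    rewrite (anti_mul A_anti x) !mxE (negbTE k1) (negbTE kr) !mul0r mulr0.
    have [E|r'] := eqVneq (rev_ord r) first; last by rewrite !mulr0 !subr0 addr0.
    exfalso; move/(congr1 val): E => /=; have := ltn_ord k; lia.
  - by exists 1; rewrite ?oner_neq0.
  rewrite eichler_mul // xb yb => E; exists d, (- (q * (a first * v last 0))); split.
    by rewrite -E !scaleNr addrA [RHS]addrAC.
  by move=> ->; rewrite !mulr0 oppr0.
(* The entry n - 1 of the equation shows that the eigenvalue is 1 if
   v (n - 1) != 0, and then its entry 1 is a contradiction. *)
have v_last : v last 0 = 0.
  have [l1 ll] : second n_ge3 != first /\ second n_ge3 != last.
    by rewrite -!(inj_eq val_inj) /=; split; lia.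
  have [d [q [E _]]] := main _ l1 ll.
  apply/eqP; apply: contraT => vl.
  have := congr1 (fun z : 'cV_n => z last 0) E.
  rewrite !mxE [last == _]eq_sym (negbTE ll) [last == _]eq_sym (negbTE fl) !mulr0 !addr0.
  rewrite -{1}[v last 0]mul1r => /(mulIf vl) d1.
  have := congr1 (fun z : 'cV_n => z (second n_ge3) 0) E.
  rewrite !mxE (negbTE l1) eqxx !mulr0 !addr0 mulr1 -d1 mul1r => /eqP.
  by rewrite addrC -subr_eq0 addrK oppr_eq0 mulf_eq0 (negbTE (a0 _)) (negbTE vl).
move=> r r1; have [->//|rl] := eqVneq r last.
have [l1 ll] : rev_ord r != first /\ rev_ord r != last.
  split; last by rewrite (inj_eq rev_ord_inj).
  by apply: contra rl => /eqP E; rewrite -[r]rev_ordK E.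
have [d [q [E /(_ v_last) q0]]] := main _ l1 ll.
(* Now the transformation adds to v a multiple of e_0 only. *)
move: E; rewrite q0 v_last mulr0 oppr0 !scale0r !addr0 rev_ordK => E.
apply/eqP; apply: contraT => vr.
have := congr1 (fun z : 'cV_n => z r 0) E.
rewrite !mxE (negbTE r1) mulr0 addr0 -{1}[v r 0]mul1r => /(mulIf vr) d1.
have := congr1 (fun z : 'cV_n => z first 0) E.
rewrite !mxE !eqxx mulr1 -d1 mul1r => /eqP.
by rewrite addrC -subr_eq0 addrK mulf_eq0 (negbTE vr) orbF (negbTE (a0 _)).
Qed.

(** For upper triangular u the conjugate of u by g fixes the line of e_0, so
    that g^-1 e_0 is an eigenvector of u. *)
Lemma norm_fixes_line g : norm_parabolic b e J i g -> fixes_line n_ge3 (in_basis e i g).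
Proof.
move=> [gGO gP]; have gs := GO_in_basis e_adapted gGO.
have [h hE'] : exists h, in_basis e i g = h by exists (in_basis e i g).
have hE : g = oc h by rewrite -hE' ibK.
rewrite hE' in gs *; have hu := is_simil_unit b_unit e_adapted gs.
suff hV : fixes_line n_ge3 (invmx h).
  by rewrite -[h]invmxK; apply: fixes_lineV hV; rewrite unitmx_inv.
move=> r r1; have -> : invmx h r first = col first (invmx h) r 0 by rewrite mxE.
apply: par_eigenvector r1 => u uu us.
have uP := @upper_par F n b e b_unit e_adapted K (idfun \o i) u uu us.
have := (gP K (idfun : {rmorphism K -> K}) (oc u)).2 uP.
rewrite map_mx_id // => /(par_fixes_line (n_ge3 := n_ge3) n_even b_unit e_adapted).
have -> : g *m oc u *m invmx g = oc (h *m u *m invmx h).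
  by rewrite hE -(of_coordV b_unit e_adapted gs) -!ocM.
rewrite -[in_basis _ _ _]/(in_basis e i _) ocK => fl.
exists ((h *m u *m invmx h) first first).
have E : h *m u *m invmx h *m delta_mx first 0 =
    (h *m u *m invmx h) first first *: delta_mx first (0 : 'I_1).
  have dE k : delta_mx first (0 : 'I_1) k 0 = (k == first)%:R :> K by rewrite mxE andbT.
  rewrite -colE; apply/colP => k; rewrite mxE [RHS]mxE dE.
  by have [->|/fl ->] := eqVneq k first; rewrite ?mulr1 ?mulr0.
by rewrite !colE scalemxAr -E -!mulmxA (mulKmx hu).
Qed.

End ParabolicHatElements.

End ParabolicHat.

(** * Double cosets of similitudes *)

Section DoubleCosetClasses.
Variables (F : fieldType) (n : nat) (b e : 'M[F]_n) (c : 'I_n -> int).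
Hypothesis n_ge3 : (3 <= n)%N.
Hypothesis n_even : ~~ odd n -> (3 <= n./2)%N.
Hypothesis two_neq0 : 2%:R != 0 :> F.
Hypothesis b_sym : b^T = b.
Hypothesis b_unit : b \in unitmx.
Hypothesis e_adapted : adapted_basis b e.
Local Notation first := (first n_ge3).
Local Notation last := (rev_ord first).
Local Notation flip := (mid_flip n_ge3).
Local Notation J := (stab_refl n).
Hypothesis cE : forall k, c k = (if k == first then 2 else if k == last then 0 else 1).

Definition same_class (x y : GOspace b) : Prop :=
  clos_refl_sym_trans _ (same_dcoset e c (typeJ c) (typeK c)) x y.

Definition coord_pt (K : fieldType) (i : {rmorphism F -> K}) (h : 'M[K]_n) : GOspace b :=
  gpt b i (of_coord e i h).

Section OverExtension.
Variables (K : fieldType) (i : {rmorphism F -> K}).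
Local Notation A := (map_mx i (gram b e)).
Local Notation oc := (of_coord e i).
Local Notation pnt := (coord_pt i).
Implicit Types (g h u x : 'M[K]_n).
Let A_sym : A^T = A := map_gram_sym e i b_sym.
Let A_unit : A \in unitmx := map_gram_unit b_unit e_adapted i.
Let A_anti : forall k l : 'I_n, l != rev_ord k -> A k l = 0 := map_gram_anti e_adapted i.
Let ocM := of_coordM e_adapted i.
Let oc1 := of_coord1 e_adapted i.
Let GO_oc := GO_of_coord e_adapted i.
Let simV h (hs : is_simil A h) := is_similV b_unit e_adapted hs.
Let simU h (hs : is_simil A h) := is_simil_unit b_unit e_adapted hs.

Lemma upper1 : upper (1%:M : 'M[K]_n).
Proof. by move=> k l lk; rewrite mxE -(inj_eq val_inj) /= gtn_eqF. Qed.

Lemma hat1 : parabolic_hat b e c J i 1%:M.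
Proof.
by rewrite -oc1; apply: hat_upper => //; [apply: upper1|apply: is_simil1].
Qed.

Lemma same_class_hat p q x : is_simil A x -> is_simil A p -> is_simil A q ->
  parabolic_hat b e c J i (oc p) -> parabolic_hat b e c J i (oc q) ->
  same_class (pnt x) (pnt (p *m x *m q)).
Proof.
move=> xs ps qs ph qh; apply: rst_step; rewrite /same_dcoset.
rewrite (typeJE n_even cE) (typeKE n_even cE).
have xGO : GO b i (oc x) by apply/GO_oc.
have yGO : GO b i (oc p *m oc x *m oc q).
  by rewrite -!ocM; apply/GO_oc; apply: is_similM => //; apply: is_similM.
exists K, i, (oc x), (oc p), (oc q), xGO, yGO; split => //.
  exact: gptE.
by rewrite /coord_pt !ocM; apply: gptE.
Qed.

Definition absorbed g : Prop := is_simil A g /\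
  (forall x, is_simil A x -> same_class (pnt (g *m x)) (pnt x)) /\
  (forall x, is_simil A x -> same_class (pnt (x *m g)) (pnt x)).

Lemma absorbed_hat g : is_simil A g -> parabolic_hat b e c J i (oc g) -> absorbed g.
Proof.
move=> gs gh; have h1 := hat1; have s1 := is_simil1 A; rewrite -oc1 in h1.
split=> //; split=> x xs; apply: rst_sym.
  by have := same_class_hat xs gs s1 gh h1; rewrite mulmx1.
by have := same_class_hat xs s1 gs h1 gh; rewrite mul1mx.
Qed.

Lemma absorbedM g h : absorbed g -> absorbed h -> absorbed (g *m h).
Proof.
move=> [gs [gl gr]] [hs [hl hr]]; split; first exact: is_similM.
split=> x xs.
  rewrite -mulmxA; apply: rst_trans (hl x xs); apply: gl; exact: is_similM.
rewrite mulmxA; apply: rst_trans (gr x xs); apply: hr; exact: is_similM.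
Qed.

Lemma absorbed_upper u : upper u -> is_simil A u -> absorbed u.
Proof. by move=> uu us; apply: absorbed_hat => //; apply: hat_upper. Qed.

Definition absorbed_perm w := forall h, monomial w h -> is_simil A h -> absorbed h.

Lemma absorbed_permM v w : v \in weyl_hat n ->
  absorbed_perm v -> absorbed_perm w -> absorbed_perm (v * w)%g.
Proof.
move=> vh va wa h hvw hs.
have gs : is_simil A (wmx A v).
  by exists 1; rewrite ?oner_neq0 //; apply: wmx_simil.
have gm := @wmx_monomial K n A v.
have -> : h = (h *m invmx (wmx A v)) *m wmx A v by rewrite mulmxKV ?simU.
apply: absorbedM; last exact: va.
apply: wa; last by apply: is_similM => //; apply: simV.
rewrite -(mulKg v w); apply: monomialM => //; apply: monomialV => //; exact: simU.
Qed.

(** A reduced word of an element fixing 0 involves reflections in J only; for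
    even n the exchange of the two middle indices accounts for the elements
    outside W. *)
Lemma absorbed_stab w : w \in weyl_hat n -> fixes_first n_ge3 w -> absorbed_perm w.
Proof.
have base v : v \in <<J>>%g -> absorbed_perm v.
  rewrite (mem_gen_stab n_ge3 n_even) => /andP[vw vf].
  have [t [vE _ /(_ vf)]] := weyl_word n_ge3 n_even vw; rewrite {}vE {vw vf}.
  elim: t => [_|j t IH /= /andP[j0 /IH {}IH]].
    by rewrite big_nil => h h1 hs; apply: absorbed_upper => //; apply: monomial1P.
  rewrite big_cons; apply: absorbed_permM => //; first by apply: simple_refl_hat.
  move=> h hj hs; apply: absorbed_hat => //.
  apply: (hat_refl n_even two_neq0 b_sym b_unit e_adapted cE _ hj hs).
  by apply/imsetP; exists j; rewrite ?inE.
move=> wh wf; case: (boolP (w \in weyl n)) => ww.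
  by apply: base; rewrite (mem_gen_stab n_ge3 n_even) ww.
have en : ~~ odd n by move: ww; rewrite weylE wh /=; case: (odd n).
have -> : w = (flip * (flip * w))%g by rewrite mulgA tperm2 mul1g.
apply: absorbed_permM; first exact: mid_flip_hat.
  by move=> h hj hs; apply: absorbed_hat => //; apply: hat_flip.
apply: base; rewrite (mem_gen_stab n_ge3 n_even) (weyl_mid_flip n_ge3 n_even) //=.
by apply: fixes_firstM => //; apply: mid_flip_fix.
Qed.

(** By elimination. The induction changes h from the left, for which x has to
    vary: x * h is (x * u^-1) * (u * h). *)
Lemma absorbed_line h : is_simil A h -> fixes_line n_ge3 h ->
  forall x, is_simil A x -> same_class (pnt (x *m h)) (pnt x).
Proof.
move=> [d d0 hd] hl; move: h d d0 hd hl.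
have cancel u h x : absorbed u -> is_simil A h -> is_simil A x ->
    (forall y, is_simil A y -> same_class (pnt (y *m (u *m h))) (pnt y)) ->
    same_class (pnt (x *m h)) (pnt x).
  move=> [us [_ ur]] hs xs uh; have uV := simV us.
  have yx : is_simil A (x *m invmx u) by apply: is_similM.
  have := uh _ yx; rewrite mulmxA mulmxKV ?simU // => E.
  apply: rst_trans E _; apply: rst_sym.
  by have := ur _ yx; rewrite mulmxKV ?simU.
apply: (stab_ind A_sym A_unit A_anti) =>
  [u d d0 uu ud x xs|u h d d0 hd uu us uh x xs|w h d wh wf d0 hd uh x xs].
- have [_ [_ ur]] := absorbed_upper uu (ex_intro2 _ _ d d0 ud); exact: ur.
- apply: (cancel u) => //; last by exists d.
  by apply: absorbed_upper => //; exists 1; rewrite ?oner_neq0.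
- apply: (cancel (wmx A w)) => //; last by exists d.
  apply: (absorbed_stab wh wf); first exact: wmx_monomial.
  by exists 1; rewrite ?oner_neq0 //; apply: wmx_simil.
Qed.

Lemma same_class_column h r : is_simil A h -> r \in weyl_hat n ->
  (forall k, k != r first -> h k first = 0) ->
  same_class (pnt h) (pnt (wmx A r)).
Proof.
move=> hs rh hr.
have rs : is_simil A (wmx A r) by exists 1; rewrite ?oner_neq0 //; apply: wmx_simil.
have rm := @wmx_monomial K n A r.
have -> : h = wmx A r *m (invmx (wmx A r) *m h) by rewrite mulKVmx ?simU.
apply: absorbed_line => //; first by apply: is_similM => //; apply: simV.
move=> k k1; have rV := monomialV (simU rs) rm.
rewrite -[k](permK r) (monomial_mul _ _ _ rV) hr ?mulr0 //.
by rewrite (inj_eq perm_inj).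
Qed.

(** After clearing column 0, h e_0 is a multiple of some e_p with e_p
    isotropic. If p is neither 0 nor n - 1, then a monomial isometry fixing
    e_0 moves e_p to e_1. *)
Lemma same_class_cases h (i1 : 'I_n./2) : i1 = 0%N :> nat -> is_simil A h ->
  [\/ same_class (pnt h) (pnt (wmx A 1%g)),
      n != 3%N /\ same_class (pnt h) (pnt (wmx A (simple_refl i1)))
    | same_class (pnt h) (pnt (wmx A (longest_rep n_ge3)))].
Proof.
move=> i10 hs; have [d d0 hd] := hs.
have f0 : (first < last)%N by rewrite /=; lia.
have [|u [p [uu us _ pp [_ up]]]] := clear_column A_sym A_unit A_anti d0 hd f0.
  by move=> l r; rewrite ltn0.
have us' : is_simil A u by exists 1; rewrite ?oner_neq0.
have [_ [ul _]] := absorbed_upper uu us'.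
have uhs : is_simil A (u *m h) by apply: is_similM.
have hu : same_class (pnt h) (pnt (u *m h)) by apply: rst_sym; apply: ul.
have [p1|p1] := eqVneq p first.
  apply: Or31; apply: rst_trans hu _; apply: same_class_column => //.
    exact: weyl_hat1.
  by move=> k; rewrite perm1 => k1; apply: up; rewrite p1.
have [pl|pl] := eqVneq p last.
  apply: Or33; apply: rst_trans hu _; apply: same_class_column => //.
    by apply: weyl_sub_hat; apply: longest_rep_weyl.
  by move=> k; rewrite (longest_rep_first n_ge3 n_even) => k1; apply: up; rewrite pl.
have n3 : n != 3%N.
  apply/eqP => n3; move: pp p1 pl; rewrite -!(inj_eq val_inj) /=.
  by have := ltn_ord p; lia.
apply: Or32; split => //; apply: rst_trans hu _.
have pp' : p != rev_ord p by [].
set w := root_swap p (second n_ge3).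
have wp : w p = second n_ge3.
  apply: val_inj; rewrite /= root_swapE // /root_swap_val /=.
  by move: pp' p1 pl; rewrite -!(inj_eq val_inj) /=; have := ltn_ord p; ifs_lia.
have wf : fixes_first n_ge3 w.
  rewrite /fixes_first -(inj_eq val_inj) /= root_swapE // /root_swap_val /=.
  by move: pp' p1 pl; rewrite -!(inj_eq val_inj) /=; have := ltn_ord p; ifs_lia.
have wh : w \in weyl_hat n by apply: root_swap_hat.
have ws : is_simil A (wmx A w) by exists 1; rewrite ?oner_neq0 //; apply: wmx_simil.
have [_ [wl _]] := absorbed_stab wh wf (@wmx_monomial K n A w) ws.
apply: rst_trans (rst_sym _ _ _ _ (wl _ uhs)) _.
apply: same_class_column; first exact: is_similM.
  by apply: simple_refl_hat.
move=> k; rewrite (simple_refl_first n_ge3 n_even) // (negbTE n3) -wp -[k](permKV w) => kp.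
rewrite (monomial_mul _ _ _ (@wmx_monomial K n A w)) up ?mulr0 //.
by apply: contra kp => /eqP ->.
Qed.

Lemma same_class_monomial r g h : r \in weyl_hat n -> is_simil A g -> is_simil A h ->
  monomial r g -> monomial r h -> same_class (pnt g) (pnt h).
Proof.
move=> rh gs hs gr hr.
have [t [tu ts ->]] := monomial_quot b_unit e_adapted hs gs hr gr.
have [_ [_ ur]] := absorbed_upper tu ts; exact: ur.
Qed.

End OverExtension.
End DoubleCosetClasses.

(** * Relative position of two isotropic lines *)

Section Classification.
Variables (F : fieldType) (n : nat) (b e : 'M[F]_n) (c : 'I_n -> int).
Hypothesis n_ge3 : (3 <= n)%N.
Hypothesis n_even : ~~ odd n -> (3 <= n./2)%N.
Hypothesis two_neq0 : 2%:R != 0 :> F.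
Hypothesis b_sym : b^T = b.
Hypothesis b_unit : b \in unitmx.
Hypothesis e_adapted : adapted_basis b e.
Local Notation first := (first n_ge3).
Local Notation last := (rev_ord first).
Hypothesis cE : forall k, c k = (if k == first then 2 else if k == last then 0 else 1).
Local Notation same_class := (@same_class F n b e c).
Local Notation cpt := (coord_pt b e).

Lemma map_wmx (K : fieldType) (i : {rmorphism F -> K}) w :
  map_mx i (wmx (gram b e) w) = wmx (map_mx i (gram b e)) w.
Proof.
apply/matrixP => k l; rewrite !mxE.
by do 2 (case: ifP => _; rewrite ?rmorph0 ?rmorph1 //); rewrite fmorph_div.
Qed.

Lemma gpt_base (K : fieldType) (i : {rmorphism F -> K}) (g : 'M[F]_n) :
  GO b idfun g -> gpt b i (map_mx i g) = gpt b idfun g.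
Proof.
move=> gGO; have iGO : GO b i (map_mx i g) by exact: (GO_map i gGO).
apply: eq_GOspace; rewrite !gpt_ideal //.
have E p : entry_eval i (map_mx i g) p = i (entry_eval idfun g p).
  by rewrite entry_eval_morph.
apply/seteqP; split => p; rewrite /eval_ker /= E => /eqP.
  by rewrite fmorph_eq0 => /eqP.
by move=> /eqP ->; rewrite rmorph0.
Qed.

Definition weyl_pt (w : 'S_n) : GOspace b := cpt idfun (wmx (gram b e) w).

Lemma wmx_is_simil (K : fieldType) (i : {rmorphism F -> K}) w : w \in weyl_hat n ->
  is_simil (map_mx i (gram b e)) (wmx (map_mx i (gram b e)) w).
Proof.
move=> wh; exists 1; rewrite ?oner_neq0 //; apply: wmx_simil => //.
- exact: map_gram_sym.
- exact: map_gram_unit.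
- exact: map_gram_anti.
Qed.

Lemma weyl_pt_ext (K : fieldType) (i : {rmorphism F -> K}) w : w \in weyl_hat n ->
  cpt i (wmx (map_mx i (gram b e)) w) = weyl_pt w.
Proof.
move=> wh; rewrite /weyl_pt /coord_pt -map_wmx -(gpt_base i); last first.
  apply/(GO_of_coord e_adapted); rewrite -[X in is_simil _ X](map_mx_id (f := idfun)) // map_wmx.
  exact: wmx_is_simil.
congr gpt; rewrite /of_coord !map_mxM map_invmx; congr (_ *m _ *m invmx _); by rewrite map_mx_id.
Qed.

Lemma monomial_class (K : fieldType) (i : {rmorphism F -> K}) w h : w \in weyl_hat n ->
  is_simil (map_mx i (gram b e)) h -> monomial w h ->
  same_class (cpt i h) (weyl_pt w).
Proof.
move=> wh hs hw; rewrite -(weyl_pt_ext i wh); have ws := wmx_is_simil i wh.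
exact: same_class_monomial wh hs ws hw (@wmx_monomial _ _ _ w).
Qed.

Lemma class_cases (x : GOspace b) (i1 : 'I_n./2) : i1 = 0%N :> nat ->
  [\/ same_class x (weyl_pt 1%g),
      n != 3%N /\ same_class x (weyl_pt (simple_refl i1))
    | same_class x (weyl_pt (longest_rep n_ge3))].
Proof.
move=> i10; have [K [i [g [gGO ->]]]] := GOspaceP x.
have gs := GO_in_basis e_adapted gGO.
rewrite -(in_basisK e_adapted i g).
have lw := longest_rep_weyl n_ge3 n_even.
have := same_class_cases n_even two_neq0 b_sym b_unit e_adapted cE i10 gs.
by rewrite !weyl_pt_ext ?weyl_hat1 ?weyl_sub_hat ?simple_refl_weyl.
Qed.

(** In the basis e, the first column of g has entries linear in those of g, so
    that the position of its line can be read off from the prime ideal of a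
    point. *)
Definition column_poly (r : 'I_n) : {mpoly F[n * n]} :=
  \sum_k \sum_l (invmx e r k * e l first) *: 'X_(mxvec_index k l).

Lemma entry_eval_column (K : fieldType) (i : {rmorphism F -> K}) (g : 'M[K]_n) r :
  entry_eval i g (column_poly r) = in_basis e i g r first.
Proof.
rewrite /entry_eval /column_poly raddf_sum /in_basis -mulmxA mxE.
apply: eq_bigr => k _; rewrite raddf_sum mxE mulr_sumr; apply: eq_bigr => l _.
rewrite /= mmapZ mmapX mmap1U mxvecE -map_invmx !mxE rmorphM /=; ring.
Qed.

Definition fixed_pt (x : GOspace b) := forall r, r != first -> pt_ideal x (column_poly r).
(** Up to a scalar, the last coordinate is the pairing with e_0. *)
Definition orthogonal_pt (x : GOspace b) := pt_ideal x (column_poly last).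

Lemma fixed_ptE (K : fieldType) (i : {rmorphism F -> K}) (h : 'M[K]_n) :
  is_simil (map_mx i (gram b e)) h -> fixed_pt (cpt i h) <-> fixes_line n_ge3 h.
Proof.
move=> /(GO_of_coord e_adapted) hGO; rewrite /fixed_pt gpt_ideal //.
by split=> H r r1; have := H r r1; rewrite /eval_ker /= entry_eval_column (of_coordK e_adapted).
Qed.

Lemma orthogonal_ptE (K : fieldType) (i : {rmorphism F -> K}) (h : 'M[K]_n) :
  is_simil (map_mx i (gram b e)) h -> orthogonal_pt (cpt i h) <-> h last first = 0.
Proof.
move=> /(GO_of_coord e_adapted) hGO; rewrite /orthogonal_pt gpt_ideal //.
by rewrite /eval_ker /= entry_eval_column (of_coordK e_adapted).
Qed.

(** Similitudes fixing the line of e_0 fix its orthogonal complement: the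
    entry (n - 1, 0) of a product P G Q is that of G up to nonzero factors. *)
Lemma same_class_type x y : same_class x y ->
  (fixed_pt x <-> fixed_pt y) /\ (orthogonal_pt x <-> orthogonal_pt y).
Proof.
elim=> {x y} [x y|x|x y _ [-> ->]|x y z _ [-> ->] _ [-> ->]] //.
move=> [L [i [g [p [q [gGO [pqGO [ph qh -> ->]]]]]]]].
move: ph qh; rewrite (typeJE n_even cE) (typeKE n_even cE) => -[ph _] [qh _].
have pl : fixes_line n_ge3 (in_basis e i p).
  exact: (norm_fixes_line n_even two_neq0 b_sym b_unit e_adapted ph).
have ql : fixes_line n_ge3 (in_basis e i q).
  exact: (norm_fixes_line n_even two_neq0 b_sym b_unit e_adapted qh).
have [pGO _] := ph; have [qGO _] := qh.
move: pl ql (GO_in_basis e_adapted gGO) (GO_in_basis e_adapted pGO) (GO_in_basis e_adapted qGO).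
have gE := in_basisK e_adapted i g; have pE := in_basisK e_adapted i p.
have qE := in_basisK e_adapted i q.
move: (in_basis e i g) (in_basis e i p) (in_basis e i q) gE pE qE => G P Q gE pE qE.
move=> pl ql gs ps qs.
have -> : GOpt gGO = cpt i G by rewrite /coord_pt gE (gptE gGO).
have -> : GOpt pqGO = cpt i (P *m G *m Q).
  by rewrite /coord_pt !(of_coordM e_adapted) gE pE qE (gptE pqGO).
have pqs : is_simil (map_mx i (gram b e)) (P *m G *m Q).
  by apply: is_similM => //; apply: is_similM.
have pu := is_simil_unit b_unit e_adapted ps; have qu := is_simil_unit b_unit e_adapted qs.
have qf := unit_col qu ql.
rewrite !fixed_ptE // !orthogonal_ptE //; split.
  split=> [gl|pql]; first by apply: fixes_lineM => //; apply: fixes_lineM.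
  have -> : G = invmx P *m (P *m G *m Q) *m invmx Q.
    by rewrite -(mulmxA P) !mulmxA mulVmx // mul1mx mulmxK.
  apply: fixes_lineM; last exact: fixes_lineV.
  by apply: fixes_lineM => //; apply: fixes_lineV.
have -> : (P *m G *m Q) last first = P last last * G last first * Q first first.
  rewrite mxE (bigD1 first) //= big1 ?addr0 => [|k k1]; last by rewrite ql ?mulr0.
  congr (_ * _); rewrite mxE (bigD1 last) //= big1 ?addr0 // => k kl.
  have [d d0 pd] := ps.
  have := diag_row_rev (map_gram_unit b_unit e_adapted i) (map_gram_anti e_adapted i)
    (k := 1%N) (l := first) k d0 pd.
  rewrite kl => /(_ _ isT) H; rewrite (eqP (H _)) ?mul0r // => l r l1 rl.
  have l0 : l = first by apply: val_inj => /=; lia.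
  by move: rl; rewrite l0; apply: pl.
have P0 : P last last != 0.
  have [d d0 pd] := ps.
  have := diag_row_rev (map_gram_unit b_unit e_adapted i) (map_gram_anti e_adapted i)
    (k := 1%N) (l := first) last d0 pd.
  rewrite eqxx => /(_ _ isT) -> // => l r l1 rl.
  have l0 : l = first by apply: val_inj => /=; lia.
  by move: rl; rewrite l0; apply: pl.
split=> [->|/eqP]; first by rewrite mulr0 mul0r.
by rewrite !mulf_eq0 (negbTE P0) (negbTE qf) orbF => /eqP.
Qed.

End Classification.

(** * A family of products of two reflections *)

Section Degenerations.
Variables (R : comNzRingType) (n : nat) (A : 'M[R]_n).
Hypothesis n_ge3 : (3 <= n)%N.
Hypothesis A_sym : A^T = A.
Hypothesis A_anti : forall k l : 'I_n, l != rev_ord k -> A k l = 0.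
Local Notation first := (first n_ge3).
Local Notation last := (rev_ord first).
Implicit Types (v y z : 'cV[R]_n) (k : 'I_n).

Definition unit_vec k : 'cV[R]_n := delta_mx k 0.

Lemma bform_unit z k : bform A z (unit_vec k) = z (rev_ord k) 0 * A (rev_ord k) k.
Proof.
rewrite (bform_anti A_anti) (bigD1 (rev_ord k)) //= big1 => [|l lk].
  by rewrite addr0 mxE rev_ordK !eqxx mulr1.
by rewrite mxE (can2_eq rev_ordK rev_ordK) (negbTE lk) mulr0.
Qed.

Lemma bformDr x y z : bform A x (y + z) = bform A x y + bform A x z.
Proof. by rewrite /bform mulmxDr mxE. Qed.

Lemma bformZr a x y : bform A x (a *: y) = a * bform A x y.
Proof. by rewrite /bform -scalemxAr mxE. Qed.

Lemma bformC x y : bform A x y = bform A y x.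
Proof.
rewrite /bform; have -> : y^T *m A *m x = (x^T *m A *m y)^T.
  by rewrite !trmx_mul trmxK A_sym mulmxA.
by rewrite [RHS]mxE.
Qed.

Lemma refl_mx_mulv v z :
  refl_mx A v *m z = bform A v v *: z - (2%:R * bform A v z) *: v.
Proof.
rewrite /refl_mx mulmxBl mul_scalar_mx -scalemxAl -mulmxA.
have -> : (A *m v)^T *m z = (bform A v z)%:M.
  by rewrite [LHS]mx11_scalar /bform trmx_mul A_sym.
by rewrite mul_mx_scalar scalerA.
Qed.

Definition mirror_vec y := unit_vec first + unit_vec last + y.

(** This is a scalar matrix for y = 0. *)
Definition degeneration y : 'M[R]_n := refl_mx A (mirror_vec y) *m refl_mx A (mirror_vec 0).

Section Column.
Variable y : 'cV[R]_n.
Hypothesis yf : y first 0 = 0.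
Hypothesis yl : y last 0 = 0.

Let lf : (last == first) = false.
Proof. by rewrite -(inj_eq val_inj) /=; lia. Qed.

Let a_rev : A last first = A first last.
Proof. by rewrite -{1}A_sym mxE. Qed.

Lemma bform_mirror_first : bform A (mirror_vec y) (unit_vec first) = A first last.
Proof.
rewrite bform_unit !mxE lf !eqxx yl a_rev /=; ring.
Qed.

Lemma bform_mirror_last : bform A (mirror_vec y) (unit_vec last) = A first last.
Proof.
rewrite bform_unit rev_ordK !mxE [first == last]eq_sym lf !eqxx yf /=; ring.
Qed.

Lemma mirror_norm :
  bform A (mirror_vec y) (mirror_vec y) = 2%:R * A first last + bform A y y.
Proof.
rewrite {2}/mirror_vec !bformDr bform_mirror_first bform_mirror_last.
rewrite [bform A (mirror_vec y) y]bformC !bformDr !bform_unit rev_ordK yf yl; ring.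
Qed.
End Column.

Lemma degeneration_simil y : y first 0 = 0 -> y last 0 = 0 ->
  simil A (degeneration y)
    ((2%:R * A first last + bform A y y) ^+ 2 * (2%:R * A first last) ^+ 2).
Proof.
move=> yf yl.
have := similM (refl_mx_simil (mirror_vec y) A_sym) (refl_mx_simil (mirror_vec 0) A_sym).
have y0 : bform A 0 0 = 0 by rewrite /bform mulmx0 mxE.
by rewrite (mirror_norm yf yl) (mirror_norm (y := 0)) ?y0 ?addr0 // mxE.
Qed.

Lemma degeneration_col y k : y first 0 = 0 -> y last 0 = 0 ->
  degeneration y k first = 4%:R * A first last ^+ 2 * ((k == first)%:R + y k 0)
    - 2%:R * A first last * bform A y y * (k == last)%:R.
Proof.
move=> yf yl.
have -> : degeneration y k first = (degeneration y *m unit_vec first) k 0.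
  by rewrite -colE [RHS]mxE.
have y0 : bform A 0 0 = 0 by rewrite /bform mulmx0 mxE.
rewrite /degeneration -mulmxA [refl_mx _ (mirror_vec 0) *m _]refl_mx_mulv.
have z0 l : (0 : 'cV[R]_n) l 0 = 0 by rewrite mxE.
rewrite (mirror_norm (z0 _) (z0 _)) (bform_mirror_first (z0 _)) y0 addr0.
have -> : (2%:R * A first last) *: unit_vec first - (2%:R * A first last) *: mirror_vec 0
    = - (2%:R * A first last) *: unit_vec last.
  by apply/colP => l; rewrite !mxE !andbT; ring.
rewrite -scalemxAr refl_mx_mulv mirror_norm // bform_mirror_last //.
by move: (bform A y y) => q; rewrite !mxE !andbT; ring.
Qed.

End Degenerations.

Section SpecializationInCoordinates.
Variables (F : fieldType) (n : nat) (b e : 'M[F]_n).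
Hypothesis e_adapted : adapted_basis b e.
Variables (K : fieldType) (i : {rmorphism F -> K}).

Lemma map_of_coord_comp (R : comNzRingType) (L : fieldType) (f : {rmorphism K -> R})
    (g : {rmorphism R -> L}) (G : 'M[R]_n) :
  map_mx g (map_mx f (map_mx i e) *m G *m map_mx f (invmx (map_mx i e))) =
  of_coord e (g \o (f \o i)) (map_mx g G).
Proof.
by rewrite /of_coord !map_mxM -!map_mx_comp map_invmx -map_mx_comp.
Qed.

Lemma coord_specialization (G : 'M[{poly K}]_n) c t :
  simil (map_mx polyC (map_mx i (gram b e))) G c -> c.[t] != 0 ->
  [/\ closure [set coord_pt b e (generic_field i) (generic_mx G)] (coord_pt b e i (at_point t G)),
      is_simil (map_mx (generic_field i) (gram b e)) (generic_mx G)
    & is_simil (map_mx i (gram b e)) (at_point t G)].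
Proof.
move=> Gc ct; have c0 : c != 0 by apply: contra_neq ct => ->; rewrite horner0.
split; last by exists c.[t] => //; apply: simil_at.
  pose P : 'M[K]_n -> 'M[{poly K}]_n := map_mx polyC.
  have Eu := basis_unit e_adapted i.
  pose H := P (map_mx i e) *m G *m P (invmx (map_mx i e)).
  have Hc : simil (P (map_mx i b)) H c.
    apply: simil_conj; first by rewrite -map_mxM mulmxV // map_mx1.
    by rewrite /P map_trmx -!map_mxM -(map_gramE b e i).
  have -> : coord_pt b e i (at_point t G) = gpt b i (at_point t H).
    by rewrite /coord_pt /of_coord /H !at_pointM /at_point !at_point_const.
  have -> : coord_pt b e (generic_field i) (generic_mx G) = gpt b (generic_field i) (generic_mx H).
    congr (gpt _ _ _); apply/esym.
    exact: (map_of_coord_comp (polyC : {rmorphism K -> {poly K}})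
      (@tofrac {poly K} : {rmorphism {poly K} -> {fraction {poly K}}}) G).
  exact: path_specialization Hc ct.
exists (tofrac c); first by rewrite tofrac_eq0.
have := simil_map (@tofrac {poly K} : {rmorphism {poly K} -> {fraction {poly K}}}) Gc.
by rewrite -!map_mx_comp.
Qed.

End SpecializationInCoordinates.

(** * The Bruhat stack *)

Section BruhatStack.
Variables (F : fieldType) (n : nat) (b e : 'M[F]_n) (c : 'I_n -> int) (i1 : 'I_n./2).
Hypothesis n_ge3 : (3 <= n)%N.
Hypothesis n_even : ~~ odd n -> (3 <= n./2)%N.
Hypothesis two_neq0 : 2%:R != 0 :> F.
Hypothesis b_sym : b^T = b.
Hypothesis b_unit : b \in unitmx.
Hypothesis e_adapted : adapted_basis b e.
Local Notation first := (first n_ge3).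
Local Notation last := (rev_ord first).
Local Notation second := (second n_ge3).
Hypothesis cE : forall k, c k = (if k == first then 2 else if k == last then 0 else 1).
Hypothesis i10 : i1 = 0%N :> nat.
Local Notation s1 := (simple_refl i1).
Local Notation w1 := (longest_rep n_ge3).
Local Notation same_class := (@same_class F n b e c).
Local Notation stack_pt := (@to_stack F n b e c).
Local Notation weyl_pt := (weyl_pt b e).

Lemma stack_ptP (x y : GOspace b) : stack_pt x = stack_pt y <-> same_class x y.
Proof.
split=> [E|xy].
  have E' : (\pi_({eq_quot (stack_equiv b e c)}) x = \pi_({eq_quot (stack_equiv b e c)}) y)%qT.
    exact: E.
  by apply/asboolP; move/(eqmodP (stack_equiv b e c) x y): E'.
suff : (\pi_({eq_quot (stack_equiv b e c)}) x = \pi_({eq_quot (stack_equiv b e c)}) y)%qT by [].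
by apply/(eqmodP (stack_equiv b e c) x y)/asboolP.
Qed.

Lemma stack_pt_surj (x : bruhat_stack b e c) : exists y, x = stack_pt y.
Proof. by elim/quotW: x => y; exists y. Qed.

Lemma stack_pt_closure (x y : GOspace b) :
  closure [set x] y -> closure [set stack_pt x] (stack_pt y).
Proof.
move=> xy B By.
have [z [-> Bz]] := xy _ (@pi_continuous _ _ y B By).
by exists (stack_pt x).
Qed.

Lemma weyl_pt_type w : w \in weyl_hat n ->
  (fixed_pt e n_ge3 (weyl_pt w) <-> w first = first) /\
  (orthogonal_pt e n_ge3 (weyl_pt w) <-> w first <> last).
Proof.
move=> wh; have ws : is_simil (map_mx idfun (gram b e)) (wmx (gram b e) w).
  rewrite -[X in is_simil _ X](map_mx_id (f := idfun)) // map_wmx.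
  exact: wmx_is_simil.
have wu := is_simil_unit b_unit e_adapted ws.
have wm := @wmx_monomial F n (gram b e) w.
have w0 := monomial_coef first wu wm.
rewrite (fixed_ptE n_ge3 e_adapted ws) (orthogonal_ptE n_ge3 e_adapted ws); split; split.
- move=> fl; apply/eqP; apply: contraT => /fl wf; by rewrite wf eqxx in w0.
- by move=> wf; apply: monomial_fixes_line wm; apply/eqP.
- by move=> h wf; rewrite wf h eqxx in w0.
- by move=> /eqP wf; apply: wm; rewrite eq_sym.
Qed.

Lemma class_of_type (x : GOspace b) :
  [/\ fixed_pt e n_ge3 x -> same_class x (weyl_pt 1%g),
      ~ fixed_pt e n_ge3 x -> orthogonal_pt e n_ge3 x -> same_class x (weyl_pt s1)
    & ~ orthogonal_pt e n_ge3 x -> same_class x (weyl_pt w1)].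
Proof.
have st y z (yz : same_class y z) :=
  same_class_type n_even two_neq0 b_sym b_unit e_adapted cE yz.
have [f1 o1] := weyl_pt_type (weyl_hat1 n).
have [fs os] := weyl_pt_type (simple_refl_hat n_ge3 n_even i1).
have [fw ow] := weyl_pt_type (weyl_sub_hat (longest_rep_weyl n_ge3 n_even)).
have fl : first <> last by move/(congr1 val) => /=; lia.
move: f1 o1 fs os fw ow; rewrite perm1 (longest_rep_first n_ge3 n_even).
rewrite (simple_refl_first n_ge3 n_even i10) => f1 o1 fs os fw ow.
have sf : second <> first by move/(congr1 val).
have sl : n != 3%N -> second <> last by move=> n3 /(congr1 val) /=; lia.
case: (class_cases n_even two_neq0 b_sym b_unit e_adapted cE x i10) => [xw|[n3 xw]|xw].
- have [xf xo] := st _ _ xw; split=> //; first by case; apply/xf/f1.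
  by case; apply/xo/o1.
- move: fs os; rewrite (negbTE n3) => fs os; have [xf xo] := st _ _ xw; split=> //.
    by move=> /xf/fs.
  by case; apply/xo/os/sl.
- have [xf xo] := st _ _ xw; split=> //; first by move=> /xf/fw/esym.
  by move=> _ /xo/ow.
Qed.

(** The points x and x0 are the generic point of the family and its value at
    0. *)
Lemma degeneration_types (y : 'cV[{poly F}]_n) :
  let A := map_mx polyC (gram b e) in
  y first 0 = 0 -> y last 0 = 0 -> (bform A y y).[0] = 0 ->
  exists x x0 : GOspace b,
  [/\ closure [set stack_pt x] (stack_pt x0),
      orthogonal_pt e n_ge3 x <-> bform A y y = 0,
      y != 0 -> ~ fixed_pt e n_ge3 x,
      orthogonal_pt e n_ge3 x0
    & fixed_pt e n_ge3 x0 <-> forall k, (y k 0).[0] = 0].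
Proof.
move=> A yf yl y00; pose i : {rmorphism F -> F} := idfun.
have AE : A = map_mx polyC (map_mx i (gram b e)) by rewrite map_mx_id.
have A_sym : A^T = A by rewrite /A map_trmx gram_sym.
have A_anti k l : l != rev_ord k -> A k l = 0.
  by move=> kl; rewrite mxE (gram_anti e_adapted) ?rmorph0.
pose a := gram b e first last.
have aE : A first last = a%:P by rewrite mxE.
have a0 : a != 0.
  by apply: (anti_neq0 (gram_unit b_unit e_adapted)) => l m; apply: (gram_anti e_adapted).
have [G GE] : exists G, G = degeneration A n_ge3 y by exists (degeneration A n_ge3 y).
have Gcol k := degeneration_col A_sym A_anti k yf yl.
have Gsim := degeneration_simil A_sym A_anti yf yl.
rewrite -GE aE in Gcol Gsim; move: (bform A y y) y00 Gcol Gsim => q q0 Gcol Gsim.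
have four : 4%:R != 0 :> F by rewrite (natrM _ 2 2) mulf_neq0.
have nz : ((2%:R * a%:P + q) ^+ 2 * (2%:R * a%:P) ^+ 2).[0] != 0.
  by rewrite !hornerE q0 addr0 !mulf_neq0.
rewrite AE in Gsim.
have [cl gs ps] := coord_specialization e_adapted Gsim nz.
exists (coord_pt b e (generic_field i) (generic_mx G)), (coord_pt b e i (at_point 0 G)).
have fl : (last == first) = false by rewrite -(inj_eq val_inj) /=; lia.
have Glast : G last first = - (2%:R * a)%:P * q.
  by rewrite Gcol fl eqxx yl !rmorphM /= polyC_natr; ring.
have Gmid k : k != first -> k != last -> G k first = (4%:R * a ^+ 2)%:P * y k 0.
  by move=> kf kl; rewrite Gcol (negbTE kf) (negbTE kl) !rmorphM /= polyC_natr; ring.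
have c0 : (4%:R * a ^+ 2)%:P != 0 by rewrite polyC_eq0 mulf_neq0 ?expf_neq0.
split.
- exact: stack_pt_closure.
- rewrite (orthogonal_ptE n_ge3 e_adapted gs) mxE Glast; split=> [/eqP|->].
    rewrite tofrac_eq0 mulNr oppr_eq0 mulf_eq0 polyC_eq0 mulf_eq0.
    by rewrite (negbTE two_neq0) (negbTE a0) => /eqP.
  by rewrite mulr0 rmorph0.
- move=> y0 /(fixed_ptE n_ge3 e_adapted gs) H; move/eqP: y0; apply; apply/colP => k.
  rewrite [RHS]mxE; have [->//|kf] := eqVneq k first; have [->//|kl] := eqVneq k last.
  apply/eqP; move: (H k kf) => /eqP; rewrite mxE tofrac_eq0 Gmid // mulf_eq0.
  by rewrite (negbTE c0).
- by apply/(orthogonal_ptE n_ge3 e_adapted ps); rewrite mxE Glast /horner_eval hornerM q0 mulr0.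
rewrite (fixed_ptE n_ge3 e_adapted ps); split=> H k; last first.
  move=> kf; rewrite mxE /horner_eval; have [->|kl] := eqVneq k last.
    by rewrite Glast hornerM q0 mulr0.
  by rewrite Gmid // hornerM H mulr0.
have [->|kf] := eqVneq k first; first by rewrite yf horner0.
have [->|kl] := eqVneq k last; first by rewrite yl horner0.
move: (H k kf) => /eqP; rewrite mxE /horner_eval Gmid // hornerM hornerC mulf_eq0.
by rewrite -(polyC_eq0 (4%:R * _)) (negbTE c0) => /eqP.
Qed.

Let gram_anti_poly (k l : 'I_n) : l != rev_ord k -> map_mx polyC (gram b e) k l = 0.
Proof. by move=> kl; rewrite mxE (gram_anti e_adapted) ?rmorph0. Qed.

Let gram_anti_neq0 (k : 'I_n) : gram b e k (rev_ord k) != 0.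
Proof.
by apply: (anti_neq0 (gram_unit b_unit e_adapted)) => l m; apply: (gram_anti e_adapted).
Qed.

(** The choice y = X e_1 moves the line inside the orthogonal complement of
    e_0, unless n = 3, where e_1 is anisotropic and the generic position is
    that of w_1 = s_1. *)
Lemma closure_simple_refl :
  closure [set stack_pt (weyl_pt s1)] (stack_pt (weyl_pt 1%g)).
Proof.
have [fs ls] : (first == second) = false /\ (last == second) = false.
  by split; rewrite -(inj_eq val_inj) /=; lia.
pose y : 'cV[{poly F}]_n := 'X *: unit_vec _ second.
have yE k : y k 0 = 'X * (k == second)%:R by rewrite !mxE andbT.
have yy : bform (map_mx polyC (gram b e)) y y =
    'X ^+ 2 * (second == rev_ord second)%:R * (gram b e second (rev_ord second))%:P.
  rewrite {2}/y bformZr (bform_unit gram_anti_poly) yE [map_mx _ _ _ _]mxE.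
  rewrite [rev_ord _ == _]eq_sym; case: eqP => [<-|_] /=; ring.
have [||| x [x0 [cl xo xf x0o x0f]]] := @degeneration_types y.
- by rewrite yE fs mulr0.
- by rewrite yE ls mulr0.
- by rewrite yy !hornerM hornerX !mul0r.
have y0 : y != 0.
  by apply/eqP => /colP/(_ second)/eqP; rewrite yE mxE eqxx mulr1 polyX_eq0.
have [x1 _ _] := class_of_type x0.
have <- : stack_pt x0 = stack_pt (weyl_pt 1%g).
  by apply/stack_ptP/x1/x0f => k; rewrite yE hornerM hornerX mul0r.
suff <- : stack_pt x = stack_pt (weyl_pt s1) by [].
have [_ x2 x3] := class_of_type x; apply/stack_ptP.
have [n3|n3] := eqVneq n 3%N; last first.
  apply: x2; first exact: xf.
  apply/xo; rewrite yy [second == _](_ : _ = false) ?mulr0 ?mul0r //.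
  by rewrite -(inj_eq val_inj) /=; lia.
rewrite (simple_refl_longest_rep n_ge3 n_even i10 n3); apply: x3 => /xo/eqP.
rewrite yy [second == _](_ : _ = true); last by rewrite -(inj_eq val_inj) /=; lia.
by rewrite mulr1 mulf_eq0 polyC_eq0 (negbTE (gram_anti_neq0 _)) expf_eq0 /= polyX_eq0.
Qed.

(** For y = e_1 + X e_(n-2) the norm of y vanishes at 0 but y does not. *)
Lemma closure_longest_rep :
  closure [set stack_pt (weyl_pt w1)] (stack_pt (weyl_pt s1)).
Proof.
have [n3|n3] := eqVneq n 3%N.
  by rewrite (simple_refl_longest_rep n_ge3 n_even i10 n3); apply: subset_closure.
have [fs ls] : (first == second) = false /\ (last == second) = false.
  by split; rewrite -(inj_eq val_inj) /=; lia.
have [fr lr sr] : [/\ (first == rev_ord second) = false, (last == rev_ord second) = false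
   & (second == rev_ord second) = false].
  by split; rewrite -(inj_eq val_inj) /=; lia.
pose y : 'cV[{poly F}]_n := unit_vec _ second + 'X *: unit_vec _ (rev_ord second).
have yE k : y k 0 = (k == second)%:R + 'X * (k == rev_ord second)%:R.
  by rewrite !mxE !andbT.
have yy : bform (map_mx polyC (gram b e)) y y =
    'X * (2%:R * gram b e second (rev_ord second))%:P.
  rewrite {2}/y bformDr bformZr !(bform_unit gram_anti_poly) rev_ordK !yE.
  rewrite ![map_mx _ _ _ _]mxE !eqxx [rev_ord _ == _]eq_sym sr.
  have -> : gram b e (rev_ord second) second = gram b e second (rev_ord second).
    by rewrite -[in LHS](gram_sym e b_sym) mxE.
  rewrite rmorphM /= polyC_natr; ring.
have [||| x [x0 [cl xo xf x0o x0f]]] := @degeneration_types y.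
- by rewrite yE fs fr mulr0 addr0.
- by rewrite yE ls lr mulr0 addr0.
- by rewrite yy hornerM hornerX mul0r.
have [_ x2 _] := class_of_type x0; have [_ _ x3] := class_of_type x.
have <- : stack_pt x0 = stack_pt (weyl_pt s1).
  apply/stack_ptP/x2 => // /x0f/(_ second)/eqP.
  by rewrite yE eqxx sr mulr0 addr0 hornerC oner_eq0.
suff <- : stack_pt x = stack_pt (weyl_pt w1) by [].
apply/stack_ptP/x3 => /xo/eqP; rewrite yy mulf_eq0 polyX_eq0 polyC_eq0 mulf_eq0.
by rewrite (negbTE two_neq0) (negbTE (gram_anti_neq0 _)).
Qed.

Lemma stack_cases (x : bruhat_stack b e c) :
  [\/ x = stack_pt (weyl_pt 1%g), x = stack_pt (weyl_pt s1) | x = stack_pt (weyl_pt w1)].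
Proof.
have [y ->] := stack_pt_surj x.
case: (class_cases n_even two_neq0 b_sym b_unit e_adapted cE y i10) => [H|[_ H]|H].
- by apply: Or31; apply/stack_ptP.
- by apply: Or32; apply/stack_ptP.
- by apply: Or33; apply/stack_ptP.
Qed.

(** The stack is the closure of the point of w_1. *)
Lemma stack_connected : connected [set: bruhat_stack b e c].
Proof.
suff <- : closure [set stack_pt (weyl_pt w1)] = [set: bruhat_stack b e c].
  exact/connected_closure/connected1.
apply/seteqP; split => // x _.
have s1w1 := closure_longest_rep.
case: (stack_cases x) => ->; [|exact: s1w1|exact: subset_closure].
have sub : closure [set stack_pt (weyl_pt s1)] `<=` closure [set stack_pt (weyl_pt w1)].
  rewrite [X in _ `<=` X](closure_id _).1; last exact: closed_closure.
  by apply: closure_subset => z ->.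
exact/sub/closure_simple_refl.
Qed.

(** All monomial similitudes for w give the same point, and by weyl_neutral
    one of them lies in the identity component. *)
Lemma labelled_by_weyl w : w \in weyl n ->
  labelled_by w = [set stack_pt (weyl_pt w)].
Proof.
move=> ww; have wh := weyl_sub_hat ww; apply/seteqP; split=> [x|x ->].
  move=> [K [i [g [gGO [[_ gw] ->]]]]]; apply/stack_ptP.
  rewrite -(gptE gGO) -(in_basisK e_adapted i g).
  have gs := GO_in_basis e_adapted gGO.
  exact: (monomial_class n_even b_sym b_unit e_adapted cE wh gs gw).
pose i : {rmorphism F -> F} := idfun.
have [g gn gw] := weyl_neutral n_ge3 n_even two_neq0 b_sym b_unit e_adapted i ww.
have gs := neutral_simil gn.
have gGO : GO b i (of_coord e i g) by apply/(GO_of_coord e_adapted).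
exists F, i, (of_coord e i g), gGO; split.
  split; first exact/neutral_GOo/(neutral_of_coord e_adapted).
  by rewrite (of_coordK e_adapted).
apply/esym/stack_ptP; rewrite -(gptE gGO).
exact: (monomial_class n_even b_sym b_unit e_adapted cE wh gs gw).
Qed.

Lemma weyl_pt_inj : {in [set 1%g; s1; w1]%SET &, injective (fun w => stack_pt (weyl_pt w))}.
Proof.
have mem w : w \in [set 1%g; s1; w1]%SET -> [\/ w = 1%g, w = s1 | w = w1].
  by rewrite !inE => /orP[/orP[]|] /eqP->; [apply: Or31|apply: Or32|apply: Or33].
have wh w : [\/ w = 1%g, w = s1 | w = w1] -> w \in weyl_hat n.
  case=> ->; [exact: weyl_hat1|exact: simple_refl_hat|].
  exact/weyl_sub_hat/longest_rep_weyl.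
have fl : first <> last by move/(congr1 val) => /=; lia.
have sf : second <> first by move/(congr1 val).
have w1f := longest_rep_first n_ge3 n_even.
have s1f := simple_refl_first n_ge3 n_even i10.
move=> v w /mem vm /mem wm /stack_ptP vw.
have := same_class_type n_even two_neq0 b_sym b_unit e_adapted cE vw.
have [-> ->] := weyl_pt_type (wh _ vm); have [-> ->] := weyl_pt_type (wh _ wm).
have sl : n != 3%N -> second <> last by move=> n3 /(congr1 val) /=; lia.
have n3E : n == 3%N -> s1 = w1 by move/eqP; exact: simple_refl_longest_rep.
case: (boolP (n == 3%N)) n3E sl s1f => n3 n3E sl s1f.
  by case: vm => ->; case: wm => ->; rewrite ?perm1 ?w1f ?s1f // ?n3E //; intuition.
by case: vm => ->; case: wm => ->; rewrite ?perm1 ?w1f ?s1f //; intuition.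
Qed.

Lemma weyl_pt_uniq : n != 3%N ->
  uniq [:: stack_pt (weyl_pt 1%g); stack_pt (weyl_pt s1); stack_pt (weyl_pt w1)].
Proof.
move=> n3; have w1f := longest_rep_first n_ge3 n_even.
have := simple_refl_first n_ge3 n_even i10; rewrite (negbTE n3) => s1f.
have ne v w : v \in [set 1%g; s1; w1]%SET -> w \in [set 1%g; s1; w1]%SET ->
    v first != w first -> stack_pt (weyl_pt v) != stack_pt (weyl_pt w).
  by move=> vm wm; apply: contra => /eqP/(weyl_pt_inj vm wm)->.
have [fl fs sl] : [/\ first != last, first != second & second != last].
  by rewrite -!(inj_eq val_inj) /=; split; lia.
have [m1 ms mw] : [/\ 1%g \in [set 1%g; s1; w1]%SET, s1 \in [set 1%g; s1; w1]%SET
    & w1 \in [set 1%g; s1; w1]%SET] by rewrite !inE !eqxx !orbT.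
have uniq3 (T : eqType) (x y z : T) : x != y -> x != z -> y != z -> uniq [:: x; y; z].
  by move=> xy xz yz; rewrite /= !inE negb_or xy xz yz.
by apply: uniq3; apply: ne; rewrite ?perm1 ?w1f ?s1f.
Qed.

End BruhatStack.

Theorem mainTheorem7 (p k : nat) (F : finFieldType) (n : nat) (b e : 'M[F]_n)
    (c : 'I_n -> int) (i1 : 'I_(n./2))
    (p_prime : prime p) (p_odd : odd p) (F_card : #|F| = (p ^ k)%N)
    (n_ge3 : (3 <= n)%N) (n_even : ~~ odd n -> (3 <= n./2)%N)
    (b_sym : b^T = b) (b_nondeg : b \in unitmx) (b_split : split_form b)
    (e_adapted : adapted_basis b e)
    (mu_cochar : is_cochar b e c)
    (mu_weights : [/\ #|[set i | c i == 0]%SET| = 1%N,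
                      #|[set i | c i == 1]%SET| = (n - 2)%N
                    & #|[set i | c i == 2]%SET| = 1%N])
    (mu_dominant : dominant c)
    (i1_first : i1 = 0%N :> nat) :
  let JWK := min_dcoset_reps (typeJ c) (typeK c) in
  let s1 := simple_refl i1 in
  exists (w1 : 'S_n) (pt : 'S_n -> bruhat_stack b e c),
    [/\ (* w1 is the element of maximal length of JWK *)
        w1 \in JWK /\
        (forall w, w \in JWK -> w != w1 -> (weyl_length w < weyl_length w1)%N),
        (* the points are parametrised by JWK *)
        JWK = [set 1%g; s1; w1]%SET /\
        (forall w, w \in JWK -> labelled_by w = [set pt w]),
        connected [set: bruhat_stack b e c],
        (* precisely three points; s1 = w1 if n = 3 *)
        [/\ forall x, x = pt 1%g \/ x = pt s1 \/ x = pt w1,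
            {in JWK &, injective pt}
          & n != 3%N -> uniq [:: pt 1%g; pt s1; pt w1]]
      & closure [set pt s1] (pt 1%g) /\ closure [set pt w1] (pt s1)].
Proof.

have two_neq0 : 2%:R != 0 :> F.
  have p_char := finfield.card_finPcharP F_card p_prime.
  apply: contraL p_odd => two0; have : 2%N \in [pchar F] by rewrite inE /= two0.
  by rewrite (pcharf_eq p_char) inE => /eqP <-.
case: mu_weights => h0 h1 h2.
have cE := cocharE n_ge3 n_even b_nondeg e_adapted mu_cochar mu_dominant h0 h1 h2.
move=> JWK s1.
have JWKE : JWK = [set 1%g; s1; longest_rep n_ge3]%SET.
  rewrite /JWK (typeJE n_even cE) (typeKE n_even cE).
  exact: min_dcoset_repsE.
exists (longest_rep n_ge3), (fun w => to_stack e c (weyl_pt b e w)).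
rewrite JWKE; split.
- split; first by rewrite !inE eqxx orbT.
  by move=> w ww wn; apply: (longest_rep_longest n_even i1_first ww wn).
- split=> // w; rewrite -JWKE inE => /andP[ww _].
  exact: (labelled_by_weyl n_even two_neq0 b_sym b_nondeg e_adapted cE ww).
- exact: (stack_connected n_even two_neq0 b_sym b_nondeg e_adapted cE i1_first).
- split.
  + move=> x.
    by case: (stack_cases n_even two_neq0 b_sym b_nondeg e_adapted cE i1_first x); auto.
  + exact: (weyl_pt_inj n_even two_neq0 b_sym b_nondeg e_adapted cE i1_first).
  + exact: (weyl_pt_uniq n_even two_neq0 b_sym b_nondeg e_adapted cE i1_first).
- split.
  + exact: (closure_simple_refl n_even two_neq0 b_sym b_nondeg e_adapted cE i1_first).
  + exact: (closure_longest_rep n_even two_neq0 b_sym b_nondeg e_adapted cE i1_first).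
Qed.
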